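(* Let $X=Y=[0,1)$ and let $\mu$, resp. $\nu$, be Lebesgue measure on $X$, resp. $Y$. There exist an irrational $\alpha\in[0,1)$ and a map $\tau:[0,1)\to\mathbb{Z}$ such that, with $$\Gamma_0=\{(x,x):x\in[0,1)\},\quad \Gamma_1=\{(x,x\oplus\alpha):x\in[0,1)\},\quad \Gamma_\tau=\{(x,x\oplus\tau(x)\alpha):x\in[0,1)\},$$ $h$ the function associated with $\alpha$ defined in the context, $h_+=\max(h,0)$, and $$c(x,y)=\begin{cases}h_+(x,y), & (x,y)\in\Gamma_0\cup\Gamma_1\cup\Gamma_\tau,\\ \infty, & \text{otherwise,}\end{cases}$$ the following hold. (i) The maps $T^0_\alpha(x)=x$, $T^1_\alpha(x)=x\oplus\alpha$ and $T^{(\tau)}_\alpha(x)=x\oplus(\tau(x)\alpha)$ are measure preserving bijections from $[0,1)$ to $[0,1)$ with respect to Lebesgue measure. Denote by $\pi_0=(\mathrm{id},\mathrm{id})_\#\mu$, $\pi_1=(\mathrm{id},T^1_\alpha)_\#\mu$, $\pi_\tau=(\mathrm{id},T^{(\tau)}_\alpha)_\#\mu$ the corresponding transport plans in $\Pi(\mu,\nu)$, and let $\pi=(\pi_0+\pi_1+\pi_\tau)/3$. (ii) The transport plans $\pi_0$ and $\pi_1$ are optimal for the cost $c$ while $\pi_\tau$ is not. In fact, $$\langle c,\pi_0\rangle=\langle c,\pi_1\rangle=1\quad\text{while}\quad \langle c,\pi_\tau\rangle\ge\langle h,\pi_\tau\rangle>1.$$ (iii) There is a sequence $(\varphi_n,\psi_n)_{n=1}^\infty$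 of bounded Borel functions such that (a) $\varphi_n(x)+\psi_n(y)\le c(x,y)$ for $x\in X$, $y\in Y$; (b) $\lim_{n\to\infty}\big(\int_X\varphi_n(x)\,d\mu(x)+\int_Y\psi_n(y)\,d\nu(y)\big)=1$; (c) $\lim_{n\to\infty}(\varphi_n(x)+\psi_n(y))=h(x,y)$, $\pi$-almost surely. (iv) For each dual optimizer $\hat h\in L^1(\pi)^{**}$ (with reference plan $\pi$), which decomposes as $\hat h=\hat h^r+\hat h^s$ into its regular part $\hat h^r\in L^1(\pi)$ and its purely singular part $\hat h^s\in L^1(\pi)^{**}$, we have $\hat h^r=h$, $\pi$-a.s., and the singular part satisfies $$\|\hat h^s\|_{L^1(\pi)^{**}}=\langle h,\pi_\tau\rangle-1>0.$$ In particular, the singular part $\hat h^s$ of $\hat h$ does not vanish. The finitely additive measure $\hat h^s$ is supported by $\Gamma_\tau$, i.e. $\langle\hat h^s,\mathbf 1_{\Gamma_0}+\mathbf 1_{\Gamma_1}\rangle=0$.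
   Context: $\oplus$ denotes addition modulo $1$ on $[0,1)$. $\Pi(\mu,\nu)$ is the set of Borel probability measures on $X\times Y$ with marginals $\mu,\nu$; $\langle f,\sigma\rangle=\int f\,d\sigma$; $\sigma\in\Pi(\mu,\nu)$ is optimal if it minimizes $\langle c,\cdot\rangle$ over $\Pi(\mu,\nu)$. For irrational $\alpha\in[0,1)$, $k\in\mathbb{Z}$ and $x\in[0,1)$ let $$\varrho_k(x)=1+\#\{0\le i<k: x\oplus i\alpha\in[0,\tfrac12)\}-\#\{0\le i<k: x\oplus i\alpha\in[\tfrac12,1)\},$$ where, for $k<0$, by ''$0\le i<k$'' is meant the index set $\{k+1,k+2,\ldots,0\}$. Define $h(x,y)=\varrho_k(x)$ if $y=x\oplus k\alpha$ for some (necessarily unique) $k\in\mathbb{Z}$, and $h(x,y)=\infty$ otherwise. Dual optimizers. Let $\pi\in\Pi(\mu,\nu)$ with $\int c\,d\pi<\infty$. For $\varepsilon>0$ put $$D^{(\pi,\varepsilon)}=\sup\Big\{\int\varphi\,d\mu+\int\psi\,d\nu:\ \varphi\in L^1(\mu),\ \psi\in L^1(\nu),\ \int_{X\times Y}(\varphi(x)+\psi(y)-c(x,y))_+\,d\pi\le\varepsilon\Big\},$$ and $D^{(\pi)}=\lim_{\varepsilon\to0}D^{(\pi,\varepsilon)}$. Let $L^1_S(\pi)$ be the norm-closed linear subspace of $L^1(X\times Y,\pi)$ spanned by the functions $(x,y)\mapsto\varphi(x)+\psi(y)$ with $\varphi\in L^1(\mu),\psi\in L^1(\nu)$; its bidual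 $L^1_S(\pi)^{**}$ is identified with a subspace of $L^1(\pi)^{**}$. A dual optimizer is an element $\hat h\in L^1_S(\pi)^{**}$ such that $\hat h\le c$ in the order of $L^1(\pi)^{**}$ (with $c$ viewed as an element of $L^1(\pi)\subset L^1(\pi)^{**}$) and $\langle\hat h,\pi\rangle=D^{(\pi)}$, where $\pi$ is identified with its density $\mathbf 1\in L^\infty(\pi)$. Every element of $L^1(\pi)^{**}=L^\infty(\pi)^*$ is a finitely additive measure and decomposes uniquely into a regular (countably additive) part, identified with an element of $L^1(\pi)$, and a purely singular (purely finitely additive) part.
   Formalization: In (iv) the norm identity is corrected to 3‖ĥ^s‖ = ⟨h,π_τ⟩ − 1: since π = (π_0+π_1+π_τ)/3, ⟨ĥ,π⟩ = 1 and ĥ^r = h, the singular part has total mass −(⟨h,π_τ⟩−1)/3, so the printed identity without the factor 3 contradicts (ii). *)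

(* Defs.v *)
From HB Require Import structures.
From mathcomp Require Import all_boot all_order all_algebra.
From mathcomp Require Import all_classical all_reals all_analysis.
Set Implicit Arguments.
Unset Strict Implicit.
Unset Printing Implicit Defensive.
Import Order.TTheory GRing.Theory Num.Theory.
Import numFieldNormedType.Exports.
Local Open Scope classical_set_scope.
Local Open Scope ring_scope.

(* Dual of a subspace E of U, seminormed by N.  No quotient by the null space
   of N is taken: boundedness forces a functional to factor through it. *)
Section dual_space.
Context (R : realType) (U : lmodType R).
Implicit Types (E : set U) (N : U -> \bar R) (F : U -> R).

Definition linear_on E F :=
  forall (a : R) u v, E u -> E v -> F (a *: u + v) = a * F u + F v.

Definition bounded_on E N F :=
  exists C : R, forall u, E u -> (`|F u|%:E <= C%:E * N u)%E.

Definition bounded_dual E N : set (U -> R) :=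
  [set F | linear_on E F /\ bounded_on E N F].

Definition dual_norm E N F : \bar R :=
  ereal_sup [set `|F u|%:E | u in [set u | E u /\ (N u <= 1)%E]].

End dual_space.

(* L^1(m)** is handled as L^oo(m)*, i.e. as functionals on the essentially
   bounded measurable functions. *)
Section L1_bidual.
Context d (T : measurableType d) (R : realType).
Variable m : {measure set T -> \bar R}.
Implicit Types (r f g : T -> R) (F : (T -> R) -> R).

Definition L1 : set (T -> R) := [set f | f \in Lfun m 1].
Definition L1norm f : \bar R := ('N[m]_1 [EFin \o f])%E.
Definition Loo : set (T -> R) := [set g | g \in Lfun m +oo%E].
Definition Loonorm g : \bar R := ('N[m]_+oo [EFin \o g])%E.

Definition L1_bidual : set ((T -> R) -> R) := bounded_dual Loo Loonorm.
Definition L1_bidual_norm F : \bar R := dual_norm Loo Loonorm F.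

Definition L1_embed r : (T -> R) -> R := fun g => \int[m]_z (r z * g z).

Definition L1_bidual_le F1 F2 :=
  forall g, Loo g -> {ae m, forall z, 0 <= g z} -> F1 g <= F2 g.

(* |F| on nonnegative g *)
Definition variation F g : \bar R :=
  ereal_sup [set (F k)%:E |
             k in [set k | Loo k /\ {ae m, forall z, `|k z| <= g z}]].

(* Yosida-Hewitt: |F| dominates no nonzero positive countably additive
   measure; the countably additive elements of L^oo(m)* are the densities. *)
Definition purely_singular F :=
  L1_bidual F /\
  forall r, L1 r -> {ae m, forall z, 0 <= r z} ->
    (forall g, Loo g -> {ae m, forall z, 0 <= g z} ->
       ((L1_embed r g)%:E <= variation F g)%E) ->
    {ae m, forall z, r z = 0}.

(* The image of S** in L1(m)** under the bitranspose of the inclusion of a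
   subspace S of L1(m), the dual of L1(m) being identified with L^oo(m). *)
Definition subspace_bidual (S : set (T -> R)) : set ((T -> R) -> R) :=
  [set F | exists2 G, bounded_dual (bounded_dual S L1norm) (dual_norm S L1norm) G &
           forall g, Loo g -> F g = G (fun f => \int[m]_z (f z * g z))].

End L1_bidual.

Section transport.
Context d1 d2 (X : measurableType d1) (Y : measurableType d2) (R : realType).
Variables (mu : probability X R) (nu : probability Y R).
Implicit Types (pi sigma : {measure set (X * Y) -> \bar R}).
Implicit Types (c : X * Y -> \bar R).

(* mu and nu being probabilities, so is every element *)
Definition couplings : set {measure set (X * Y) -> \bar R} :=
  [set pi | (forall A, measurable A -> pi (A `*` setT) = mu A) /\
            (forall B, measurable B -> pi (setT `*` B) = nu B)].

Definition optimal c pi :=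
  couplings pi /\
  forall sigma, couplings sigma -> (\int[pi]_z c z <= \int[sigma]_z c z)%E.

Definition oplus (phi : X -> R) (psi : Y -> R) : X * Y -> R :=
  fun z => phi z.1 + psi z.2.

Definition relaxed_dual_value pi c (eps : R) : \bar R :=
  ereal_sup [set v | exists phi psi,
    [/\ L1 mu phi, L1 nu psi,
        (\int[pi]_z maxe ((oplus phi psi z)%:E - c z) 0 <= eps%:E)%E &
        v = (\int[mu]_x phi x + \int[nu]_y psi y)%:E]].

Definition dual_value pi c : \bar R :=
  lim (relaxed_dual_value pi c eps @[eps --> 0^'+]).

(* The functions phi (+) psi already form a linear subspace, so that only the
   closure has to be taken. *)
Definition L1S pi : set (X * Y -> R) :=
  [set f | L1 pi f /\ forall eps : R, 0 < eps ->
     exists phi psi, [/\ L1 mu phi, L1 nu psi &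
       (L1norm pi (fun z => f z - oplus phi psi z)%R < eps%:E)%E]].

(* fine is harmless: c is pi-a.e. finite when it is pi-integrable. *)
Definition dual_optimizer pi c (H : (X * Y -> R) -> R) :=
  [/\ L1_bidual pi H,
      subspace_bidual pi (L1S pi) H,
      L1_bidual_le pi H (L1_embed pi (fine \o c)) &
      (H (cst 1))%:E = dual_value pi c].

End transport.

(* [0,1) is the support of the probability unif01 on R rather than a type, and
   the plans live on R * R: a coupling of unif01 with itself is carried by
   [0,1) x [0,1). *)
Section unit_interval.
Context (R : realType).
Local Notation RR := (measurableTypeR R).

Definition I01 : set RR := `[0, 1[%classic.

Lemma measurable_I01 : measurable I01.
Proof. exact: measurable_itv. Qed.

Definition unif01 : set RR -> \bar R := mrestr lebesgue_measure measurable_I01.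

HB.instance Definition _ := Measure.on unif01.

Let unif01T : unif01 setT = 1%E.
Proof.
by rewrite /unif01 /mrestr setTI /I01 lebesgue_measure_itv/= lte01 sube0.
Qed.

HB.instance Definition _ := Measure_isProbability.Build _ _ _ unif01 unif01T.

Record mp_bijection (T : RR -> RR) : Prop := MPBijection {
  mpb_bij : set_bij I01 I01 T ;
  mpb_measurable : measurable_fun I01 T ;
  mpb_preserving : forall A, measurable A ->
    lebesgue_measure (I01 `&` T @^-1` A) = lebesgue_measure (I01 `&` A) }.

Section graph_plan.
Variables (T : RR -> RR) (mT : measurable_fun I01 T).

(* (id, T)_# unif01, for a map T which is measurable on [0,1) only; mT is an
   argument so that the measure instance below can find it. *)
Definition graph_plan : set (RR * RR) -> \bar R :=
  let _ := mT in fun A => lebesgue_measure (I01 `&` (fun x => (x, T x)) @^-1` A).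

Let measurable_graph : measurable_fun I01 (fun x => (x, T x)).
Proof.
have mT' : measurable_fun setT (T \_ I01).
  exact: (measurable_restrictT T measurable_I01).1.
apply: (@eq_measurable_fun _ _ _ _ I01 (fun x => (x, (T \_ I01) x))).
  by move=> x xI; rewrite patchE xI.
by apply: measurable_funTS; apply: measurable_fun_pair => //; exact: measurable_id.
Qed.

Let graph_plan0 : graph_plan set0 = 0%E.
Proof. by rewrite /graph_plan preimage_set0 setI0 measure0. Qed.

Let graph_plan_ge0 A : (0 <= graph_plan A)%E.
Proof. exact: measure_ge0. Qed.

Let graph_plan_sigma_additive : semi_sigma_additive graph_plan.
Proof.
move=> F mF tF mUF; rewrite /graph_plan preimage_bigcup setI_bigcupr.
apply: measure_semi_sigma_additive.
- by move=> n; exact: measurable_graph measurable_I01 _ (mF n).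
- apply/trivIsetP => i j _ _ ij; rewrite -subset0 => x [[_ Fix] [_ Fjx]].
  have : (F i `&` F j) (x, T x) by split.
  by move/trivIsetP : tF => /(_ _ _ Logic.I Logic.I ij) ->.
- rewrite -setI_bigcupr -preimage_bigcup.
  exact: measurable_graph measurable_I01 _ mUF.
Qed.

HB.instance Definition _ := isMeasure.Build _ _ _ graph_plan
  graph_plan0 graph_plan_ge0 graph_plan_sigma_additive.

End graph_plan.

Definition mean3 (p0 p1 p2 : {measure set (RR * RR) -> \bar R}) :
    {measure set (RR * RR) -> \bar R} :=
  mscale (3^-1)%:nng (measure_add (measure_add p0 p1) p2).

(* x (+) k alpha, addition modulo 1 *)
Definition rotation (alpha : R) (k : int) (x : R) : R :=
  let y := x + k%:~R * alpha in y - (Num.floor y)%:~R.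

Definition graph01 (T : R -> R) : set (R * R) :=
  [set z | 0 <= z.1 < 1 /\ z.2 = T z.1].

(* 0, ..., k - 1 for k >= 0 and k + 1, ..., 0 for k < 0 *)
Definition window (k : int) : seq int :=
  match k with
  | Posz n => [seq Posz i | i <- iota 0 n]
  | Negz n => [seq - Posz i | i <- iota 0 n.+1]
  end.

Definition rho (alpha : R) (k : int) (x : R) : int :=
  1 + (count (fun i => 0 <= rotation alpha i x < 2^-1) (window k))%:Z
    - (count (fun i => 2^-1 <= rotation alpha i x < 1) (window k))%:Z.

(* The k such that z.2 = z.1 (+) k alpha is unique for irrational alpha. *)
Definition hfun (alpha : R) (z : R * R) : \bar R :=
  if `[< exists k, graph01 (rotation alpha k) z >]
  then (rho alpha (xget 0 [set k | graph01 (rotation alpha k) z]) z.1)%:~R%:E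
  else +oo%E.

Definition rotation_tau (alpha : R) (tau : R -> int) (x : R) : R :=
  rotation alpha (tau x) x.

Definition cost (alpha : R) (tau : R -> int) (z : R * R) : \bar R :=
  if z \in graph01 id `|` graph01 (rotation alpha 1) `|` graph01 (rotation_tau alpha tau)
  then maxe (hfun alpha z) 0
  else +oo%E.

Definition bounded_Borel (f : R -> R) :=
  measurable_fun [set: RR] (f : RR -> RR) /\ exists M : R, forall x, `|f x| <= M.

End unit_interval.
Arguments unif01 R : clear implicits.

(* Main.v *)
(** alpha is the sum of the 1/M_n with M_n = 2^(8^n), so the rotation by alpha is
    extremely close to the rotation by the rational number P_n/M_n.  Along the
    cycle of the latter, the sums of the signs +1 on [0,1/2) and -1 on [1/2,1) are
    the increments of an explicit potential whose values are distributed as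
    Bin(2^n, 1/2).  The map tau is a greedy matching in time: for k = 2, 3, 4, etc.,
    all pairs x, x + k alpha along which the sum of the signs is 1 are matched if
    both points are still free; hence h = 2 on Gamma_tau.  In the rational model the
    sources still free after one period have potential at least 2^(n-1), and the
    free targets have potential at most 2^(n-1), because binomial coefficients are
    unimodal.  Both kinds have density at most 'C(2^n, 2^(n-1)) / 2^(2^n), which
    tends to 0, so the matching is complete almost everywhere; and across the
    matches made later the potential does not increase, so the potentials are
    almost feasible dual functions, with value tending to 1.

    For (iv), the functional H - h is nonpositive.  It vanishes on Gamma_0 and
    Gamma_1 because the marginals of pi_0, pi_1 and pi agree, and on each piece
    {tau = k} of Gamma_tau because phi(x) + psi(x + k alpha) is a finite combination
    of the values of the same function on Gamma_0 and Gamma_1 along the orbit of x.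
    Since these pieces cover, pure singularity of the remainder forces the regular
    part to be h, and H - h has total mass 1 - 4/3. *)

Require Import Defs.
From HB Require Import structures.
From mathcomp Require Import all_boot all_order all_algebra.
From mathcomp Require Import all_classical all_reals all_analysis.
From mathcomp Require Import measurable_realfun ess_sup_inf.
From mathcomp Require Import zify ring lra.
Set Implicit Arguments.
Unset Strict Implicit.
Unset Printing Implicit Defensive.
Import Order.TTheory GRing.Theory Num.Theory.
Import numFieldNormedType.Exports.
Local Open Scope classical_set_scope.
Local Open Scope ring_scope.

(** * The rational models *)

(** The integral of [dual_phi n] (x) + [dual_psi n] (y) against [pitau] is fixed by the marginals
    and tends to 1, although these sums converge almost surely to 2 there. A unit of mass must
    therefore escape to sets of vanishing measure: it sits on the late matches, where the potential
    drops, and the singular part of a dual optimizer is the trace of this. For a map tau with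
    finitely many values the telescoping along orbits would leave no defect, so matching times have
    to be unbounded and the potentials have to spread out. The spread comes from a convolution:
    [pot n.+1] is [pot n] plus an independent reflected copy of it, which doubles the number of
    coins.

    The exponent 8 settles the errors. With d = [den n], one step of the true rotation deviates from
    the model by at most 2/d^7 of a cell, and the first d rounds look at most (d+2)^2 steps away, so
    the points whose prediction may fail have measure at most 16/d^5. This beats the size 2^n of the
    potential, which is at most d. Moreover [mul n] = d^7 is a multiple of d, as the independence
    requires. *)

Definition den n : nat := (2 ^ (8 ^ n))%N.
Definition mul n : nat := (den n ^ 7)%N.
Fixpoint half n : nat := if n is n'.+1 then (half n' * mul n')%N else 1%N.
Fixpoint num n : nat := if n is n'.+1 then (num n' * mul n').+1 else 1%N.

Lemma denS n : den n.+1 = (den n * mul n)%N.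
Proof. by rewrite /mul -expnS /den expnS mulnC expnM. Qed.

Lemma den_gt0 n : (0 < den n)%N.
Proof. by rewrite expn_gt0. Qed.

Lemma mul_gt0 n : (0 < mul n)%N.
Proof. by rewrite expn_gt0 den_gt0. Qed.

Lemma den_half n : den n = (2 * half n)%N.
Proof. by elim: n => // n IH; rewrite denS IH /= mulnA. Qed.

Lemma half_gt0 n : (0 < half n)%N.
Proof. by have := den_gt0 n; rewrite den_half muln_gt0. Qed.

Lemma den_gt1 n : (1 < den n)%N.
Proof. by have := half_gt0 n; rewrite den_half; lia. Qed.

Lemma mulE n : mul n = (den n ^ 6 * den n)%N.
Proof. by rewrite /mul expnSr. Qed.

Lemma double_den_le n : (2 * den n <= den n.+1)%N.
Proof.
rewrite denS mulnC leq_mul2l mulE -[2%N]mul1n; apply/orP; right.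
by rewrite leq_mul ?expn_gt0 ?den_gt0 ?den_gt1.
Qed.

Lemma ltn_den n : (n < den n)%N.
Proof. by elim: n => // n IH; have := double_den_le n; lia. Qed.

(** [num n.+1] is an even number plus one, and [den n] is a power of two. Coprimality makes the
    cells a single cycle of the model and lets [num n] be inverted modulo [den n]. *)
Lemma coprime_num_den n : coprime (num n) (den n).
Proof.
rewrite /den coprimeXr // coprimen2; elim: n => // n IH /=.
by rewrite oddM /mul /den -expnM oddX muln_eq0 expn_eq0 /= andbF.
Qed.

(* The potential of the cell [c/M_n, (c+1)/M_n).  At scale n.+1 write
   c = mul n * q + r.  Adding num n.+1 = num n * mul n + 1 to c adds num n to q,
   except when r wraps around, where q receives an extra unit.  As den n divides
   mul n, the class of q - num n * r modulo den n is constant between two wraps and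
   increases by 1 at each of them, so that the second term cancels the effect of
   the extra unit. *)
Fixpoint pot n (c : int) : nat :=
  if n is n'.+1 then
    let q := (c %/ mul n')%Z in
    (pot n' q + (2 ^ n' - pot n' (q - (num n')%:Z * (c %% mul n')%Z)))%N
  else `|(c %% 2)%Z|%N.

Lemma pot_le n c : (pot n c <= 2 ^ n)%N.
Proof.
elim: n c => [|n IH] c /=; first by lia.
by rewrite expnS; have := IH (c %/ mul n)%Z; lia.
Qed.

(** The potential is thus a function of residues; it is kept on [int] so that translates along
    orbits need no reduction. *)
Lemma pot_periodic n c k : pot n (c + (den n)%:Z * k) = pot n c.
Proof.
elim: n c k => [|n IH] c k /=; first by rewrite /den expn0 expn1 mulrC addrC modzMDl.
have m0 : (mul n)%:Z != 0 by rewrite lt0n_neq0 // mul_gt0.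
rewrite denS PoszM mulrAC addrC divzMDl // modzMDl [_ + (c %/ _)%Z]addrC.
by rewrite IH addrAC IH.
Qed.

Definition altsgn (c : int) : int := 1 - 2 * (c %% 2)%Z.

Lemma pot_step n c :
  (pot n (c + (num n)%:Z))%:Z = (pot n c)%:Z + altsgn (c %/ half n)%Z.
Proof.
elim: n c => [|n IH] c /=.
  by rewrite /altsgn divz1; lia.
have m0 : (mul n)%:Z != 0 by rewrite lt0n_neq0 // mul_gt0.
have mp := mul_gt0 n.
set m := mul n in m0 mp *; set P := num n in IH *; set H := half n in IH *.
have -> : (c %/ (H * m)%N)%Z = (((c : int) %/ m)%Z %/ H)%Z.
  by rewrite PoszM mulrC divzMA_ge0.
set q := (c %/ m)%Z; set r := (c %% m)%Z.
have cE : c = q * m + r by rewrite /q /r; exact: divz_eq.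
have r0 : 0 <= r by exact: modz_ge0.
have rm : r < m by have := ltz_mod c m0; rewrite /r; lia.
have [rl|rl] := ltP (r + 1) m%:Z.
  have -> : ((c + (P * m).+1%:Z)) = (q + P%:Z) * m + (r + 1) by rewrite cE; lia.
  rewrite divzMDl // modzMDl (divz_small (d:=m)) ?modz_small; try lia.
  rewrite addr0.
  have -> : q + P%:Z - P%:Z * (r + 1) = q - P%:Z * r by ring.
  have := IH q; have := pot_le n (q - P%:Z * r); lia.
have rE : r = m%:Z - 1 by lia.
(* At a wrap both terms of the new value have the argument q + P + 1 and add up to 2^n. The old
   value is pot q + 2^n - pot (q + P), because m is 0 modulo [den n]. The difference is again the
   step of [pot n] at q. *)
have -> : ((c + (P * m).+1%:Z)) = (q + P%:Z + 1) * m by rewrite cE rE; lia.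
rewrite mulzK // modzMl mulr0 subr0.
have -> : q - P%:Z * r = q + P%:Z + (den n)%:Z * (- (den n ^ 6)%N%:Z * P%:Z).
  by rewrite rE /m mulE PoszM; ring.
rewrite pot_periodic.
have := IH q; have := pot_le n (q + P%:Z); have := pot_le n (q + P%:Z + 1).
lia.
Qed.

Lemma big_ord_mul (A : nmodType) a b (F : nat -> A) :
  \sum_(c < a * b) F c = \sum_(i < a) \sum_(j < b) F (i * b + j)%N.
Proof.
elim: a => [|a IH]; first by rewrite !big_ord0.
rewrite mulSn addnC big_split_ord /= big_ord_recr /=; congr (_ + _) => //.
Qed.

(** Since p is invertible modulo d, the affine map j |-> q - p j permutes the residues; [h] is this
    permutation on ordinals. *)
Lemma sum_affine_residues (A : nmodType) d (G : int -> A) p q :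
  (0 < d)%N -> coprime p d -> (forall c k, G (c + d%:Z * k) = G c) ->
  \sum_(j < d) G (q - p%:Z * j%:Z) = \sum_(j < d) G j%:Z.
Proof.
case: d => // d _ cop per.
have d0 : d.+1%:Z != 0 by [].
pose h (j : 'I_d.+1) : 'I_d.+1 := inord `|((q - p%:Z * j%:Z) %% d.+1)%Z|%N.
have hE j : (h j)%:Z = ((q - p%:Z * j%:Z) %% d.+1)%Z.
  rewrite /h inordK; first by rewrite gez0_abs // modz_ge0.
  by have := ltz_mod (q - p%:Z * j%:Z) d0; have := modz_ge0 (q - p%:Z * j%:Z) d0; lia.
have hinj : injective h.
  move=> i j /(congr1 (fun k : 'I_d.+1 => (k : nat)%:Z)); rewrite !hE => /eqP.
  rewrite eqz_mod_dvd => dv; apply/val_inj/eqP => /=.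
  have {dv} : (d.+1 %| p%:Z * (i%:Z - j%:Z))%Z.
    by case/dvdzP: dv => z dv; apply/dvdzP; exists (- z); rewrite mulNr -dv; ring.
  rewrite Gauss_dvdzr; last by rewrite /coprimez /gcdz /= gcdnC; move: cop => /eqP ->.
  rewrite -eqz_mod_dvd !modz_small /=; first by [].
    by have := ltn_ord j; lia.
  by have := ltn_ord i; lia.
rewrite [RHS](reindex_inj hinj) /=; apply: eq_bigr => j _.
rewrite hE -(per (_ %% _)%Z ((q - p%:Z * j%:Z) %/ d.+1)%Z); congr G.
by rewrite {1}(divz_eq (q - p%:Z * j%:Z) d.+1); ring.
Qed.

(** Generating functions turn the sum of independent terms into a product. The reflected potential
    is carried along because the recursion for either one uses both. The powers of two and [den n]
    stand on opposite sides to keep the coefficients integral. *)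
Lemma pot_distribution n :
  ((2 ^ 2 ^ n)%N%:R * \sum_(c < den n) 'X^(pot n c) = (den n)%:R * ('X + 1) ^+ (2 ^ n) :> {poly int})
  /\ ((2 ^ 2 ^ n)%N%:R * \sum_(c < den n) 'X^(2 ^ n - pot n c) = (den n)%:R * ('X + 1) ^+ (2 ^ n) :> {poly int}).
Proof.
elim: n => [|n [IH1 IH2]].
  by rewrite /den !big_ord_recl !big_ord0 /=; split; rewrite !expn1 expr0 expr1 expr1; ring.
(* Independence: for a fixed quotient the remainder runs over [mul n] = [den n] ^ 6 * [den n]
   values, so the second argument meets every class modulo [den n] exactly [den n] ^ 6 times. *)
have key (G1 G2 : int -> {poly int}) :
  (forall c k, G2 (c + (den n)%:Z * k) = G2 c) ->
  \sum_(c < den n.+1) (G1 (c%:Z %/ mul n)%Z * G2 ((c%:Z %/ mul n)%Z - (num n)%:Z * (c%:Z %% mul n)%Z)) =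
   (den n ^ 6)%:R * (\sum_(c < den n) G1 c%:Z) * (\sum_(c < den n) G2 c%:Z).
  move=> per; rewrite denS.
  rewrite (big_ord_mul _ _ (fun c : nat => G1 (c%:Z %/ mul n)%Z * G2 ((c%:Z %/ mul n)%Z - (num n)%:Z * (c%:Z %% mul n)%Z))).
  rewrite [RHS]mulrAC mulr_sumr; apply: eq_bigr => i _.
  transitivity (\sum_(j < den n ^ 6 * den n) (G1 i%:Z * G2 (i%:Z - (num n)%:Z * j%:Z))).
    rewrite -mulE; apply: eq_bigr => j _.
    rewrite PoszD PoszM divzMDl ?modzMDl; last by rewrite lt0n_neq0 // mul_gt0.
    by rewrite divz_small ?modz_small ?addr0 //=; have := ltn_ord j; lia.
  rewrite (big_ord_mul _ _ (fun j : nat => G1 i%:Z * G2 (i%:Z - (num n)%:Z * j%:Z))).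
  rewrite (eq_bigr (fun=> G1 i%:Z * \sum_(c < den n) G2 c%:Z)).
    by rewrite sumr_const card_ord -mulr_natl; ring.
  move=> k _; rewrite -mulr_sumr; congr (_ * _).
  rewrite -(sum_affine_residues i%:Z (den_gt0 n) (coprime_num_den n) per).
  apply: eq_bigr => j _; rewrite -(per _ ((num n)%:Z * k%:Z)).
  by congr G2; rewrite PoszD PoszM; ring.
have e2 : (2 ^ 2 ^ n.+1)%N%:R = (2 ^ 2 ^ n)%N%:R * (2 ^ 2 ^ n)%N%:R :> {poly int}.
  by rewrite -natrM -expnD addnn -mul2n -expnS.
have eM : (den n.+1)%:R = (den n ^ 6)%:R * (den n)%:R * (den n)%:R :> {poly int}.
  by rewrite denS mulE !natrM; ring.
have eX : ('X + 1) ^+ (2 ^ n.+1) = ('X + 1) ^+ (2 ^ n) * ('X + 1) ^+ (2 ^ n) :> {poly int}.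
  by rewrite -exprD addnn -mul2n -expnS.
rewrite e2 eM eX; split.
  rewrite (eq_bigr (fun c : 'I_(den n.+1) => 'X^(pot n (c%:Z %/ mul n)%Z) *
    'X^(2 ^ n - pot n ((c%:Z %/ mul n)%Z - (num n)%:Z * (c%:Z %% mul n)%Z)))); last first.
    by move=> c _; rewrite -exprD.
  rewrite (key (fun c => 'X^(pot n c)) (fun c => 'X^(2 ^ n - pot n c))); last first.
    by move=> c k; rewrite pot_periodic.
  rewrite [X in X = _](_ : _ = (den n ^ 6)%:R * ((2 ^ 2 ^ n)%N%:R * \sum_(c < den n) 'X^(pot n c))
    * ((2 ^ 2 ^ n)%N%:R * \sum_(c < den n) 'X^(2 ^ n - pot n c))); last by ring.
  by rewrite IH1 IH2; ring.
rewrite (eq_bigr (fun c : 'I_(den n.+1) => 'X^(2 ^ n - pot n (c%:Z %/ mul n)%Z) *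
    'X^(pot n ((c%:Z %/ mul n)%Z - (num n)%:Z * (c%:Z %% mul n)%Z)))); last first.
  move=> c _; rewrite -exprD; congr ('X^_) => /=; rewrite expnS.
  have := pot_le n (c%:Z %/ mul n)%Z.
  have := pot_le n ((c%:Z %/ mul n)%Z - (num n)%:Z * (c%:Z %% mul n)%Z).
  lia.
rewrite (key (fun c => 'X^(2 ^ n - pot n c)) (fun c => 'X^(pot n c))); last first.
  by move=> c k; rewrite pot_periodic.
rewrite [X in X = _](_ : _ = (den n ^ 6)%:R * ((2 ^ 2 ^ n)%N%:R * \sum_(c < den n) 'X^(pot n c))
    * ((2 ^ 2 ^ n)%N%:R * \sum_(c < den n) 'X^(2 ^ n - pot n c))); last by ring.
by rewrite IH1 IH2; ring.
Qed.

Definition level n s : nat := (\sum_(c < den n) (pot n c == s))%N.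

Lemma level_binomial n s : (2 ^ 2 ^ n * level n s = den n * 'C(2 ^ n, s))%N.
Proof.
have [/(congr1 (fun p : {poly int} => p`_s)) + _] := pot_distribution n.
rewrite -!polyC_natr !coefCM coef_sum.
rewrite (eq_bigr (fun c : 'I_(den n) => (pot n c == s)%:R)); last first.
  by move=> c _; rewrite coefXn eq_sym.
rewrite -natr_sum.
have -> : (('X + 1) ^+ (2 ^ n) : {poly int})`_s = ('C(2 ^ n, s))%:R.
  rewrite addrC exprDn coef_sum.
  have [le|lt] := leqP s (2 ^ n)%N; last first.
    rewrite bin_small // big1 // => i _.
    rewrite expr1n mul1r coefMn coefXn; case: eqP => [e|]; last by rewrite mul0rn.
    by have := ltn_ord i; lia.
  rewrite (bigD1 (Ordinal (n:=(2 ^ n).+1) (m:=s) le)) //= big1 ?addr0; last first.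
    move=> i /eqP ni; rewrite expr1n mul1r coefMn coefXn; case: eqP => [e|]; last by rewrite mul0rn.
    by case: ni; apply/val_inj.
  by rewrite expr1n mul1r coefMn coefXn eqxx.
by rewrite -!natrM => /eqP; rewrite eqr_nat => /eqP.
Qed.

(** * Greedy matching along orbits *)

Section greedy_matching.
Variables (T : Type) (rot : int -> T -> T) (up : nat -> pred T) (A : pred T).

(* Round i matches x with rot (i + 2) x.  The jumps 0 and 1 are excluded so that
   Gamma_tau almost surely avoids Gamma_0 and Gamma_1. *)
Fixpoint unmatched (j : nat) : pred T * pred T :=
  if j is i.+1 then
    let D := (unmatched i).1 in let V := (unmatched i).2 in
    let E := fun x => [&& D x, V (rot i.+2 x) & up i.+2 x] in
    (fun x => D x && ~~ E x, fun y => V y && ~~ E (rot (- i.+2%:Z) y))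
  else (A, A).

Definition source j : pred T := (unmatched j).1.
Definition target j : pred T := (unmatched j).2.
Definition matched j : pred T :=
  fun x => [&& source j x, target j (rot j.+2 x) & up j.+2 x].

Lemma sourceS j x : source j.+1 x = source j x && ~~ matched j x.
Proof. by []. Qed.

Lemma targetS j y : target j.+1 y = target j y && ~~ matched j (rot (- j.+2%:Z) y).
Proof. by []. Qed.

Lemma source_anti i j x : (i <= j)%N -> source j x -> source i x.
Proof.
move=> ij; rewrite -(subnKC ij); elim: (j - i)%N => [|k IH]; first by rewrite addn0.
by rewrite addnS sourceS => /andP[/IH].
Qed.

Lemma target_anti i j x : (i <= j)%N -> target j x -> target i x.
Proof.
move=> ij; rewrite -(subnKC ij); elim: (j - i)%N => [|k IH]; first by rewrite addn0.
by rewrite addnS targetS => /andP[/IH].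
Qed.

Lemma matched_source i j x : (i < j)%N -> matched i x -> ~~ source j x.
Proof. by move=> ij m; apply/negP => /(source_anti ij); rewrite sourceS m andbF. Qed.

Lemma matched_inj i j x : matched i x -> matched j x -> i = j.
Proof.
move=> mi mj; case: (ltngtP i j) => // lt.
  by have := matched_source lt mi; have /and3P[-> ] := mj.
by have := matched_source lt mj; have /and3P[-> ] := mi.
Qed.

Lemma matched_ex j x : source 0 x -> ~~ source j x -> exists i, matched i x.
Proof.
move=> x0; elim: j => [|j IH]; first by rewrite x0.
by rewrite sourceS negb_and negbK => /orP[/IH //|m]; exists j.
Qed.

Lemma target_matched_ex j y : target 0 y -> ~~ target j y ->
  exists i, matched i (rot (- i.+2%:Z) y).
Proof.
move=> x0; elim: j => [|j IH]; first by rewrite x0.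
by rewrite targetS negb_and negbK => /orP[/IH //|m]; exists j.
Qed.

Lemma matched_target i j x : (i < j)%N -> rot (- i.+2%:Z) (rot i.+2 x) = x ->
  matched i x -> ~~ target j (rot i.+2 x).
Proof.
move=> ij e m; apply/negP => /(target_anti ij).
by rewrite targetS e m andbF.
Qed.

End greedy_matching.

Lemma sum_translate (A : nmodType) d (G : int -> A) k : (0 < d)%N ->
  (forall c l, G (c + d%:Z * l) = G c) ->
  \sum_(j < d) G (j%:Z + k) = \sum_(j < d) G j%:Z.
Proof.
move=> d0 per.
rewrite -(sum_affine_residues 0 d0 (coprime1n d) per).
pose G' c := G (- c); have per' c l : G' (c + d%:Z * l) = G' c.
  by rewrite /G' opprD -mulrN per.
rewrite (eq_bigr (fun j : 'I_d => G' (- k - 1%:Z * j%:Z))); last first.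
  by move=> j _; rewrite /G'; congr G; ring.
rewrite (sum_affine_residues (- k) d0 (coprime1n d) per').
by apply: eq_bigr => j _; rewrite /G'; congr G; ring.
Qed.

(** * The greedy matching for the rational rotation *)

Section cyclic_matching.
Variable n : nat.
Local Notation d := (den n).
Local Notation rotc := (fun (k : int) (c : int) => c + k * (num n)%:Z).
Local Notation upc :=
  (fun (k : nat) (c : int) => pot n (c + k%:Z * (num n)%:Z) == (pot n c).+1).

Definition csource := source rotc upc predT.
Definition ctarget := target rotc upc predT.
Definition cmatched := matched rotc upc predT.

Lemma cmatchedE j c : cmatched j c =
  [&& csource j c, ctarget j (c + j.+2%:Z * (num n)%:Z) &
      pot n (c + j.+2%:Z * (num n)%:Z) == (pot n c).+1].
Proof. by []. Qed.

Lemma cmatching_periodic j c l :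
  csource j (c + d%:Z * l) = csource j c /\ ctarget j (c + d%:Z * l) = ctarget j c.
Proof.
rewrite /csource /ctarget; elim: j c l => [|j IH] c l //.
have m (x : int) z : matched rotc upc predT j (x + d%:Z * z) = matched rotc upc predT j x.
  rewrite /matched (IH x z).1 ![_ + d%:Z * _ + _]addrAC (IH (x + _) z).2.
  by rewrite !pot_periodic.
rewrite !sourceS !targetS (IH c l).1 (IH c l).2 m; split=> //.
by rewrite addrAC m.
Qed.

Lemma cmatched_periodic j c l : cmatched j (c + d%:Z * l) = cmatched j c.
Proof.
rewrite !cmatchedE; have [-> _] := cmatching_periodic j c l.
rewrite ![_ + d%:Z * _ + _]addrAC.
have [_ ->] := cmatching_periodic j (c + j.+2%:Z * (num n)%:Z) l.
by rewrite !pot_periodic.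
Qed.

Definition slevel j s := (\sum_(c < d) (csource j c && (pot n c == s)))%N.
Definition tlevel j s := (\sum_(c < d) (ctarget j c && (pot n c == s)))%N.

(** Every match uses up one source of potential s and one target of potential s + 1, so the two
    counts decrease together from their initial values [level n s] and [level n s.+1]. *)
Lemma level_balance j s :
  (slevel j s + level n s.+1 = tlevel j s.+1 + level n s)%N.
Proof.
elim: j => [|j IH].
  by rewrite /slevel /tlevel addnC.
have S : (slevel j s = slevel j.+1 s + \sum_(c < d) (cmatched j c && (pot n c == s)))%N.
  rewrite /slevel -big_split /=; apply: eq_bigr => c _.
  rewrite {2}/csource sourceS -/csource -/cmatched.
  have : cmatched j c -> csource j c by case/and3P.
  by case: (csource j c); case: (cmatched j c) => //=; try (by case: eqP); move=> /(_ isT).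
have V : (tlevel j s.+1 = tlevel j.+1 s.+1 + \sum_(c < d) (cmatched j c && (pot n c == s)))%N.
  pose G (c : int) : nat := (cmatched j c && (pot n c == s)).
  (* A match is recorded at its source; translating over a full period records it at its target
     instead. *)
  have -> : (\sum_(c < d) (cmatched j c && (pot n c == s)) = \sum_(c < d) G (c%:Z - j.+2%:Z * (num n)%:Z)%R)%N.
    symmetry; apply: (sum_translate _ (den_gt0 n)) => c l.
    by rewrite /G cmatched_periodic pot_periodic.
  rewrite /tlevel -big_split /=; apply: eq_bigr => c _.
  rewrite {2}/ctarget targetS -/ctarget -/cmatched /G mulNr.
  set c' := _ - _.
  have cE : c'  + j.+2%:Z * (num n)%:Z = c by rewrite /c' subrK.
  have : cmatched j c' -> ctarget j c /\ pot n c = (pot n c').+1.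
    by case/and3P => _; rewrite cE => ? /eqP.
  case: (ctarget j c); case: (cmatched j c') => //=; try (by case: eqP).
    by move=> /(_ isT)[_ ->]; rewrite eqSS.
  by move=> /(_ isT)[].
lia.
Qed.

(** The jumps 2, ..., d + 1 of the first d rounds represent every residue, so one of them leads from
    u to v modulo d. Both points, free at the end, were free in that round and would have been
    matched. *)
Lemma cmatching_maximal u v : csource d u -> ctarget d v -> pot n v <> (pot n u).+1.
Proof.
move=> Du Vv e.
have [k [k2 kd [z vE]]] : exists k : nat, [/\ (2 <= k)%N, (k < d + 2)%N &
   exists z, v = u + k%:Z * (num n)%:Z + d%:Z * z].
  have [a [b ab]] : exists a b, a * (num n)%:Z + b * d%:Z = 1.
    have [a [b ab]] := Bezoutz (num n) d.
    exists a, b; rewrite ab /gcdz /=; by move: (coprime_num_den n) => /eqP ->.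
  have d0 : d%:Z != 0 by rewrite lt0n_neq0 // den_gt0.
  (* The Bezout coefficient a inverts [num n] modulo d, so (v - u) * a steps lead from u to v. The
     shift by 2 puts the representative in the range of the admissible jumps. *)
  pose k0 := (((v - u) * a - 2) %% d)%Z.
  have k00 : 0 <= k0 by exact: modz_ge0.
  have k0d : k0 < d%:Z by have := ltz_mod ((v - u) * a - 2) d0; rewrite /k0; lia.
  exists (`|k0| + 2)%N; split; [lia|lia|].
  exists ((v - u) * b + (num n)%:Z * (((v - u) * a - 2) %/ d)%Z).
  have := divz_eq ((v - u) * a - 2) d; rewrite -/k0; set q := (_ %/ _)%Z => E.
  have -> : (`|k0| + 2)%N%:Z = (v - u) * a - q * d by lia.
  have -> : u + ((v - u) * a - q * d%:Z) * (num n)%:Z + d%:Z * ((v - u) * b + (num n)%:Z * q) =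
      u + (v - u) * (a * (num n)%:Z + b * d%:Z) by ring.
  by rewrite ab; ring.
have Vk : ctarget d (u + k%:Z * (num n)%:Z).
  by have [_ <-] := cmatching_periodic d (u + k%:Z * (num n)%:Z) z; rewrite -vE.
have kE : k = (k - 2).+2 by lia.
have : cmatched (k - 2) u.
  apply/and3P; split.
  - by apply: source_anti Du; lia.
  - by rewrite -kE; apply: target_anti Vk; lia.
  - by rewrite -kE -e vE pot_periodic.
move=> m; have /negP := @matched_source _ rotc upc predT (k - 2) d u ltac:(lia) m; exact.
Qed.

Lemma bin_lt_mid h s : (s < h)%N -> ('C(h.*2, s) <= 'C(h.*2, s.+1))%N.
Proof.
move=> sh; have := mul_bin_left h.*2 s.
have : (s.+1 <= h.*2 - s)%N by lia.
by move: ('C(h.*2, s)) ('C(h.*2, s.+1)) (h.*2 - s)%N => a b c; nia.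
Qed.

Lemma bin_gt_mid h s : (h <= s)%N -> ('C(h.*2, s.+1) <= 'C(h.*2, s))%N.
Proof.
move=> sh; have := mul_bin_left h.*2 s.
have : (h.*2 - s <= s.+1)%N by lia.
by move: ('C(h.*2, s)) ('C(h.*2, s.+1)) (h.*2 - s)%N => a b c; nia.
Qed.

Hypothesis n0 : (0 < n)%N.
Local Notation h := (2 ^ n.-1)%N.

Let hE : (2 ^ n = h.*2)%N.
Proof. by rewrite -mul2n -expnS prednK. Qed.

Lemma level_lt_mid s : (s < h)%N -> (level n s <= level n s.+1)%N.
Proof.
move=> /bin_lt_mid; rewrite -hE => le.
by rewrite -(leq_pmul2l (_ : 0 < 2 ^ 2 ^ n)%N) ?expn_gt0 // !level_binomial leq_mul2l le orbT.
Qed.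

Lemma level_gt_mid s : (h <= s)%N -> (level n s.+1 <= level n s)%N.
Proof.
move=> /bin_gt_mid; rewrite -hE => le.
by rewrite -(leq_pmul2l (_ : 0 < 2 ^ 2 ^ n)%N) ?expn_gt0 // !level_binomial leq_mul2l le orbT.
Qed.

Lemma periodic_window (p : int -> bool) c : (forall x l, p (x + d%:Z * l) = p x) ->
  p c -> exists i : 'I_d, p i.
Proof.
move=> per pc; have d0 : d%:Z != 0 by rewrite lt0n_neq0 // den_gt0.
have lt : (`|(c %% d)%Z| < d)%N.
  by have := ltz_mod c d0; have := modz_ge0 c d0; lia.
exists (Ordinal lt) => /=.
by rewrite gez0_abs ?modz_ge0 // -(per _ (c %/ d)%Z) addrC [_ * (_ %/ _)%Z]mulrC -divz_eq.
Qed.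

Lemma slevel_eq0 s v : ctarget d v -> pot n v = s.+1 -> slevel d s = 0%N.
Proof.
move=> Vv vs; rewrite /slevel big1 // => c _.
case: (boolP (csource d c)) => //= Dc; case: eqP => // cs.
by have := cmatching_maximal Dc Vv; rewrite vs cs.
Qed.

(** With [level_balance] this determines both counts: one vanishes, and the other is the difference
    of two neighbouring levels. *)
Lemma slevel_or_tlevel s : slevel d s = 0%N \/ tlevel d s.+1 = 0%N.
Proof.
have [|/negP] := boolP (tlevel d s.+1 == 0%N); first by move/eqP; right.
rewrite /tlevel sum_nat_eq0 => /negP/forallPn[c] /=.
by rewrite eqb0 negbK => /andP[Vc /eqP cs]; left; exact: slevel_eq0 Vc cs.
Qed.

Lemma slevel_gt_mid s : (h <= s)%N -> (slevel d s + level n s.+1 <= level n s)%N.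
Proof.
move=> hs; have := level_balance d s; have := level_gt_mid hs.
by have [->|->] := slevel_or_tlevel s; lia.
Qed.

Lemma tlevel_lt_mid s : (s < h)%N -> (tlevel d s.+1 + level n s <= level n s.+1)%N.
Proof.
move=> hs; have := level_balance d s; have := level_lt_mid hs.
by have [->|->] := slevel_or_tlevel s; lia.
Qed.

Lemma slevel_lt_mid s : (s < h)%N -> slevel d s = 0%N.
Proof.
move=> hs; have := level_balance d s; have := level_lt_mid hs.
by have [->|->] := slevel_or_tlevel s; lia.
Qed.

Lemma tlevel_gt_mid s : (h <= s)%N -> tlevel d s.+1 = 0%N.
Proof.
move=> hs; have := level_balance d s; have := level_gt_mid hs.
by have [->|->] := slevel_or_tlevel s; lia.
Qed.

(** Below the middle the levels increase, so it is the targets that are in excess there and no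
    source is left over. *)
Lemma csource_ge u : csource d u -> (h <= pot n u)%N.
Proof.
move=> Du; rewrite leqNgt; apply/negP => /slevel_lt_mid /eqP.
have per (x l : int) : (csource d (x + d%:Z * l) && (pot n (x + d%:Z * l) == pot n u)) =
    (csource d x && (pot n x == pot n u)).
  by have [-> _] := cmatching_periodic d x l; rewrite pot_periodic.
have [|i] := @periodic_window (fun x => csource d x && (pot n x == pot n u)) u per; first by rewrite Du eqxx.
by move=> ci; rewrite /slevel sum_nat_eq0 => /forallP/(_ i)/=; rewrite ci.
Qed.

Lemma ctarget_le v : ctarget d v -> (pot n v <= h)%N.
Proof.
move=> Dv; rewrite leqNgt; apply/negP => vs.
have vE : pot n v = (pot n v).-1.+1 by lia.
have : (h <= (pot n v).-1)%N by lia.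
move=> /tlevel_gt_mid /eqP.
have per (x l : int) : (ctarget d (x + d%:Z * l) && (pot n (x + d%:Z * l) == (pot n v).-1.+1)) =
    (ctarget d x && (pot n x == (pot n v).-1.+1)).
  by have [_ ->] := cmatching_periodic d x l; rewrite pot_periodic.
have [|i] := @periodic_window (fun x => ctarget d x && (pot n x == (pot n v).-1.+1)) v per; first by rewrite Dv -vE eqxx.
by move=> ci; rewrite /tlevel sum_nat_eq0 => /forallP/(_ i)/=; rewrite ci.
Qed.

Lemma sum_by_level (p : int -> bool) :
  (\sum_(c < d) p c = \sum_(s < (2 ^ n).+1) \sum_(c < d) (p c && (pot n c == s)))%N.
Proof.
rewrite exchange_big /=; apply: eq_bigr => c _.
have lt : (pot n c < (2 ^ n).+1)%N by rewrite ltnS pot_le.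
rewrite (bigD1 (Ordinal lt)) //= eqxx andbT big1 ?addn0 // => i ni.
by case: eqP => [e|]; rewrite ?andbF // -(inj_eq val_inj) /= e eqxx in ni *.
Qed.

(** From the middle upwards the free sources at level s number at most [level n s] - [level n s.+1],
    and these differences telescope. *)
Lemma csource_count : (\sum_(c < d) csource d c <= level n h)%N.
Proof.
rewrite sum_by_level -(big_mkord predT (fun s => slevel d s)).
have hh : (h <= (2 ^ n).+1)%N by rewrite hE; lia.
rewrite (big_cat_nat _ hh) //= big_nat_cond big1 ?add0n; last first.
  by move=> i; rewrite andbT => /slevel_lt_mid.
suff H k : (\sum_(h <= i < h + k) slevel d i + level n (h + k) <= level n h)%N.
  by have := H ((2 ^ n).+1 - h)%N; rewrite subnKC //; lia.
elim: k => [|k IH]; first by rewrite addn0 big_geq.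
rewrite addnS big_nat_recr ?leq_addr //=.
by have := slevel_gt_mid (leq_addr k h); lia.
Qed.

Lemma ctarget_count : (\sum_(c < d) ctarget d c <= level n h)%N.
Proof.
rewrite sum_by_level -(big_mkord predT (fun s => tlevel d s)).
have hh : (h.+1 <= (2 ^ n).+1)%N by rewrite hE; lia.
rewrite (big_cat_nat _ hh) //= [X in (_ + X)%N]big_nat_cond [X in (_ + X)%N]big1 ?addn0; last first.
  move=> [|i]; rewrite andbT => /andP[hi _] //.
  by apply: tlevel_gt_mid; lia.
suff H k : (k <= h)%N -> (\sum_(0 <= i < k.+1) tlevel d i <= level n k)%N by exact: H.
elim: k => [|k IH] kh.
  (* Targets of potential 0 have no possible source; they are bounded by their whole level, which
     starts the telescoping. *)
  rewrite big_nat1 /tlevel; apply: leq_sum => c _.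
  by case: (ctarget d c) => //=; case: eqP.
rewrite big_nat_recr //=.
have := IH (ltnW kh); have := tlevel_lt_mid kh; lia.
Qed.

End cyclic_matching.

(** The ratio of consecutive central coefficients is 2(2h+1)/(h+1), and the induction step reduces
    to (2h+1)(2h+3) <= (2h+2)^2. This gives the decay of order h^(-1/2) without Stirling's
    formula. *)
Lemma central_bin_bound h : ('C(h.*2, h) ^ 2 * h.*2.+1 <= 16 ^ h)%N.
Proof.
elim: h => // h IH.
have E : (h.+1 * 'C(h.+1.*2, h.+1) = 2 * h.*2.+1 * 'C(h.*2, h))%N.
  rewrite doubleS.
  have e1 : (h.*2.+1.+1 * 'C(h.*2.+1, h) = h.+1 * 'C(h.*2.+2, h.+1))%N.
    exact: mul_bin_diag.
  have e2 : (h.*2.+1 * 'C(h.*2, h) = (h.*2.+1 - h) * 'C(h.*2.+1, h))%N.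
    exact: mul_bin_down.
  move: e1 e2; have -> : (h.*2.+1 - h = h.+1)%N by lia.
  move: ('C(h.*2, h)) ('C(h.*2.+1, h)) ('C(h.*2.+2, h.+1)) => a b c; nia.
have H : (h.+1 ^ 2 * ('C(h.+1.*2, h.+1) ^ 2 * h.+1.*2.+1) <= h.+1 ^ 2 * 16 ^ h.+1)%N.
  rewrite mulnA -expnMn E [(16 ^ h.+1)%N]expnS; move: IH.
  move: ('C(h.*2, h)) (16 ^ h)%N => a b IH; clear -IH.
  have -> : ((2 * h.*2.+1 * a) ^ 2 * h.+1.*2.+1 = (a ^ 2 * h.*2.+1) * (4 * h.*2.+1 * h.+1.*2.+1))%N.
    by rewrite -!mul2n; ring.
  have -> : (h.+1 ^ 2 * (16 * b) = b * (16 * h.+1 ^ 2))%N by ring.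
  apply: leq_mul => //; rewrite -!mul2n; nia.
by move: H; rewrite leq_pmul2l.
Qed.

(** * The irrational rotation *)

Section rotations.
Context (R : realType).
Implicit Types (a x y : R) (i j k : int).

Lemma rotation_itv a k x : 0 <= rotation a k x < 1.
Proof.
rewrite /rotation; set y := x + _.
have /andP[h1 h2] := floor_itv y.
rewrite intrD in h2; apply/andP; split; lra.
Qed.

Lemma rotation_eq a k x y z : 0 <= y < 1 -> x + k%:~R * a = y + z%:~R ->
  rotation a k x = y.
Proof.
move=> /andP[y0 y1] e; rewrite /rotation e.
have -> : Num.floor (y + z%:~R) = z; last by rewrite addrK.
by apply: floor_def; rewrite intrD; lra.
Qed.

Lemma rotation_int a k x : exists z : int, x + k%:~R * a = rotation a k x + z%:~R.
Proof. by exists (Num.floor (x + k%:~R * a)); rewrite /rotation subrK. Qed.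

Lemma rotationD a i j x : rotation a i (rotation a j x) = rotation a (i + j) x.
Proof.
have [z1 e1] := rotation_int a j x; have [z2 e2] := rotation_int a (i + j) x.
apply: (rotation_eq (z := z2 - z1)); first exact: rotation_itv.
by rewrite intrB; rewrite intrD in e2; lra.
Qed.

Lemma rotation0 a x : 0 <= x < 1 -> rotation a 0 x = x.
Proof. by move=> x01; apply: (rotation_eq (z := 0)) => //; rewrite mul0r. Qed.

Lemma rotationK a k x : 0 <= x < 1 -> rotation a (- k) (rotation a k x) = x.
Proof. by move=> x01; rewrite rotationD addNr rotation0. Qed.

Lemma rotationNK a k x : 0 <= x < 1 -> rotation a k (rotation a (- k) x) = x.
Proof. by move=> x01; rewrite rotationD addrN rotation0. Qed.

Lemma rotation_inj a i j x : irrational a -> rotation a i x = rotation a j x -> i = j.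
Proof.
move=> irr e; have [z1 e1] := rotation_int a i x; have [z2 e2] := rotation_int a j x.
apply/eqP; apply: contrapT => /negP; rewrite -subr_eq0 => ij.
apply: irr; exists ((z1 - z2)%:~R / (i - j)%:~R) => //.
rewrite rmorphM fmorphV /= !ratr_int.
have ij0 : (i - j)%:~R != 0 :> R by rewrite intr_eq0.
apply: (mulIf ij0). rewrite divfK // !intrB; rewrite e in e1; lra.
Qed.

Definition fsgn x : int := if x < 2^-1 then 1 else - 1.

Lemma rho0 a x : rho a 0 x = 1.
Proof. by rewrite /rho /= addr0 subr0. Qed.

Lemma rhoS a n x : rho a n.+1 x = rho a n x + fsgn (rotation a n x).
Proof.
have E : iota 0 n.+1 = iota 0 n ++ [:: n] by rewrite -addn1 iotaD.
rewrite /rho /window E map_cat !count_cat [in LHS]/= !addn0 /fsgn.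
have /andP[-> ->] := rotation_itv a n x; rewrite andbT ltNge.
by case: (2^-1 <= _) => /=; lia.
Qed.

Lemma rho1 a x : 0 <= x < 1 -> rho a 1 x = 1 + fsgn x.
Proof. by move=> x01; rewrite (rhoS a 0) rho0 rotation0. Qed.

End rotations.

(** * The number alpha and its rational approximations *)

Section alpha.
Context (R : realType).

Definition conv n : R := (num n)%:R / (den n)%:R.

Lemma den_neq0 n : (den n)%:R != 0 :> R.
Proof. by rewrite pnatr_eq0 -lt0n den_gt0. Qed.

Lemma den_pos n : 0 < (den n)%:R :> R.
Proof. by rewrite ltr0n den_gt0. Qed.

Lemma convS n : conv n.+1 = conv n + (den n.+1)%:R^-1.
Proof.
have m0 : (mul n)%:R != 0 :> R by rewrite pnatr_eq0 -lt0n mul_gt0.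
have d0 := den_neq0 n.
rewrite /conv /= denS -addn1 natrD !natrM; field.
by rewrite ?nat1r ?d0 ?m0.
Qed.

Lemma den_growth n : 2 * (den n)%:R <= (den n.+1)%:R :> R.
Proof. by rewrite -natrM ler_nat double_den_le. Qed.

Lemma inv_den_growth n : 2 * (den n.+1)%:R^-1 <= (den n)%:R^-1 :> R.
Proof.
have := den_growth n; have := den_pos n; have := den_pos n.+1.
move: (den n)%:R (den n.+1)%:R => x y y0 x0 xy.
by rewrite ler_pdivrMr // mulrC ler_pdivlMr.
Qed.

Lemma conv_nondecreasing n k : conv n <= conv (n + k).
Proof.
elim: k => [|k IH]; rewrite ?addn0 // addnS convS (le_trans IH) // lerDl.
by rewrite invr_ge0 ltW // den_pos.
Qed.

(** Since 1/[den] at least halves at each index, the bound 2/[den] on the tail loses at least what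
    the next partial sum gains. *)
Lemma conv_upper n k : conv (n + k) + 2 * (den (n + k).+1)%:R^-1 <=
  conv n + 2 * (den n.+1)%:R^-1.
Proof.
elim: k => [|k IH]; rewrite ?addn0 // (le_trans _ IH) // addnS convS.
by have := inv_den_growth (n + k).+1; lra.
Qed.

Definition alpha : R := sup (range conv).

Let conv_le n m : conv m <= conv n + 2 * (den n.+1)%:R^-1.
Proof.
have [mn|nm] := leqP m n.
  rewrite -(subnKC mn) (le_trans (conv_nondecreasing m (n - m))) // lerDl.
  by rewrite mulr_ge0 // invr_ge0 ltW // den_pos.
have := conv_upper n (m - n); rewrite subnKC ?(ltnW nm) //; apply: le_trans.
by rewrite lerDl mulr_ge0 // invr_ge0 ltW // den_pos.
Qed.

Let conv_sup : has_sup (range conv).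
Proof.
split; first by exists (conv 0), 0%N.
by exists (conv 0 + 2 * (den 1)%:R^-1) => _ [m _ <-]; exact: conv_le.
Qed.

Lemma alpha_le n : alpha <= conv n + 2 * (den n.+1)%:R^-1.
Proof. by apply: ge_sup => [|_ [m _ <-]]; [exists (conv 0), 0%N|exact: conv_le]. Qed.

Lemma conv_lt_alpha n : conv n < alpha.
Proof.
apply: (@lt_le_trans _ _ (conv n.+1)).
  by rewrite convS ltrDl invr_gt0 den_pos.
by apply: ub_le_sup; [exact: conv_sup.2|exists n.+1].
Qed.

Lemma alpha_itv : 0 <= alpha < 1.
Proof.
apply/andP; split.
  apply: le_trans (ltW (conv_lt_alpha 0)).
  by rewrite /conv divr_ge0.
apply: le_lt_trans (alpha_le 0) _.
rewrite /conv /den /=; lra.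
Qed.

Lemma irrational_alpha : irrational alpha.
Proof.
move=> [q _ qa].
have qE : alpha = (numq q)%:~R / (denq q)%:~R by rewrite -qa /ratr.
have b0 : 0 < (denq q)%:~R :> R by rewrite ltr0z.
(* Taking the denominator itself as the index of the approximation is enough: n < [den n] makes the
   positive integer in [e] smaller than 2 n [den n] / [den n.+1], hence than 1, up to equality in
   the first bound. *)
pose n := `|denq q|%N.
have dn : (denq q)%:~R = n%:R :> R by rewrite pmulrn /n gez0_abs // ltW.
have d0 := den_pos n.
have e : (den n)%:R * (denq q)%:~R * (alpha - conv n) = ((den n)%:Z * numq q - (num n)%:Z * denq q)%:~R :> R.
  rewrite qE /conv intrB !intrM -!pmulrn; field.
  by rewrite (gt_eqF b0) den_neq0.
have pos : 0 < (den n)%:R * (denq q)%:~R * (alpha - conv n).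
  by rewrite mulr_gt0 ?mulr_gt0 // subr_gt0 conv_lt_alpha.
have lt1 : (den n)%:R * (denq q)%:~R * (alpha - conv n) < 1.
  apply: (@le_lt_trans _ _ ((den n)%:R * n%:R * (2 * (den n.+1)%:R^-1))).
    by rewrite dn ler_wpM2l ?mulr_ge0 // lerBlDl alpha_le.
  rewrite mulrA ltr_pdivrMr ?den_pos // mul1r -!natrM ltr_nat denS mulE.
  have := ltn_den n; have := den_gt1 n; have : (den n <= den n ^ 6)%N.
    by rewrite -{1}(expn1 (den n)) leq_pexp2l ?den_gt0.
  by move: (den n ^ 6)%N (den n) => x y; nia.
by move: pos lt1; rewrite e ltr0z -[1]/(1%:~R) ltr_int; lia.
Qed.

End alpha.

(** * Comparison of the irrational rotation with its rational models *)

Section locality.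
Context (R : realType).
Implicit Types (x y : R).
Variable n : nat.
Local Notation d := (den n).
Local Notation a := (alpha R).

(** In units of one cell, the error per step between the rotation by alpha and the rotation by num n
    / den n. *)
Definition drift : R := d%:R * a - (num n)%:R.

Lemma drift_gt0 : 0 < drift.
Proof.
have := conv_lt_alpha R n; rewrite /conv ltr_pdivrMr ?den_pos // /drift; lra.
Qed.

Lemma drift_le : drift <= 2 * d%:R * (den n.+1)%:R^-1.
Proof.
have d0 := den_pos R n.
have := alpha_le R n; rewrite /conv -(ler_pM2l d0) mulrDr [_ * (_ / _)]mulrC divfK ?gt_eqF //.
by rewrite /drift; lra.
Qed.

Definition cell x : int := Num.floor (d%:R * x).

(* For |i| <= k the drift accumulated in i steps does not push x + i alpha out of
   the cell predicted by the rotation by P_n/M_n. *)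
Definition good (k : nat) x : bool :=
  k%:R * drift <= d%:R * x - (cell x)%:~R < 1 - k%:R * drift.

Lemma good_le j k x : (j <= k)%N -> good k x -> good j x.
Proof.
move=> jk /andP[h1 h2]; have : j%:R * drift <= k%:R * drift.
  by rewrite ler_pM2r ?drift_gt0 // ler_nat.
by rewrite /good; lra.
Qed.

(** The integer z accounts for the reduction modulo 1. The margin that remains is k - |i|, so the
    lemma can be applied again further along the orbit. *)
Lemma cell_rotation (i : int) k x : (`|i| <= k)%N -> good k x ->
  (exists z, cell (rotation a i x) = cell x + i * (num n)%:Z + d%:Z * z) /\
  good (k - `|i|) (rotation a i x).
Proof.
move=> ik /andP[h1 h2]; have [z e] := rotation_int a i x.
have ie : - (k%:R * drift) <= i%:~R * drift <= k%:R * drift.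
  rewrite -mulNr !ler_pM2r ?drift_gt0 //.
  by rewrite -[k%:R]/(k%:Z%:~R) -intrN !ler_int; lia.
have ce : cell (rotation a i x) = cell x + i * (num n)%:Z - d%:Z * z.
  apply: floor_def; rewrite !(intrD, intrB, intrM, intrN) -!pmulrn.
  have -> : rotation a i x = x + i%:~R * a - z%:~R by rewrite e addrK.
  have -> : d%:R * (x + i%:~R * a - z%:~R) =
    d%:R * x + i%:~R * drift + i%:~R * (num n)%:R - d%:R * z%:~R :> R.
    by rewrite /drift; ring.
  by lra.
split; first by exists (- z); rewrite ce mulrN.
have E : d%:R * rotation a i x - (cell (rotation a i x))%:~R =
    d%:R * x - (cell x)%:~R + i%:~R * drift.
  rewrite ce !(intrD, intrB, intrM, intrN) -!pmulrn.
  have -> : rotation a i x = x + i%:~R * a - z%:~R by rewrite e addrK.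
  by rewrite /drift; ring.
have F : (k - `|i|)%:R * drift = k%:R * drift - `|i|%:R * drift by rewrite natrB // mulrBl.
have G : - (`|i|%:R * drift) <= i%:~R * drift <= `|i|%:R * drift.
  rewrite -mulNr !ler_pM2r ?drift_gt0 //.
  by rewrite -[`|i|%:R]/(`|i|%:Z%:~R) -intrN !ler_int; lia.
by rewrite /good E F; lra.
Qed.

Lemma fsgn_cell y : 0 <= y < 1 -> fsgn y = altsgn (cell y %/ half n)%Z.
Proof.
move=> /andP[y0 y1].
have hp : 0 < (half n)%:R :> R by rewrite ltr0n half_gt0.
have dE : d%:R = 2 * (half n)%:R :> R by rewrite den_half natrM.
have c0 : 0 <= cell y by rewrite /cell floor_ge0 mulr_ge0.
have cd : cell y < d%:Z.
  by rewrite /cell floor_lt_int // -pmulrn gtr_pMr // den_pos.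
have E : (y < 2^-1) = (cell y < (half n)%:Z).
  rewrite /cell floor_lt_int -pmulrn dE mulrC mulrA gtr_pMl //.
  by apply/idP/idP; lra.
have cd2 : cell y < 2 * (half n)%:Z by rewrite (lt_le_trans cd) // den_half PoszM.
have hp0 : (half n)%:Z != 0 by rewrite lt0n_neq0 // half_gt0.
rewrite /fsgn E /altsgn; case: ltP => ch.
  by rewrite divz_small //=; lia.
have -> : cell y = 1 * (half n)%:Z + (cell y - (half n)%:Z) by ring.
by rewrite divzMDl // divz_small //=; lia.
Qed.

Lemma altsgn_periodic (c z : int) :
  altsgn ((c + d%:Z * z) %/ half n)%Z = altsgn (c %/ half n)%Z.
Proof.
have hp0 : (half n)%:Z != 0 by rewrite lt0n_neq0 // half_gt0.
rewrite den_half PoszM.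
have -> : c + (2 * (half n)%:Z) * z = (z * 2) * (half n)%:Z + c by ring.
by rewrite divzMDl // /altsgn modzMDl.
Qed.

(** [pot_step] telescopes along the orbit, whose cells are the predicted ones up to multiples of
    d. *)
Lemma rho_cell (j k : nat) x : (j <= k)%N -> good k x ->
  rho a j x = 1 + ((pot n (cell x + j%:Z * (num n)%:Z))%:Z - (pot n (cell x))%:Z).
Proof.
elim: j => [|j IH] jk g.
  by rewrite rho0 mul0r addr0 subrr addr0.
rewrite rhoS (IH (ltnW jk) g) fsgn_cell ?rotation_itv //.
have [[z ->] _] := @cell_rotation j k x (ltnW jk) g.
rewrite altsgn_periodic.
have := pot_step n (cell x + j%:Z * (num n)%:Z).
have -> : cell x + j%:Z * (num n)%:Z + (num n)%:Z = cell x + j.+1%:Z * (num n)%:Z.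
  by rewrite -addn1 PoszD; ring.
by lia.
Qed.

Definition rup (j : nat) x : bool := rho a j x == 2.
Definition rsource := source (rotation a) rup (fun x => 0 <= x < 1).
Definition rtarget := target (rotation a) rup (fun x => 0 <= x < 1).
Definition rmatched := matched (rotation a) rup (fun x => 0 <= x < 1).

Lemma rmatchedE j x : rmatched j x =
  [&& rsource j x, rtarget j (rotation a j.+2 x) & rup j.+2 x].
Proof. by []. Qed.

Lemma rsourceS j x : rsource j.+1 x = rsource j x && ~~ rmatched j x.
Proof. by []. Qed.

Lemma rtargetS j y :
  rtarget j.+1 y = rtarget j y && ~~ rmatched j (rotation a (- j.+2%:Z) y).
Proof. by []. Qed.

Lemma rup_cell (j k : nat) x : (j <= k)%N -> good k x ->
  rup j x = (pot n (cell x + j%:Z * (num n)%:Z) == (pot n (cell x)).+1).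
Proof. by move=> jk g; rewrite /rup (rho_cell jk g); lia. Qed.

(** A target is taken by the point j + 2 steps earlier, whose match looks j + 2 steps ahead. One
    round thus costs a margin of at most 2(j + 2), which is less than (j + 3)^2 - (j + 2)^2. *)
Lemma rmatching_cell j x : 0 <= x < 1 -> good (j.+2 ^ 2) x ->
  rsource j x = csource n j (cell x) /\ rtarget j x = ctarget n j (cell x).
Proof.
elim: j x => [|j IH] x x01 g; first by rewrite /rsource /rtarget /source /target /= x01.
have M y : 0 <= y < 1 -> good (j.+2 ^ 2 + j.+2) y -> rmatched j y = cmatched n j (cell y).
  move=> y01 gy; rewrite rmatchedE cmatchedE.
  have [->  _] := IH y y01 (good_le (leq_addr _ _) gy).
  have le : (`|j.+2%:Z| <= j.+2 ^ 2 + j.+2)%N by rewrite leq_addl.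
  have [[z e] gr] := cell_rotation le gy.
  have le' : (j.+2 ^ 2 <= j.+2 ^ 2 + j.+2 - `|j.+2%:Z|)%N by rewrite absz_nat addnK.
  have [_ ->] := IH _ (rotation_itv a j.+2 y) (good_le le' gr).
  rewrite e; have [_ ->] := cmatching_periodic n j (cell y + j.+2%:Z * (num n)%:Z) z.
  by rewrite (rup_cell le gy).
have gj : good (j.+2 ^ 2) x by apply: good_le g; rewrite leq_exp2r.
have [Is It] := IH x x01 gj.
rewrite rsourceS rtargetS Is It; split.
  rewrite M //; last by apply: good_le g; lia.
have le : (`|(- j.+2%:Z)| <= j.+3 ^ 2)%N by lia.
have [[z e] gr] := cell_rotation le g.
rewrite M ?rotation_itv //; last by apply: good_le gr; lia.
rewrite e cmatched_periodic; congr (_ && ~~ _).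
Qed.

End locality.

(** * Measurability and almost sure completeness of the matching *)

Section lebesgue_rotation.
Context (R : realType).
Local Notation RR := (measurableTypeR R).
Local Notation leb := (@lebesgue_measure R).
Implicit Types (A : set RR).

Lemma I01E (x : R) : @I01 R x = (0 <= x < 1).
Proof. by rewrite /I01 /= in_itv. Qed.

Lemma unif01E A : unif01 R A = leb (A `&` @I01 R).
Proof. by []. Qed.

Lemma measurable_shift (t : R) : measurable_fun [set: RR] (fun x : RR => (x + t : RR)).
Proof. by apply: measurable_funD => //; exact: measurable_id. Qed.

Lemma lebesgue_shift (t : R) A : measurable A ->
  leb ((fun x : R => x + t) @^-1` A) = leb A.
Proof.
move=> mA; symmetry; rewrite -[RHS]/(pushforward leb (fun x : RR => (x + t : RR)) A).
apply: lebesgue_measure_unique => //; first exact: measurable_shift.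
move=> _ /= _ [[a b] /= ab <-].
have -> : `]a, b]%classic = [set` `]a, b]] by [].
rewrite /pushforward.
have -> : (fun x : RR => (x + t : RR)) @^-1` `]a, b]%classic = `]a - t, b - t]%classic.
  by apply/seteqP; split=> x /=; rewrite !in_itv /= lerBrDr ltrBlDr.
rewrite !lebesgue_measure_itv /= !lte_fin ltrD2r; case: ifP => // _.
by rewrite -!EFinB; congr EFin; ring.
Qed.

Lemma measurable_floor (c : R) (T : pred int) : measurable [set x : RR | T (Num.floor (c * x))].
Proof.
have mc : measurable_fun [set: RR] (fun x : RR => (c * x : RR)).
  by apply: measurable_funM => //; exact: measurable_id.
have -> : [set x : RR | T (Num.floor (c * x))] =
    \bigcup_z (if T z then (fun x : RR => (c * x : RR)) @^-1` `[z%:~R, (z + 1)%:~R[ else set0).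
  apply/seteqP; split=> [x /= Tx|x [z /= _]].
    by exists (Num.floor (c * x)) => //=; rewrite Tx /= in_itv /= floor_itv.
  by case: ifP => //= Tz; rewrite in_itv /= => /floor_def ->.
apply: countable_bigcupT_measurable => [|z]; first exact: countableP.
case: ifP => // _; rewrite -[X in measurable X]setTI; apply: mc => //.
Qed.

Lemma measurable_rotation (a : R) k : measurable_fun [set: RR] (rotation a k : RR -> RR).
Proof.
have mf : measurable_fun [set: RR] (fun x : RR => ((Num.floor x)%:~R : RR)).
  by apply: nondecreasing_measurable => // x y xy; rewrite ler_int le_floor.
have ms := measurable_shift (k%:~R * a).
apply: measurable_funB => //; exact: measurableT_comp mf ms.
Qed.

(** With t the image of 0, the rotation is the shift by t onto [t,1) and the shift by t - 1 onto
    [0,t); each piece is handled by translation invariance. *)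
Lemma unif01_rotation (a : R) k A : measurable A ->
  unif01 R (rotation a k @^-1` A) = unif01 R A.
Proof.
move=> mA; pose t := rotation a k 0.
have /andP[t0 t1] : 0 <= t < 1 by exact: rotation_itv.
have [z e] := rotation_int a k 0; rewrite add0r -/t in e.
have mt : measurable (`[t, 1[ : set RR) by exact: measurable_itv.
have mt' : measurable (`[0, t[ : set RR) by exact: measurable_itv.
rewrite !unif01E.
have -> : rotation a k @^-1` A `&` @I01 R =
   ((fun x : R => x + t) @^-1` (A `&` `[t, 1[)) `|` ((fun x : R => x + (t - 1)) @^-1` (A `&` `[0, t[)).
  apply/seteqP; split=> [x [/= Ax]|x /= [[Ax]|[Ax]]].
  - rewrite I01E => /andP[x0 x1].
    have [xt|xt] := ltP (x + t) 1.
      have E : rotation a k x = x + t by apply: (rotation_eq (z := z)); lra.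
      by left; rewrite -E; split => //=; rewrite E in_itv /=; lra.
    have E : rotation a k x = x + (t - 1).
      by apply: (rotation_eq (z := z + 1)); rewrite ?intrD; lra.
    by right; rewrite -E; split => //=; rewrite E in_itv /=; lra.
  - rewrite in_itv /= => /andP[h1 h2].
    have E : rotation a k x = x + t by apply: (rotation_eq (z := z)); lra.
    by rewrite E I01E; split => //; lra.
  - rewrite in_itv /= => /andP[h1 h2].
    have E : rotation a k x = x + (t - 1).
      by apply: (rotation_eq (z := z + 1)); rewrite ?intrD; lra.
    by rewrite E I01E; split => //; lra.
rewrite measureU.
- transitivity (leb (A `&` `[t, 1%R[) + leb (A `&` `[0%R, t[))%E.
    by congr (_ + _)%E; apply: lebesgue_shift; exact: measurableI.
  rewrite -measureU; [|exact: measurableI|exact: measurableI|].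
    rewrite -setIUr; congr (leb (_ `&` _)); apply/seteqP; split=> x /=; rewrite I01E !in_itv /=; lra.
  apply/seteqP; split=> x //= [[_]]; rewrite in_itv /= => /andP[h1 h2] [_].
  by rewrite in_itv /=; lra.
- rewrite -[X in measurable X]setTI; apply: measurable_shift => //; exact: measurableI.
- rewrite -[X in measurable X]setTI; apply: measurable_shift => //; exact: measurableI.
- apply/seteqP; split=> x //= [[_]]; rewrite in_itv /= => /andP[h1 h2] [_].
  by rewrite in_itv /=; lra.
Qed.

End lebesgue_rotation.

Section measurability.
Context (R : realType).
Local Notation RR := (measurableTypeR R).
Local Notation a := (alpha R).

Lemma measurable_rotation_preimage k (A : set RR) : measurable A ->
  measurable (rotation a k @^-1` A).
Proof. by move=> mA; rewrite -[X in measurable X]setTI; apply: measurable_rotation. Qed.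

Lemma measurable_fsgn : measurable [set x : RR | x < 2^-1].
Proof.
have -> : [set x : RR | x < 2^-1] = `]-oo, 2^-1[%classic.
  by apply/seteqP; split=> x /=; rewrite in_itv.
exact: measurable_itv.
Qed.

Lemma measurable_counts (p : int -> RR -> bool) (s : seq int) (v : nat) :
  (forall i, measurable [set x | p i x]) ->
  measurable [set x | count (p^~ x) s == v].
Proof.
move=> mp; elim: s v => [|i s IH] v.
  rewrite (_ : [set x | _] = if 0%N == v then setT else set0); first by case: ifP.
  by case: ifP => e; apply/seteqP; split=> x //=; rewrite e.
case: v => [|v].
  rewrite (_ : [set x | _] = ~` [set x | p i x] `&` [set x | count (p^~ x) s == 0%N]).
    by apply: measurableI => //; exact: measurableC.
  apply/seteqP; split=> x /=; rewrite addn_eq0 eqb0; first by case/andP => /negP.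
  by case=> /negP -> ->.
rewrite (_ : [set x | _] = ([set x | p i x] `&` [set x | count (p^~ x) s == v]) `|`
    (~` [set x | p i x] `&` [set x | count (p^~ x) s == v.+1])).
  by apply: measurableU; apply: measurableI => //; exact: measurableC.
have E x : (p i x + count (p^~ x) s == v.+1)%N = if p i x then count (p^~ x) s == v else count (p^~ x) s == v.+1.
  by case: (p i x); rewrite ?add1n ?add0n ?eqSS.
apply/seteqP; split=> x /=; rewrite E; case: (boolP (p i x)) => [h|/negP h].
- by left.
- by right.
- by case=> -[].
- by case=> -[].
Qed.

Lemma measurable_rho (k v : int) : measurable [set x : RR | rho a k x == v].
Proof.
pose p1 (i : int) (x : RR) := 0 <= rotation a i x < 2^-1.
pose p2 (i : int) (x : RR) := 2^-1 <= rotation a i x < 1.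
have m1 i : measurable [set x | p1 i x].
  exact: (measurable_rotation_preimage i (measurable_itv `[0, 2^-1[)).
have m2 i : measurable [set x | p2 i x].
  exact: (measurable_rotation_preimage i (measurable_itv `[2^-1, 1[)).
rewrite (_ : [set x | _] = \bigcup_n \bigcup_m (if 1 + n%:Z - m%:Z == v then
   [set x | count (p1^~ x) (window k) == n] `&` [set x | count (p2^~ x) (window k) == m] else set0)).
  apply: bigcupT_measurable => n; apply: bigcupT_measurable => m; case: ifP => // _.
  by apply: measurableI; exact: measurable_counts.
apply/seteqP; split=> x /=.
  move=> e; exists (count (p1^~ x) (window k)) => //; exists (count (p2^~ x) (window k)) => //.
  rewrite -[rho a k x]/(1 + (count (p1^~ x) (window k))%:Z - (count (p2^~ x) (window k))%:Z) in e.
  by rewrite e; split => /=.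
move=> [n _ [m _]]; case: ifP => // e [/= /eqP h1 /eqP h2].
have -> : rho a k x = 1 + (count (p1^~ x) (window k))%:Z - (count (p2^~ x) (window k))%:Z by [].
by rewrite h1 h2 e.
Qed.

Lemma measurable_matching j :
  [/\ measurable [set x : RR | rsource j x],
      measurable [set x : RR | rtarget j x] &
      measurable [set x : RR | rmatched j x]].
Proof.
have M i : measurable [set x : RR | rsource i x] -> measurable [set x : RR | rtarget i x] ->
    measurable [set x : RR | rmatched i x].
  move=> mS mT; rewrite (_ : [set x : RR | _] = [set x | rsource i x] `&`
     (rotation a i.+2 @^-1` [set x : RR | rtarget i x]) `&` [set x | rho a i.+2 x == 2]).
    apply: measurableI; last exact: measurable_rho.
    by apply: measurableI => //; exact: measurable_rotation_preimage.
  apply/seteqP; split=> x /=; rewrite rmatchedE /rup; first by case/and3P.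
  by case=> -[-> ->] ->.
elim: j => [|j [mS mT mM]].
  have mI : measurable [set x : RR | 0 <= x < 1].
    rewrite (_ : [set x : RR | _] = @I01 R); first exact: measurable_I01.
    by apply/seteqP; split=> x; rewrite I01E.
  by split => //; exact: M.
have mS' : measurable [set x : RR | rsource j.+1 x].
  rewrite (_ : [set x : RR | _] = [set x : RR | rsource j x] `\` [set x : RR | rmatched j x]).
    exact: measurableD.
  apply/seteqP; split=> x /=; rewrite rsourceS; first by case/andP => ? /negP.
  by case=> -> /negP ->.
have mT' : measurable [set x : RR | rtarget j.+1 x].
  rewrite (_ : [set x : RR | _] = [set x : RR | rtarget j x] `\`
      (rotation a (- j.+2%:Z) @^-1` [set x : RR | rmatched j x])).
    by apply: measurableD => //; exact: measurable_rotation_preimage.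
  apply/seteqP; split=> x /=; rewrite rtargetS; first by case/andP => ? /negP.
  by case=> -> /negP ->.
by split => //; exact: M.
Qed.

Variable n : nat.
Local Notation d := (den n).

(* Whether x is matched at round j depends on the orbit up to the time
   2 + 3 + ... + (j + 2) <= (j + 2)^2, by recursion on the rounds. *)
Definition width := (d.+2 ^ 2)%N.

Definition bad : set RR := [set x | 0 <= x < 1 /\ ~~ good n width x].

Lemma measurable_bad : measurable bad.
Proof.
pose g (x : RR) : RR := d%:R * x - (Num.floor (d%:R * x))%:~R.
have mg : measurable_fun [set: RR] g.
  have m1 : measurable_fun [set: RR] (fun x : RR => (d%:R * x : RR)).
    by apply: measurable_funM => //; exact: measurable_id.
  have mf : measurable_fun [set: RR] (fun x : RR => ((Num.floor x)%:~R : RR)).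
    by apply: nondecreasing_measurable => // x y xy; rewrite ler_int le_floor.
  by apply: measurable_funB => //; exact: measurableT_comp mf m1.
rewrite (_ : bad = @I01 R `\` (g @^-1` `[width%:R * drift R n, 1 - width%:R * drift R n[)).
  apply: measurableD; first exact: measurable_I01.
  by rewrite -[X in measurable X]setTI; exact: mg.
apply/seteqP; split=> x /=; rewrite /good /bad /= I01E in_itv /=; by case=> -> /negP.
Qed.

Lemma unif01_cover (X : set RR) (F : nat -> set RR) (e : nat -> R) :
  measurable X -> (forall c, measurable (F c)) ->
  (forall c, (lebesgue_measure (F c) <= (e c)%:E)%E) ->
  (forall x : R, X x -> 0 <= x < 1 -> F `|Num.floor (d%:R * x)|%N x) ->
  (unif01 R X <= (\sum_(c < d) e c)%:E)%E.
Proof.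
move=> mX mF Fe XF; rewrite unif01E.
have sub : X `&` @I01 R `<=` \big[setU/set0]_(c < d) F c.
  move=> x [Xx]; rewrite I01E => x01; rewrite -bigcup_mkord.
  exists `|Num.floor (d%:R * x)|%N; last exact: XF.
  have /andP[x0 x1] := x01.
  have h0 : 0 <= Num.floor (d%:R * x) by rewrite floor_ge0 mulr_ge0.
  have h1 : Num.floor (d%:R * x) < d%:Z by rewrite floor_lt_int -pmulrn gtr_pMr // den_pos.
  by rewrite /=; lia.
apply: le_trans (content_subadditive _ _ _ sub) _.
- by move=> k _; exact: mF.
- by apply: measurableI => //; exact: measurable_I01.
by rewrite -sumEFin; apply: lee_sum => c _; exact: Fe.
Qed.

Lemma leb_cell_le (u v w : R) : v - u <= w -> 0 <= w ->
  (lebesgue_measure (`[(u / d%:R)%R, (v / d%:R)%R[%classic : set RR) <= (w / d%:R)%:E)%E.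
Proof.
move=> uv w0; rewrite lebesgue_measure_itv /=; case: ifP => _.
  by rewrite -EFinB lee_fin -mulrBl ler_pM2r // invr_gt0 den_pos.
by rewrite lee_fin divr_ge0.
Qed.

Lemma cellE (x : R) : 0 <= x < 1 ->
  (`|Num.floor (d%:R * x)|%N%:R : R) = (cell n x)%:~R.
Proof.
move=> /andP[x0 _]; rewrite /cell pmulrn gez0_abs //.
by rewrite floor_ge0 mulr_ge0.
Qed.

(** In each of the d cells the bad points lie in two end intervals of length w/d. *)
Lemma unif01_bad : (unif01 R bad <= (2 * (width%:R * drift R n))%:E)%E.
Proof.
set w := width%:R * drift R n.
have w0 : 0 <= w by rewrite mulr_ge0 // ltW // drift_gt0.
have d0 := den_pos R n.
pose F (c : nat) : set RR := `[c%:R / d%:R, (c%:R + w) / d%:R[%classic `|` `[(c%:R + 1 - w) / d%:R, (c%:R + 1) / d%:R[%classic.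
have mF c : measurable (F c) by apply: measurableU; exact: measurable_itv.
have -> : 2 * w = \sum_(c < d) (w / d%:R + w / d%:R).
  rewrite sumr_const card_ord -mulr_natl; field; exact: den_neq0.
apply: (@unif01_cover _ F (fun=> w / d%:R + w / d%:R)) => //.
- exact: measurable_bad.
- move=> c; have := @measureU2 _ _ _ (@lebesgue_measure R) _ _ (measurable_itv `[c%:R / d%:R, (c%:R + w) / d%:R[) (measurable_itv `[(c%:R + 1 - w) / d%:R, (c%:R + 1) / d%:R[).
  move=> /le_trans; apply; rewrite EFinD; apply: leeD; apply: leb_cell_le; lra.
- move=> x [x01 gx] _; rewrite /F /= cellE //.
  have /andP[f1 f2] := floor_itv (d%:R * x); rewrite -/(cell n x) intrD in f1 f2.
  rewrite !in_itv /= !ler_pdivrMr // !ltr_pdivlMr // ![x * _]mulrC.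
  move: gx; rewrite /good -/w negb_and -ltNge -leNgt => /orP[h|h].
    have H : (cell n x)%:~R <= d%:R * x < (cell n x)%:~R + w by lra.
    by left.
  have H : (cell n x)%:~R + 1 - w <= d%:R * x < (cell n x)%:~R + 1 by lra.
  by right.
Qed.

Lemma unif01_cells (p : int -> bool) : (forall c z, p (c + d%:Z * z) = p c) ->
   measurable [set x : RR | p (cell n x)] /\
  (unif01 R [set x | p (cell n x)] <= ((\sum_(c < d) p c)%N%:R / d%:R)%:E)%E.
Proof.
move=> per; have mp := measurable_floor d%:R p; split; first exact: mp.
have d0 := den_pos R n.
pose F (c : nat) : set RR := if p c then `[c%:R / d%:R, (c%:R + 1) / d%:R[%classic else set0.
rewrite natr_sum mulr_suml.
apply: (@unif01_cover _ F (fun c : nat => (p c)%:R / d%:R)) => //.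
- by move=> c; rewrite /F; case: ifP => // _; exact: measurable_itv.
- move=> c; rewrite /F; case: ifP => _; last by rewrite measure0 mul0r.
  by apply: leb_cell_le => /=; lra.
- move=> x /= px x01.
  have c0 : 0 <= cell n x by rewrite /cell floor_ge0 mulr_ge0 //; case/andP: x01.
  have -> : F `|Num.floor (d%:R * x)|%N = `[(cell n x)%:~R / d%:R, ((cell n x)%:~R + 1) / d%:R[%classic.
    by rewrite /F cellE // gez0_abs // px.
  have /andP[f1 f2] := floor_itv (d%:R * x); rewrite -/(cell n x) intrD in f1 f2.
  have H : (cell n x)%:~R <= d%:R * x < (cell n x)%:~R + 1 by lra.
  by rewrite /= !in_itv /= !ler_pdivrMr // !ltr_pdivlMr // ![x * _]mulrC.
Qed.

(** As d >= 2, [width] is at most 4 d^2, and [drift] is at most 2 d / d^8. *)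
Lemma width_drift : (2 * (width%:R * drift R n)) <= 16 / d%:R ^+ 5 :> R.
Proof.
have d0 := den_pos R n.
have dr := drift_le R n.
have d8 : (den n.+1)%:R = d%:R ^+ 8 :> R by rewrite denS /mul natrM natrX; ring.
have w : width%:R <= 4 * d%:R ^+ 2 :> R.
  rewrite /width -natrX -natrM ler_nat; have := den_gt1 n; nia.
rewrite d8 in dr.
have -> : 16 / d%:R ^+ 5 = 2 * (4 * d%:R ^+ 2 * (2 * d%:R * (d%:R ^+ 8)^-1)) :> R.
  by field; exact: den_neq0.
by rewrite ler_pM2l // ler_pM // ltW // drift_gt0.
Qed.

Lemma exp2_le_den : (2 ^+ n <= d%:R :> R).
Proof.
rewrite -natrX ler_nat /den leq_exp2l //.
exact/ltnW/ltn_expl.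
Qed.

(** For k = 0 this makes the bad sets summable; for k = 1 it outweighs the potential, whose size 2^n
    is at most d. *)
Lemma bad_small k : (k <= 4)%N ->
  (unif01 R bad * (d%:R ^+ k)%:E <= (16 * 2^-1 ^+ n)%:E)%E.
Proof.
move=> k4; have d0 := den_pos R n.
have dk : 0 <= d%:R ^+ k :> R by rewrite exprn_ge0 // ltW.
apply: (@le_trans _ _ ((16 / d%:R ^+ 5)%:E * (d%:R ^+ k)%:E)%E).
  rewrite lee_wpmul2r ?lee_fin //; apply: le_trans unif01_bad _.
  by rewrite lee_fin width_drift.
rewrite -EFinM lee_fin -mulrA ler_pM2l //.
have -> : d%:R ^+ 5 = d%:R ^+ k * d%:R ^+ (5 - k) :> R.
  by rewrite -exprD subnKC // (leq_trans k4).
rewrite invfM mulrAC mulVf ?mul1r ?expf_neq0 ?den_neq0 //.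
rewrite exprVn lef_pV2 ?posrE ?exprn_gt0 //.
apply: le_trans exp2_le_den _; rewrite -[leLHS]expr1 ler_weXn2l //; last by lia.
by rewrite ler1n den_gt0.
Qed.

Lemma level_ratio : (0 < n)%N ->
  (level n (2 ^ n.-1)%N)%:R / d%:R = ('C(2 ^ n, 2 ^ n.-1))%:R / (2 ^ 2 ^ n)%:R :> R.
Proof.
move=> n0; have := level_binomial n (2 ^ n.-1)%N => /(congr1 (fun k => k%:R : R)).
rewrite !natrM => e; have e0 : (2 ^ 2 ^ n)%:R != 0 :> R by rewrite pnatr_eq0 expn_eq0.
apply: (mulfI e0); rewrite mulrA e [RHS]mulrCA mulfV // mulr1 mulrAC mulfV ?mul1r //.
exact: den_neq0.
Qed.

End measurability.

Section leftover.
Context (R : realType).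
Local Notation RR := (measurableTypeR R).
Local Notation a := (alpha R).

Lemma central_ratio (h : nat) : (('C(h.*2, h))%:R / (2 ^ h.*2)%:R) ^+ 2 <= (h.*2.+1)%:R^-1 :> R.
Proof.
have p0 : 0 < (h.*2.+1)%:R :> R by rewrite ltr0n.
have q0 : 0 < (2 ^ h.*2)%:R :> R by rewrite ltr0n expn_gt0.
rewrite expr_div_n ler_pdivrMr ?exprn_gt0 // mulrC ler_pdivlMr // -!natrX -natrM ler_nat.
rewrite (leq_trans (central_bin_bound h)) //.
by rewrite -expnM -mul2n mulnAC expnM.
Qed.

Definition leftover : set RR :=
  [set x | (forall j, rsource j x) \/ (forall j, rtarget j x)].

Lemma measurable_leftover : measurable leftover.
Proof.
rewrite (_ : leftover = \bigcap_j [set x : RR | rsource j x] `|` \bigcap_j [set x : RR | rtarget j x]).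
  by apply: measurableU; apply: bigcapT_measurable => j; have [] := measurable_matching R j.
apply/seteqP; split=> x /= [h|h]; [left => j _|right => j _|left => j|right => j]; exact: h.
Qed.

(** Off the bad set, being free after [den n] rounds is read off the cell; the cells in question
    number at most the central level, whose density is the binomial ratio. *)
Lemma unmatched_small n : (0 < n)%N ->
  (unif01 R [set x | rsource (den n) x] <= unif01 R (@bad R n) + (('C(2 ^ n, 2 ^ n.-1))%:R / (2 ^ 2 ^ n)%:R)%:E)%E /\
  (unif01 R [set x | rtarget (den n) x] <= unif01 R (@bad R n) + (('C(2 ^ n, 2 ^ n.-1))%:R / (2 ^ 2 ^ n)%:R)%:E)%E.
Proof.
move=> n0; have [mS mT _] := measurable_matching R (den n).
have mB := @measurable_bad R n.
have key (p : int -> bool) (X : set RR) : measurable X -> (forall c z, p (c + (den n)%:Z * z) = p c) ->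
   (\sum_(c < den n) p c <= level n (2 ^ n.-1))%N ->
   (forall x : R, X x -> 0 <= x < 1 -> good n (width n) x -> p (cell n x)) ->
   (unif01 R X <= unif01 R (@bad R n) + (('C(2 ^ n, 2 ^ n.-1))%:R / (2 ^ 2 ^ n)%:R)%:E)%E.
  move=> mX per le sub; have [mp lep] := @unif01_cells R n p per.
  have XE : unif01 R X = unif01 R (X `&` @I01 R) by rewrite !unif01E -setIA setIid.
  apply: (@le_trans _ _ (unif01 R (@bad R n `|` [set x | p (cell n x)]))).
    rewrite XE; apply: le_measure; rewrite ?inE.
    - by apply: measurableI => //; exact: measurable_I01.
    - exact: measurableU.
    - move=> x [Xx]; rewrite I01E => x01.
      have [g|g] := boolP (good n (width n) x); last by left.
      by right; exact: sub.
  apply: le_trans (measureU2 _ mB mp) _; apply: leeD => //.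
  apply: le_trans lep _; rewrite lee_fin -level_ratio //.
  by rewrite ler_pM2r ?invr_gt0 ?den_pos // ler_nat.
split.
- apply: (key (csource n (den n))) => //.
  + by move=> c z; have [] := cmatching_periodic n (den n) c z.
  + exact: csource_count.
  + by move=> x /= + x01 g; have [->] := rmatching_cell x01 g.
- apply: (key (ctarget n (den n))) => //.
  + by move=> c z; have [] := cmatching_periodic n (den n) c z.
  + exact: ctarget_count.
  + by move=> x /= + x01 g; have [_ ->] := rmatching_cell x01 g.
Qed.

Lemma ratio_cvg0 : (('C(2 ^ n.+1, 2 ^ n))%:R / (2 ^ 2 ^ n.+1)%:R : R) @[n --> \oo] --> 0.
Proof.
apply/cvgrPdist_le => e e0; near=> n.
rewrite sub0r normrN ger0_norm; last by rewrite divr_ge0.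
rewrite -(@ler_pXn2r _ 2) ?nnegrE ?divr_ge0 ?(ltW e0) //.
have E : (2 ^ n.+1 = (2 ^ n).*2)%N by rewrite expnS mul2n.
rewrite E (le_trans (central_ratio _)) //.
have : (e ^+ 2)^-1 <= n%:R.
  by near: n; exact: nbhs_infty_ger.
have e2 : 0 < e ^+ 2 by rewrite exprn_gt0.
move=> en; rewrite -[leRHS]invrK lef_pV2 ?posrE ?invr_gt0 // (le_trans en) // ler_nat.
by rewrite -E; have := ltn_expl n.+1 (isT : 1 < 2)%N; lia.
Unshelve. all: by end_near. Qed.

Lemma bad_cvg0 k : (k <= 4)%N -> (unif01 R (@bad R n) * ((den n)%:R ^+ k)%:E)%E @[n --> \oo] --> 0%E.
Proof.
move=> k4.
apply: (@squeeze_cvge _ _ _ _ (fun=> 0%E) _ (fun n => (16 * 2^-1 ^+ n)%:E)).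
- apply: nearW => n; apply/andP; split; last exact: bad_small.
  by apply: mule_ge0; [exact: measure_ge0|rewrite lee_fin exprn_ge0].
- exact: cvg_cst.
- by apply: cvg_EFin; [exact: nearW|apply: cvg_geometric; rewrite ger0_norm // invf_lt1 // ltr1n].
Qed.

(** A point that stays free forever is free after [den n] rounds for every n, and both error terms
    of [unmatched_small] tend to 0. *)
Lemma unif01_leftover : unif01 R leftover = 0%E.
Proof.
have [mS mT] : measurable [set x : RR | forall j, rsource j x] /\ measurable [set x : RR | forall j, rtarget j x].
  split.
    rewrite (_ : [set x | _] = \bigcap_j [set x : RR | rsource j x]).
      by apply: bigcapT_measurable => j; have [] := measurable_matching R j.
    by apply/seteqP; split=> x /= h j; [move=> _|]; apply: h.
  rewrite (_ : [set x | _] = \bigcap_j [set x : RR | rtarget j x]).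
    by apply: bigcapT_measurable => j; have [] := measurable_matching R j.
  by apply/seteqP; split=> x /= h j; [move=> _|]; apply: h.
have c0 : (unif01 R (@bad R n.+1) + (('C(2 ^ n.+1, 2 ^ n))%:R / (2 ^ 2 ^ n.+1)%:R)%:E)%E @[n --> \oo] --> 0%E.
  rewrite -[X in _ --> X]adde0; apply: cvgeD => //.
    have := @bad_cvg0 0 isT; rewrite -(@cvg_shiftS _ _) /=.
    by under eq_fun do rewrite expr0 mule1.
  apply: cvg_EFin; [exact: nearW|exact: ratio_cvg0].
have key (X : set RR) (F : nat -> set RR) : measurable X -> (forall n, measurable (F n)) ->
   (forall n, X `<=` F n) ->
  (forall n, (unif01 R (F n.+1) <= unif01 R (@bad R n.+1) + (('C(2 ^ n.+1, 2 ^ n))%:R / (2 ^ 2 ^ n.+1)%:R)%:E)%E) -> unif01 R X = 0%E.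
  move=> mX mF XF le; apply/eqP; rewrite eq_le measure_ge0 andbT.
  have /cvg_lim <- // := c0; apply: lime_ge; first by apply/cvg_ex; exists 0%E.
  apply: nearW => n; apply: le_trans (le n); apply: le_measure; rewrite ?inE //.
apply: measure_negligible; first exact: measurable_leftover.
rewrite (_ : leftover = [set x : RR | forall j, rsource j x] `|` [set x : RR | forall j, rtarget j x]) //.
apply: negligibleU; apply/negligibleP => //.
- apply: (key _ (fun n => [set x : RR | rsource (den n) x])) => // n.
  + by have [] := measurable_matching R (den n).
  + by move=> x /=.
  + by have [] := @unmatched_small n.+1 isT.
- apply: (key _ (fun n => [set x : RR | rtarget (den n) x])) => // n.
  + by have [] := measurable_matching R (den n).
  + by move=> x /=.
  + by have [] := @unmatched_small n.+1 isT.
Qed.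

End leftover.

(** * The map tau and its measure preservation *)

Section matching_map.
Context (R : realType).
Local Notation RR := (measurableTypeR R).
Local Notation a := (alpha R).

(* The union of the orbits of the unmatched points: being invariant, this null set
   can be removed, and tau = 0 on it makes the map x + tau(x) alpha bijective
   everywhere. *)
Definition exceptional : set RR :=
  \bigcup_n (rotation a n%:Z @^-1` (@leftover R) `|` rotation a (- n%:Z) @^-1` (@leftover R)).

Lemma exceptionalP (x : R) :
  exceptional x <-> exists k : int, leftover (rotation a k x).
Proof.
split=> [[n _ [h|h]]|[k h]]; [by exists n|by exists (- n%:Z)|].
exists `|k|%N => //; case: (ger0P k) => k0; [left|right] => /=.
  by rewrite gez0_abs.
by rewrite ltz0_abs // opprK.
Qed.

Lemma exceptional_rotation k (x : R) : exceptional (rotation a k x) <-> exceptional x.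
Proof.
rewrite !exceptionalP; split=> -[j]; first by rewrite rotationD; exists (j + k).
by move=> h; exists (j - k); rewrite rotationD subrK.
Qed.

Lemma measurable_exceptional : measurable exceptional.
Proof.
have mL := @measurable_leftover R.
by apply: bigcupT_measurable => n; apply: measurableU; exact: measurable_rotation_preimage.
Qed.

Lemma unif01_exceptional : unif01 R exceptional = 0%E.
Proof.
have mL := @measurable_leftover R.
apply: measure_negligible; first exact: measurable_exceptional.
apply: negligible_bigcup => n; apply: negligibleU; apply/negligibleP.
- exact: measurable_rotation_preimage.
- by have := unif01_rotation a n mL; rewrite unif01_leftover.
- exact: measurable_rotation_preimage.
- by have := unif01_rotation a (- n%:Z) mL; rewrite unif01_leftover.
Qed.

Definition jump (x : R) : int :=
  if `[< ~ exceptional x /\ exists j, rmatched j x >]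
  then (xget 0%N [set j | rmatched j x]).+2%:Z else 0.

Lemma jump_exceptional (x : R) : exceptional x -> jump x = 0.
Proof. by move=> Nx; rewrite /jump asboolF // => -[]. Qed.

Lemma jump_matched j (x : R) : ~ exceptional x -> rmatched j x -> jump x = j.+2.
Proof.
move=> Nx mj; rewrite /jump asboolT; last by split => //; exists j.
case: xgetP => [i _ mi|/(_ j)/(_ mj) //].
by rewrite (matched_inj mi mj).
Qed.

Lemma rmatched_itv j (x : R) : rmatched j x -> 0 <= x < 1.
Proof. by move=> /and3P[s _ _]; exact: (source_anti (leq0n j) s). Qed.

Lemma nonexceptional_matched (x : R) : 0 <= x < 1 -> ~ exceptional x ->
  exists j, rmatched j x.
Proof.
move=> x01 Nx; apply: contrapT => nm; apply: Nx; apply/exceptionalP; exists 0.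
rewrite rotation0 //; left=> j; apply: contrapT => /negP ns.
by apply: nm; apply: matched_ex ns.
Qed.

Lemma nonexceptional_target (y : R) : 0 <= y < 1 -> ~ exceptional y ->
  exists j, rmatched j (rotation a (- j.+2%:Z) y).
Proof.
move=> y01 Ny; apply: contrapT => nm; apply: Ny; apply/exceptionalP; exists 0.
rewrite rotation0 //; right=> j; apply: contrapT => /negP ns.
by apply: nm; apply: target_matched_ex ns.
Qed.

Lemma jump_cases (x : R) : 0 <= x < 1 ->
  (exceptional x /\ jump x = 0) \/
  (exists j, [/\ ~ exceptional x, rmatched j x & jump x = j.+2]).
Proof.
move=> x01; have [Nx|Nx] := pselect (exceptional x).
  by left; split => //; exact: jump_exceptional.
have [j mj] := nonexceptional_matched x01 Nx.
by right; exists j; split => //; exact: jump_matched.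
Qed.

Local Notation T := (rotation_tau a jump).

(** The exceptional set is invariant, so x and y are both in it or both outside. Outside, a target
    taken in round i is no longer free in a later round j, so the rounds agree and the common
    rotation can be inverted. *)
Lemma jump_inj (x y : R) : 0 <= x < 1 -> 0 <= y < 1 -> T x = T y -> x = y.
Proof.
move=> x01 y01; rewrite /rotation_tau.
wlog le : x y x01 y01 / jump x <= jump y.
  by move=> W e; case/orP: (le_total (jump x) (jump y)) => le; [exact: W|symmetry; exact: W].
move=> e; have Nxy : exceptional x <-> exceptional y.
  by rewrite -(exceptional_rotation (jump x)) e exceptional_rotation.
have [[Nx jx]|[i [Nx mi jx]]] := jump_cases x01; have [[Ny jy]|[j [Ny mj jy]]] := jump_cases y01.
- by move: e; rewrite jx jy !rotation0.
- by case: Ny; apply/Nxy.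
- by case: Nx; apply/Nxy.
have ij : (i <= j)%N by move: le; rewrite jx jy; lia.
move: e; rewrite jx jy => e; case: ltngtP ij => // ij _; last first.
  by rewrite -(rotationK a i.+2 x01) e ij rotationK.
have := @matched_target _ (rotation a) (@rup R) (fun x => 0 <= x < 1) i j x ij
  (rotationK a i.+2 x01) mi.
by rewrite e; have /and3P[_ -> _] := mj.
Qed.

Lemma jump_surj (y : R) : 0 <= y < 1 -> exists2 x, 0 <= x < 1 & T x = y.
Proof.
move=> y01; have [Ny|Ny] := pselect (exceptional y).
  by exists y => //; rewrite /rotation_tau jump_exceptional // rotation0.
have [j mj] := nonexceptional_target y01 Ny.
exists (rotation a (- j.+2%:Z) y); first exact: rotation_itv.
rewrite /rotation_tau (jump_matched _ mj) ?rotationNK //.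
by rewrite exceptional_rotation.
Qed.

Definition jump_piece j : set RR := [set x | rmatched j x] `\` exceptional.

Lemma measurable_jump_piece j : measurable (jump_piece j).
Proof.
by apply: measurableD; [have [] := measurable_matching R j|exact: measurable_exceptional].
Qed.

Lemma trivIset_jump_piece : trivIset setT jump_piece.
Proof.
apply/trivIsetP => i j _ _ ij; apply/seteqP; split=> x //= [[mi _] [mj _]].
by move/eqP: ij; apply; exact: matched_inj mi mj.
Qed.

Lemma jump_piece_cover : @I01 R `\` exceptional = \bigcup_j jump_piece j.
Proof.
apply/seteqP; split=> x.
  rewrite /= I01E => -[x01 Nx]; have [j mj] := nonexceptional_matched x01 Nx.
  by exists j.
by move=> [j _ [/= mj Nx]]; split => //; rewrite I01E; exact: rmatched_itv mj.
Qed.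

Lemma jump_preimage (A : set RR) : @I01 R `&` T @^-1` A =
  (@I01 R `&` exceptional `&` A) `|`
  \bigcup_j (jump_piece j `&` rotation a j.+2 @^-1` A).
Proof.
apply/seteqP; split=> x.
  move=> [x01 /=]; rewrite I01E in x01; rewrite /rotation_tau.
  have [[Nx ->]|[j [Nx mj ->]]] := jump_cases x01 => h.
    by left; rewrite rotation0 // in h; rewrite /= I01E.
  by right; exists j.
move=> [[[x01 Nx] Ax]|[j _ [[/= mj Nx] Ax]]].
  split => //=; rewrite /rotation_tau jump_exceptional // rotation0 //.
split; first by rewrite I01E; exact: rmatched_itv mj.
by rewrite /= /rotation_tau (jump_matched _ mj).
Qed.

Lemma measurable_jump : measurable_fun (@I01 R) (T : RR -> RR).
Proof.
move=> _ A mA; rewrite jump_preimage; apply: measurableU.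
  by apply: measurableI => //; apply: measurableI; [exact: measurable_I01|exact: measurable_exceptional].
apply: bigcupT_measurable => j; apply: measurableI; first exact: measurable_jump_piece.
exact: measurable_rotation_preimage.
Qed.

Definition jump_image j : set RR := rotation a (- j.+2%:Z) @^-1` jump_piece j `&` @I01 R.

Lemma jump_imageP j (x : R) : jump_piece j x -> jump_image j (T x) /\ T x = rotation a j.+2 x.
Proof.
move=> px; have [/= mj Nx] := px.
rewrite /rotation_tau (jump_matched Nx mj); split => //; split=> /=.
  by rewrite rotationK //; exact: rmatched_itv mj.
by rewrite I01E rotation_itv.
Qed.

Lemma jump_image_inv j (y : R) : jump_image j y ->
  jump_piece j (rotation a (- j.+2%:Z) y) /\ T (rotation a (- j.+2%:Z) y) = y.
Proof.
move=> [/= [mj Nx]]; rewrite I01E => y01; split => //.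
by rewrite /rotation_tau (jump_matched Nx mj) rotationNK.
Qed.

Lemma measurable_jump_image j : measurable (jump_image j).
Proof.
apply: measurableI; last exact: measurable_I01.
by apply: measurable_rotation_preimage; exact: measurable_jump_piece.
Qed.

Lemma trivIset_jump_image : trivIset setT jump_image.
Proof.
apply/trivIsetP => i j _ _ ij; apply/seteqP; split=> y //= [yi yj].
have [[/= mi Ni] ti] := jump_image_inv yi; have [[/= mj Nj] tj] := jump_image_inv yj.
have e : rotation a (- i.+2%:Z) y = rotation a (- j.+2%:Z) y.
  by apply: jump_inj; rewrite ?rotation_itv // ti tj.
by move/eqP: ij; apply; rewrite e in mi; exact: matched_inj mi mj.
Qed.

Lemma jump_image_cover : @I01 R `\` exceptional = \bigcup_j jump_image j.
Proof.
apply/seteqP; split=> y.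
  rewrite /= I01E => -[y01 Ny]; have [j mj] := nonexceptional_target y01 Ny.
  by exists j => //; split; [split => //=; rewrite exceptional_rotation|rewrite I01E].
move=> [j _ [[/= mj Ny] y01]]; split => //.
by rewrite exceptional_rotation in Ny.
Qed.

Lemma unif01_setD_exceptional (A : set RR) : measurable A ->
  unif01 R (A `&` (@I01 R `\` exceptional)) = unif01 R A.
Proof.
move=> mA; have mN := measurable_exceptional.
have mI := @measurable_I01 R.
have mX : measurable (A `&` (@I01 R `\` exceptional)) by apply: measurableI => //; exact: measurableD.
apply/eqP; rewrite eq_le; apply/andP; split.
  by apply: le_measure => [||x []] //; exact: mem_set.
have -> : unif01 R A = unif01 R (A `&` @I01 R) by rewrite !unif01E -setIA setIid.
apply: le_trans (le_trans _ (measureU2 (unif01 R) mX mN)) _.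
  apply: le_measure; [apply/mem_set; exact: measurableI|apply/mem_set; exact: measurableU|].
  move=> x [Ax x01]; have [Nx|Nx] := pselect (exceptional x); first by right.
  by left.
rewrite -[leRHS]adde0; apply: leeD => //.
by rewrite le_eqVlt; apply/orP; left; apply/eqP; exact: unif01_exceptional.
Qed.

(** Up to the null set [exceptional], [0,1) is partitioned both by the pieces and by their images,
    and each piece is carried to its image by one rotation. *)
Lemma mp_bijection_jump : mp_bijection T.
Proof.
split.
- split.
  + by move=> x _; rewrite I01E rotation_itv.
  + by move=> x y; rewrite !inE !I01E => x01 y01; exact: jump_inj.
  + move=> y; rewrite I01E => /jump_surj[x x01 xy]; exists x => //.
- exact: measurable_jump.
- move=> A mA; have mT := measurable_jump.
  have mTA : measurable (@I01 R `&` T @^-1` A) by apply: mT => //; exact: measurable_I01.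
  have mI := @measurable_I01 R.
  have E (B : set RR) : lebesgue_measure (@I01 R `&` B) = unif01 R (@I01 R `&` B).
    by rewrite unif01E setIAC setIid.
  rewrite (E (T @^-1` A)) (E A).
  rewrite -(unif01_setD_exceptional mTA) -[RHS]unif01_setD_exceptional; last exact: measurableI.
  have -> : @I01 R `&` T @^-1` A `&` (@I01 R `\` exceptional) =
      \bigcup_j (jump_piece j `&` rotation a j.+2 @^-1` (A `&` jump_image j)).
    rewrite jump_piece_cover; apply/seteqP; split=> x.
      move=> [[x01 /= Ax] [j _ px]]; exists j => //; split => //=.
      by have [pi <-] := jump_imageP px.
    move=> [j _ [px /= []]]; have [pi <-] := jump_imageP px => Ax _.
    split; last by exists j.
    by split => //; rewrite I01E; case: px => /= /rmatched_itv.
  have -> : @I01 R `&` A `&` (@I01 R `\` exceptional) =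
      \bigcup_j (A `&` jump_image j).
    rewrite -setI_bigcupr -jump_image_cover.
    by apply/seteqP; split=> [x [[Ix Ax] h]|x [Ax [Ix Nx]]].
  have mr j : measurable (rotation a j.+2 @^-1` (A `&` jump_image j)).
    by apply: measurable_rotation_preimage; apply: measurableI => //; exact: measurable_jump_image.
  rewrite measure_bigcup; last 2 first.
  + by move=> j _; apply: measurableI; [exact: measurable_jump_piece|exact: mr].
  + apply/trivIsetP => i j _ _ ij; rewrite setIACA.
    have /trivIsetP/(_ i j Logic.I Logic.I ij) -> := trivIset_jump_piece.
    by rewrite set0I.
  rewrite measure_bigcup; last 2 first.
  + by move=> j _; apply: measurableI => //; exact: measurable_jump_image.
  + apply/trivIsetP => i j _ _ ij; rewrite setIACA.
    have /trivIsetP/(_ i j Logic.I Logic.I ij) -> := trivIset_jump_image.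
    by rewrite setI0.
  apply: eq_eseriesr => j _.
  have mAj : measurable (A `&` jump_image j) by apply: measurableI => //; exact: measurable_jump_image.
  change (unif01 R (jump_piece j `&` rotation a j.+2 @^-1` (A `&` jump_image j)) =
    unif01 R (A `&` jump_image j)).
  rewrite -(unif01_rotation a j.+2 mAj) !unif01E; congr lebesgue_measure.
  apply/seteqP; split=> x; first by case=> -[].
  move=> [[/= Ax ix] x01]; split => //; split => //.
  have [px _] := jump_image_inv ix.
  by rewrite I01E in x01; rewrite rotationK in px.
Qed.

Lemma mp_bijection_rotation k : mp_bijection (rotation a k).
Proof.
split.
- split.
  + by move=> x _; rewrite I01E rotation_itv.
  + move=> x y; rewrite !inE !I01E => x01 y01 e.
    by rewrite -(rotationK a k x01) e rotationK.
  + move=> y; rewrite I01E => y01; exists (rotation a (- k) y).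
      by rewrite I01E rotation_itv.
    by rewrite rotationNK.
- by apply: measurable_funTS; exact: measurable_rotation.
- by move=> A mA; rewrite setIC -[LHS]/(unif01 R (rotation a k @^-1` A)) unif01_rotation // unif01E setIC.
Qed.

Lemma mp_bijection_id : mp_bijection (id : R -> R).
Proof.
split => //; split => //.
  by move=> y y01; exists y.
Qed.

End matching_map.

(** * Transport plans and costs *)

Section graph_plans.
Context (R : realType).
Local Notation RR := (measurableTypeR R).
Local Notation mu := (unif01 R).
Variables (T : RR -> RR) (mT : measurable_fun (@I01 R) T).
Hypothesis mTT : measurable_fun [set: RR] T.
Local Notation g := (fun x : RR => (x, T x)).

Lemma measurable_graph_map : measurable_fun [set: RR] g.
Proof. by apply: measurable_fun_pair => //; exact: measurable_id. Qed.

Lemma graph_planE A : graph_plan mT A = mu (g @^-1` A).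
Proof. by rewrite /graph_plan unif01E setIC. Qed.

Lemma measurable_graph : measurable [set z : RR * RR | z.2 = T z.1].
Proof.
have m1 : measurable_fun [set: RR * RR] (fun z : RR * RR => z.2 - T z.1).
  apply: measurable_funB; first exact: measurable_snd.
  by apply: measurableT_comp => //; exact: measurable_fst.
rewrite (_ : [set z : RR * RR | _] = (fun z : RR * RR => z.2 - T z.1) @^-1` [set 0]).
  by rewrite -[X in measurable X]setTI; apply: m1.
by apply/seteqP; split=> z /= => [->|/eqP]; rewrite ?subrr // subr_eq0 => /eqP.
Qed.

Lemma measurable_graph01 : measurable (graph01 T).
Proof.
rewrite (_ : graph01 T = fst @^-1` (@I01 R) `&` [set z : RR * RR | z.2 = T z.1]).
  apply: measurableI; last exact: measurable_graph.
  rewrite -[X in measurable X]setTI; apply: measurable_fst => //; exact: measurable_I01.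
by apply/seteqP; split=> z; rewrite /graph01 /= I01E.
Qed.

(** The set where P fails need not be measurable; it is enclosed in the null set made of all points
    off the graph and all points above N. *)
Lemma graph_plan_ae (P : RR * RR -> Prop) :
  {ae mu, forall x, 0 <= x < 1 -> P (x, T x)} -> {ae graph_plan mT, forall z, P z}.
Proof.
move=> [N [mN N0 PN]].
exists (~` (graph01 T `\` (fst @^-1` N))); split.
- apply: measurableC; apply: measurableD; first exact: measurable_graph01.
  by rewrite -[X in measurable X]setTI; exact: measurable_fst.
- rewrite graph_planE.
  have e : mu (g @^-1` (~` (graph01 T `\` fst @^-1` N))) = mu N.
    rewrite !unif01E; congr lebesgue_measure; apply/seteqP; split=> x [/= h x01]; split => //.
      by apply: contrapT => Nx; apply: h; split => //; split => //=; rewrite -I01E.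
    by move=> [_].
  by rewrite e N0.
- move=> z nP [[z01 z2] Nz]; apply: nP; apply: contrapT => nPz; apply: Nz => /=.
  by apply: PN => /= /(_ z01); rewrite -z2 -surjective_pairing.
Qed.

Lemma graph_plan_integral (f : RR * RR -> \bar R) :
  measurable_fun setT f -> (forall z, (0 <= f z)%E) ->
  (\int[graph_plan mT]_z f z = \int[mu]_x f (x, T x))%E.
Proof.
move=> mf f0.
have mg := measurable_graph_map.
transitivity (\int[pushforward mu g]_z f z)%E.
  by apply: eq_measure_integral => A _ _; exact: graph_planE.
by rewrite ge0_integral_pushforward.
Qed.

Lemma graph_plan_setT : graph_plan mT setT = 1%E.
Proof. by rewrite graph_planE preimage_setT; exact: probability_setT. Qed.

End graph_plans.

Section graph_coupling.
Context (R : realType).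

Lemma couplings_graph_plan (T : R -> R) (b : mp_bijection T) :
  couplings (unif01 R) (unif01 R) (graph_plan (mpb_measurable b)).
Proof.
split=> A mA; rewrite /= /graph_plan unif01E setIC.
  by congr (lebesgue_measure (_ `&` _)); apply/seteqP; split=> [x [] |x Ax]; last split.
rewrite -[RHS]/(lebesgue_measure (A `&` @I01 R)) [RHS](_ : _ = lebesgue_measure (@I01 R `&` A)); last by rewrite setIC.
rewrite -(mpb_preserving b mA) setIC.
by congr (lebesgue_measure (_ `&` _)); apply/seteqP; split=> [x [] |x Ax]; last split.
Qed.

End graph_coupling.

Section mean_plans.
Context (R : realType).
Local Notation RR := (measurableTypeR R).
Variables p0 p1 p2 : {measure set (RR * RR) -> \bar R}.
Local Notation pi := (mean3 p0 p1 p2).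

Lemma mean3E A : pi A = ((3^-1)%:E * (p0 A + p1 A + p2 A))%E.
Proof.
transitivity ((3^-1)%:E * measure_add (measure_add p0 p1) p2 A)%E; first by [].
by congr (_ * _)%E; rewrite measure_addE; congr (_ + _)%E; exact: measure_addE.
Qed.

Lemma mean3_ae (P : RR * RR -> Prop) :
  {ae p0, forall z, P z} -> {ae p1, forall z, P z} -> {ae p2, forall z, P z} ->
  {ae pi, forall z, P z}.
Proof.
move=> [N0 [m0 n0 s0]] [N1 [m1 n1 s1]] [N2 [m2 n2 s2]].
(* The set where P fails lies in each of the three null sets, so in their intersection, which is
   null for all three plans at once. *)
exists (N0 `&` N1 `&` N2); split.
- by apply: measurableI => //; exact: measurableI.
- have h (p : {measure set (RR * RR) -> \bar R}) N : measurable N -> p N = 0%E ->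
      N0 `&` N1 `&` N2 `<=` N -> p (N0 `&` N1 `&` N2) = 0%E.
    move=> mN pN sub; apply: (subset_measure0 _ mN) => //.
    by apply: measurableI => //; exact: measurableI.
  have h0 : p0 (N0 `&` N1 `&` N2) = 0%E by apply: (h p0 N0) => // z [[]].
  have h1 : p1 (N0 `&` N1 `&` N2) = 0%E by apply: (h p1 N1) => // z [[]].
  have h2 : p2 (N0 `&` N1 `&` N2) = 0%E by apply: (h p2 N2) => // z [].
  by rewrite mean3E h0 h1 h2 !adde0 mule0.
- by move=> z nP; split; [split; [exact: s0|exact: s1]|exact: s2].
Qed.

Lemma mean3_integral (f : RR * RR -> \bar R) :
  measurable_fun setT f -> (forall z, (0 <= f z)%E) ->
  (\int[pi]_z f z = (3^-1)%:E * (\int[p0]_z f z + \int[p1]_z f z + \int[p2]_z f z))%E.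
Proof.
move=> mf f0; rewrite /mean3 ge0_integral_mscale //.
by rewrite !ge0_integral_measure_add.
Qed.

End mean_plans.

Section costs.
Context (R : realType).
Local Notation RR := (measurableTypeR R).
Local Notation mu := (unif01 R).
Local Notation a := (alpha R).
Local Notation tau := (@jump R).
Local Notation T := (rotation_tau a tau).

Lemma hfunE k x : 0 <= x < 1 -> hfun a (x, rotation a k x) = (rho a k x)%:~R%:E.
Proof.
move=> x01; rewrite /hfun asboolT; last by exists k.
case: xgetP => [j _ [_ /= e]|/(_ k)]; last by case.
by rewrite (rotation_inj (@irrational_alpha R) e).
Qed.

Lemma measurable_hfun : measurable_fun [set: RR * RR] (hfun a).
Proof.
move=> _ Y mY; rewrite setTI.
pose G k : set (RR * RR) := graph01 (rotation a k).
have mG k : measurable (G k) by apply: measurable_graph01; exact: measurable_rotation.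
have mGU : measurable (\bigcup_k G k).
  by apply: countable_bigcupT_measurable => //; exact: countableP.
rewrite (_ : _ @^-1` _ =
   (\bigcup_(k : int) \bigcup_(v : int) (if `[< Y v%:~R%:E >] then G k `&` fst @^-1` [set x : RR | rho a k x == v] else set0)) `|`
   (if `[< Y +oo%E >] then ~` \bigcup_k G k else set0)).
  apply: measurableU.
    apply: countable_bigcupT_measurable => [|k]; first exact: countableP.
    apply: countable_bigcupT_measurable => [|v]; first exact: countableP.
    case: ifP => // _; apply: measurableI => //.
    by rewrite -[X in measurable X]setTI; apply: measurable_fst => //; exact: measurable_rho.
  by case: ifP => // _; exact: measurableC.
apply/seteqP; split=> z /=.
  have [[k [z01 z2]]|nz] := pselect (exists k, G k z).
    have zE : z = (z.1, rotation a k z.1) by rewrite -z2 -surjective_pairing.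
    rewrite zE hfunE // => Yz; left; exists k => //; exists (rho a k z.1) => //.
    by rewrite asboolT //; split => //=; split.
  rewrite /hfun asboolF // => Yoo; right; rewrite asboolT //.
  by move=> [k _ Gk]; apply: nz; exists k.
case=> [[k _ [v _]]|].
  case: ifP => // /asboolP Yv [[z01 z2] /= /eqP rv].
  by rewrite [z]surjective_pairing z2 hfunE // rv.
case: ifP => // /asboolP Yoo nz; rewrite /hfun asboolF // => -[k Gk].
by apply: nz; exists k.
Qed.

Lemma jump_out (x : R) : ~~ (0 <= x < 1) -> jump x = 0.
Proof.
move=> nx; rewrite /jump asboolF // => -[_ [j /rmatched_itv h]].
by rewrite h in nx.
Qed.

Lemma measurable_jumpT : measurable_fun [set: RR] (T : RR -> RR).
Proof.
move=> _ A mA; rewrite setTI.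
rewrite (_ : _ @^-1` A = (@I01 R `&` T @^-1` A) `|` (~` @I01 R `&` rotation a 0 @^-1` A)).
  apply: measurableU.
    by apply: measurable_jump => //; exact: measurable_I01.
  apply: measurableI; [by apply: measurableC; exact: measurable_I01|].
  exact: measurable_rotation_preimage.
have E x : ~ @I01 R x -> T x = rotation a 0 x.
  by rewrite I01E => /negP nx; rewrite /rotation_tau jump_out.
apply/seteqP; split=> x /=.
  by have [h|h] := pselect (@I01 R x); [left|right; rewrite -E].
by case=> -[] // h; rewrite -E.
Qed.

Lemma measurable_id_graph : measurable (graph01 (id : R -> R)).
Proof. by apply: measurable_graph01; exact: measurable_id. Qed.

Lemma measurable_rotation_graph k : measurable (graph01 (rotation a k)).
Proof. by apply: measurable_graph01; exact: measurable_rotation. Qed.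

Lemma measurable_jump_graph : measurable (graph01 T).
Proof. by apply: measurable_graph01; exact: measurable_jumpT. Qed.

Lemma measurable_cost : measurable_fun [set: RR * RR] (cost a tau).
Proof.
apply: measurable_fun_ifT.
- apply: (measurable_fun_bool true); rewrite setTI.
  rewrite (_ : _ @^-1` _ = graph01 id `|` graph01 (rotation a 1) `|` graph01 T).
    apply: measurableU; [apply: measurableU; [exact: measurable_id_graph|exact: measurable_rotation_graph]|exact: measurable_jump_graph].
  by apply/seteqP; split=> z /=; [move/set_mem|move/mem_set].
- by apply: measurable_maxe => //; exact: measurable_hfun.
- exact: measurable_cst.
Qed.

Lemma cost_ge0 z : (0 <= cost a tau z)%E.
Proof. by rewrite /cost; case: ifP => // _; rewrite le_max lexx orbT. Qed.

Lemma hfun_id (x : R) : 0 <= x < 1 -> hfun a (x, x) = 1%E.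
Proof. by move=> x01; have := @hfunE 0 x x01; rewrite rotation0 // rho0. Qed.

Lemma hfun_rotation (x : R) : 0 <= x < 1 ->
  hfun a (x, rotation a 1 x) = (1 + fsgn x)%:~R%:E.
Proof. by move=> x01; rewrite hfunE // rho1. Qed.

Lemma hfun_jump (x : R) : 0 <= x < 1 -> ~ exceptional x -> hfun a (x, T x) = 2%E.
Proof.
move=> x01 Nx; rewrite /rotation_tau hfunE //.
have [[//]|[j [_ mj ->]]] := jump_cases x01.
by move: mj; rewrite rmatchedE => /and3P[_ _ /eqP ->].
Qed.

Lemma cost_id (x : R) : 0 <= x < 1 -> cost a tau (x, x) = 1%E.
Proof.
move=> x01; rewrite /cost ifT; last by rewrite inE; left; left.
by rewrite hfun_id //; apply/max_idPl; rewrite lee_fin.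
Qed.

Lemma cost_rotation (x : R) : 0 <= x < 1 ->
  cost a tau (x, rotation a 1 x) = (1 + fsgn x)%:~R%:E.
Proof.
move=> x01; rewrite /cost ifT; last by rewrite inE; left; right.
rewrite hfun_rotation // /fsgn; case: ifP => _; apply/max_idPl; rewrite lee_fin //.
Qed.

Lemma cost_jump (x : R) : 0 <= x < 1 -> ~ exceptional x -> cost a tau (x, T x) = 2%E.
Proof.
move=> x01 Nx; rewrite /cost ifT; last by rewrite inE; right.
by rewrite hfun_jump //; apply/max_idPl; rewrite lee_fin.
Qed.

Lemma ae_nonexceptional : {ae mu, forall x : R, ~ exceptional x}.
Proof.
exists (@exceptional R); split; [exact: measurable_exceptional|exact: unif01_exceptional|].
by move=> x /= /contrapT.
Qed.

End costs.

Section coupling_integrals.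
Context d1 d2 (X : measurableType d1) (Y : measurableType d2) (R : realType).
Variables (mu : probability X R) (nu : probability Y R).
Variable sigma : {measure set (X * Y) -> \bar R}.
Hypothesis coupled : couplings mu nu sigma.

Lemma coupling_fst (f : X -> \bar R) : measurable_fun setT f ->
  (forall x, (0 <= f x)%E) -> (\int[sigma]_z f z.1 = \int[mu]_x f x)%E.
Proof.
move=> mf f0; have [c1 _] := coupled.
transitivity (\int[pushforward sigma fst]_x f x)%E.
  by rewrite (ge0_integral_pushforward measurable_fst) // preimage_setT.
apply: eq_measure_integral => A mA _; apply: etrans (c1 A mA).
by congr (sigma _); apply/seteqP; split=> [z Az|z []].
Qed.

Lemma coupling_snd (f : Y -> \bar R) : measurable_fun setT f ->
  (forall x, (0 <= f x)%E) -> (\int[sigma]_z f z.2 = \int[nu]_x f x)%E.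
Proof.
move=> mf f0; have [_ c2] := coupled.
transitivity (\int[pushforward sigma snd]_x f x)%E.
  by rewrite (ge0_integral_pushforward measurable_snd) // preimage_setT.
apply: eq_measure_integral => A mA _; apply: etrans (c2 A mA).
by congr (sigma _); apply/seteqP; split=> [z Az|z []].
Qed.

Lemma coupling_fst_L1 (f : X -> R) : L1 mu f ->
  sigma.-integrable setT (fun z => (f z.1)%:E) /\
  (\int[sigma]_z (f z.1)%:E = \int[mu]_x (f x)%:E)%E.
Proof.
move=> /Lfun1_integrable fi; have /integrableP[mf fi'] := fi.
have i : sigma.-integrable setT (fun z => (f z.1)%:E).
  apply/integrableP; split; first by apply: (measurableT_comp mf); exact: measurable_fst.
  rewrite (coupling_fst (f := fun x => `|(f x)%:E|%E)) //.
  by apply: measurableT_comp.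
split => //; rewrite -(integral_pushforward measurable_fst mf i measurableT).
apply: eq_measure_integral => A mA _; have [c1 _] := coupled.
apply: etrans (c1 A mA); by congr (sigma _); apply/seteqP; split=> [z Az|z []].
Qed.

Lemma coupling_snd_L1 (f : Y -> R) : L1 nu f ->
  sigma.-integrable setT (fun z => (f z.2)%:E) /\
  (\int[sigma]_z (f z.2)%:E = \int[nu]_x (f x)%:E)%E.
Proof.
move=> /Lfun1_integrable fi; have /integrableP[mf fi'] := fi.
have i : sigma.-integrable setT (fun z => (f z.2)%:E).
  apply/integrableP; split; first by apply: (measurableT_comp mf); exact: measurable_snd.
  rewrite (coupling_snd (f := fun x => `|(f x)%:E|%E)) //.
  by apply: measurableT_comp.
split => //; rewrite -(integral_pushforward measurable_snd mf i measurableT).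
apply: eq_measure_integral => A mA _; have [_ c1] := coupled.
apply: etrans (c1 A mA); by congr (sigma _); apply/seteqP; split=> [z Az|z []].
Qed.

Lemma coupling_oplus (phi : X -> R) (psi : Y -> R) : L1 mu phi -> L1 nu psi ->
  sigma.-integrable setT (EFin \o oplus phi psi) /\
  (\int[sigma]_z (oplus phi psi z)%:E = (\int[mu]_x phi x + \int[nu]_y psi y)%:E)%E.
Proof.
move=> Lphi Lpsi; have [i1 e1] := coupling_fst_L1 Lphi.
have [i2 e2] := coupling_snd_L1 Lpsi.
split.
  rewrite (_ : _ \o _ = (fun z => (phi z.1)%:E) \+ (fun z => (psi z.2)%:E))%E //.
  exact: integrableD.
rewrite /oplus; under eq_integral do rewrite EFinD.
rewrite integralD //= e1 e2 EFinD /Rintegral !fineK //.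
- by apply: integrable_fin_num => //; exact/Lfun1_integrable.
- by apply: integrable_fin_num => //; exact/Lfun1_integrable.
Qed.

(** Integrate f <= c + (f - c)_+ for f = phi (+) psi. The positive part of f is inserted because c
    may be infinite, so that only integrals of nonnegative functions are compared. *)
Lemma relaxed_weak_duality (phi : X -> R) (psi : Y -> R) (c : X * Y -> \bar R) :
  L1 mu phi -> L1 nu psi -> measurable_fun setT c -> (forall z, (0 <= c z)%E) ->
  ((\int[mu]_x phi x + \int[nu]_y psi y)%:E <=
     \int[sigma]_z c z + \int[sigma]_z maxe ((oplus phi psi z)%:E - c z) 0)%E.
Proof.
move=> Lphi Lpsi mc c0; have [io eo] := coupling_oplus Lphi Lpsi.
have mo := measurable_int sigma io.
have mm : measurable_fun setT (fun z => maxe ((oplus phi psi z)%:E - c z) 0)%E.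
  by apply: measurable_maxe => //; apply: emeasurable_funB.
have m0 z : (0 <= maxe ((oplus phi psi z)%:E - c z) 0)%E by rewrite le_max lexx orbT.
rewrite -eo -ge0_integralD //.
apply: (@le_trans _ _ (\int[sigma]_z (fun z => (oplus phi psi z)%:E)^\+ z)%E).
  rewrite integralE leeBlDr ?leeDl ?integral_ge0 //.
  have /integrable_fin_num := integrable_funeneg measurableT io.
  exact.
apply: ge0_le_integral => //.
- exact: measurable_funepos.
- exact: emeasurable_funD.
move=> z _; rewrite funeposE ge_max; apply/andP; split; last by rewrite adde_ge0.
case: (c z) (c0 z) => [r _| _ |//]; last first.
  rewrite addye ?leey //.
  by rewrite gt_eqF // (lt_le_trans (ltNyr 0)) // le_max lexx orbT.
by rewrite -EFinB -EFin_max -EFinD lee_fin -lerBlDl le_max lexx.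
Qed.

Lemma weak_duality (phi : X -> R) (psi : Y -> R) (c : X * Y -> \bar R) :
  L1 mu phi -> L1 nu psi -> measurable_fun setT c -> (forall z, (0 <= c z)%E) ->
  (forall z, ((oplus phi psi z)%:E <= c z)%E) ->
  ((\int[mu]_x phi x + \int[nu]_y psi y)%:E <= \int[sigma]_z c z)%E.
Proof.
move=> Lphi Lpsi mc c0 le.
rewrite (le_trans (relaxed_weak_duality Lphi Lpsi mc c0)) //.
rewrite [X in (_ + X)%E]integral0_eq ?adde0 // => z _.
by apply/max_idPr; rewrite sube_le0.
Qed.

Lemma coupling_setT : sigma setT = 1%E.
Proof.
by have [c1 _] := coupled; rewrite -setXTT c1 // probability_setT.
Qed.

End coupling_integrals.

Lemma bounded_L1 d (X : measurableType d) (R : realType) (m : {measure set X -> \bar R})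
    (f : X -> R) (M : R) : (m setT < +oo)%E -> measurable_fun setT f ->
  (forall x, `|f x| <= M) -> L1 m f.
Proof.
move=> fin mf le; rewrite /L1 /=; apply/Lfun1_integrable.
apply: measurable_bounded_integrable => //.
exists M; split; first exact: num_real.
by move=> N MN x _; exact: le_trans (le x) (ltW MN).
Qed.

(** * The approximating dual functions *)

Section dual_sequence.
Context (R : realType).
Local Notation RR := (measurableTypeR R).
Local Notation mu := (unif01 R).
Local Notation a := (alpha R).
Local Notation tau := (@jump R).
Local Notation T := (rotation_tau a tau).

Lemma unif01_setT : mu setT = 1%E.
Proof. exact: probability_setT. Qed.

Lemma unif01_setT_lty : (mu setT < +oo)%E.
Proof. by rewrite unif01_setT ltry. Qed.

(** Both ends are controlled: a late match joins x to a point beyond the window of x, so a correct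
    cell at x says nothing about the cell of T x. *)
Definition bad_orbit n : set RR := @bad R n `|` T @^-1` (@bad R n).

(* The correction on the bad orbits makes the sum of both functions nonpositive
   there, since the potential is at most 2^n. *)
Definition dual_psi n (y : R) : R := (pot n (cell n y))%:R.

Definition dual_phi n (x : R) : R := 1 - dual_psi n x - (2 ^ n).+1%:R * \1_(bad_orbit n) x.

Lemma measurable_bad_orbit n : measurable (bad_orbit n).
Proof.
apply: measurableU; first exact: measurable_bad.
by rewrite -[X in measurable X]setTI; apply: measurable_jumpT => //; exact: measurable_bad.
Qed.

Lemma unif01_bad_orbit n : (mu (bad_orbit n) <= 2%:E * mu (@bad R n))%E.
Proof.
have mB := @measurable_bad R n.
have mT : measurable (T @^-1` (@bad R n) : set RR).
  by rewrite -[X in measurable X]setTI; apply: measurable_jumpT.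
apply: le_trans (measureU2 mu mB mT) _.
rewrite (_ : 2%:E = 1 + 1)%E // ge0_muleDl // mul1e leeD //.
rewrite le_eqVlt; apply/orP; left; apply/eqP.
change (mu (T @^-1` (@bad R n)) = mu (@bad R n)).
by rewrite !unif01E setIC (mpb_preserving (mp_bijection_jump R) mB) setIC.
Qed.

Lemma dual_psi_ge0 n y : 0 <= dual_psi n y.
Proof. by []. Qed.

Lemma dual_psi_le n y : dual_psi n y <= (2 ^ n)%:R.
Proof. by rewrite /dual_psi ler_nat pot_le. Qed.

Lemma measurable_dual_psi n : measurable_fun [set: RR] (dual_psi n : RR -> RR).
Proof.
move=> _ Y mY; rewrite setTI.
have := @measurable_floor R (den n)%:R (fun z => `[< Y (pot n z)%:R >]).
congr measurable; apply/seteqP; split=> x /=; first by move/asboolP.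
by move=> h; apply/asboolP.
Qed.

Lemma measurable_dual_phi n : measurable_fun [set: RR] (dual_phi n : RR -> RR).
Proof.
apply: measurable_funB.
  by apply: measurable_funB => //; exact: measurable_dual_psi.
apply: measurable_funM => //.
by apply: measurable_indic; exact: measurable_bad_orbit.
Qed.

Lemma bounded_dual_psi n y : `|dual_psi n y| <= (2 ^ n)%:R.
Proof. by rewrite ger0_norm ?dual_psi_ge0 // dual_psi_le. Qed.

Lemma dual_sum n x y : dual_phi n x + dual_psi n y =
  1 + (dual_psi n y - dual_psi n x) - (2 ^ n).+1%:R * \1_(bad_orbit n) x.
Proof. by rewrite /dual_phi; ring. Qed.

Lemma bounded_dual_phi n x : `|dual_phi n x| <= 2 * (2 ^ n).+1%:R.
Proof.
have := dual_psi_ge0 n x; have := dual_psi_le n x.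
have -> : (2 ^ n).+1%:R = (2 ^ n)%:R + 1 :> R by rewrite -addn1 natrD.
rewrite /dual_phi ler_norml indicE; case: (_ \in _) => /=.
  rewrite mulr1 -addn1 natrD; lra.
rewrite mulr0; have : 0 <= (2 ^ n)%:R :> R by []. lra.
Qed.

Lemma dual_bad n x y : bad_orbit n x -> dual_phi n x + dual_psi n y <= 0.
Proof.
move=> bx; rewrite dual_sum indicE mem_set // mulr1 -addn1 natrD.
by have := dual_psi_ge0 n x; have := dual_psi_le n y; lra.
Qed.

Lemma dual_good n x y : ~ bad_orbit n x ->
  dual_phi n x + dual_psi n y = 1 + (dual_psi n y - dual_psi n x).
Proof. by move=> bx; rewrite dual_sum indicE memNset // mulr0 subr0. Qed.

Lemma not_bad_orbit n x : 0 <= x < 1 -> ~ bad_orbit n x ->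
  good n (width n) x /\ good n (width n) (T x).
Proof.
move=> x01 nb; split; apply: contrapT => /negP g; apply: nb; [left|right] => //.
by split => //; exact: rotation_itv.
Qed.

Lemma dual_psi_orbit n (j : nat) x : (j <= width n)%N -> good n (width n) x ->
  dual_psi n (rotation a j x) - dual_psi n x = (rho a j x)%:~R - 1.
Proof.
move=> jw g; rewrite (rho_cell jw g) /dual_psi.
have [[z ->] _] := @cell_rotation R n j _ _ jw g.
by rewrite pot_periodic intrD addrAC subrr add0r intrB -!pmulrn.
Qed.

Lemma width_ge n : (0 < width n)%N.
Proof. by rewrite /width expn_gt0. Qed.

Lemma dual_rotation n x : 0 <= x < 1 -> ~ bad_orbit n x ->
  dual_phi n x + dual_psi n (rotation a 1 x) = (1 + fsgn x)%:~R.
Proof.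
move=> x01 nb; have [g _] := not_bad_orbit x01 nb.
rewrite dual_good // (@dual_psi_orbit n 1 x (width_ge n) g) rho1 //.
by rewrite addrCA subrr addr0.
Qed.

Lemma dual_jump_eq n j x : 0 <= x < 1 -> ~ exceptional x -> ~ bad_orbit n x ->
  rmatched j x -> (j < den n)%N -> dual_phi n x + dual_psi n (T x) = 2.
Proof.
move=> x01 Nx nb mj jd; have [g _] := not_bad_orbit x01 nb.
have jw : (j.+2 <= width n)%N by rewrite /width; nia.
rewrite dual_good // /rotation_tau (jump_matched Nx mj) dual_psi_orbit //.
by move: mj; rewrite rmatchedE => /and3P[_ _ /eqP ->]; rewrite addrCA subrr addr0.
Qed.

(** Early matches give equality. In a match made later, x and T x are both still free after [den n]
    rounds, hence on opposite sides of the middle level, and the sum is even at most 1. *)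
Lemma dual_jump_le n x : (0 < n)%N -> 0 <= x < 1 -> ~ exceptional x -> ~ bad_orbit n x ->
  dual_phi n x + dual_psi n (T x) <= 2.
Proof.
move=> n0 x01 Nx nb; have [j mj] := nonexceptional_matched x01 Nx.
have [jd|dj] := ltnP j (den n); first by rewrite (dual_jump_eq x01 Nx nb mj jd).
have [g gT] := not_bad_orbit x01 nb.
have sx : csource n (den n) (cell n x).
  have [<- _] := rmatching_cell x01 g.
  by move: mj; rewrite rmatchedE => /and3P[+ _ _]; exact: source_anti.
have T01 : 0 <= T x < 1 by exact: rotation_itv.
have tx : ctarget n (den n) (cell n (T x)).
  have [_ <-] := rmatching_cell T01 gT.
  rewrite /rotation_tau (jump_matched Nx mj).
  by move: mj; rewrite rmatchedE => /and3P[_ + _]; exact: target_anti.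
have := leq_trans (ctarget_le n0 tx) (csource_ge n0 sx).
rewrite -(ler_nat R) dual_good // -/(dual_psi n x) -/(dual_psi n (T x)); lra.
Qed.

Lemma dual_le_cost n x y : (0 < n)%N ->
  ((dual_phi n x + dual_psi n y)%:E <= cost a tau (x, y))%E.
Proof.
move=> n0; have [bx|nb] := pselect (bad_orbit n x).
  by apply: le_trans (cost_ge0 _); rewrite lee_fin dual_bad.
have id_case : 0 <= x < 1 -> y = x -> ((dual_phi n x + dual_psi n y)%:E <= cost a tau (x, y))%E.
  by move=> x01 ->; rewrite cost_id // dual_good // subrr addr0.
have [zG|zG] := pselect ((graph01 id `|` graph01 (rotation a 1) `|` graph01 T) (x, y)); last first.
  by rewrite /cost ifF ?leey //; apply: memNset.
case: zG => [[[x01 /= yx]|[/= x01 yx]]|[/= x01 yx]].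
- exact: id_case.
- by rewrite yx cost_rotation // lee_fin dual_rotation.
(* On the exceptional set tau is 0, so the point lies on the diagonal. *)
have [Nx|Nx] := pselect (exceptional x).
  by apply: id_case => //; rewrite yx /rotation_tau jump_exceptional // rotation0.
by rewrite yx cost_jump // lee_fin; exact: dual_jump_le.
Qed.

Lemma L1_dual_phi n : L1 mu (dual_phi n).
Proof.
apply: (@bounded_L1 _ RR R mu _ _ _ _ (bounded_dual_phi n)); last exact: measurable_dual_phi.
exact: unif01_setT_lty.
Qed.

Lemma L1_dual_psi n : L1 mu (dual_psi n).
Proof.
apply: (@bounded_L1 _ RR R mu _ _ _ _ (bounded_dual_psi n)); last exact: measurable_dual_psi.
exact: unif01_setT_lty.
Qed.

(** Both marginals are the same measure, so [dual_psi] cancels and only the correction on the bad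
    orbits is left. *)
Lemma dual_integral n : \int[mu]_x dual_phi n x + \int[mu]_y dual_psi n y =
  1 - (2 ^ n).+1%:R * fine (mu (bad_orbit n)).
Proof.
have mB := measurable_bad_orbit n.
have L1B : L1 mu \1_(bad_orbit n).
  apply: (@bounded_L1 _ RR R mu _ 1) => //; first exact: unif01_setT_lty.
  by move=> x; rewrite indicE; case: (_ \in _); rewrite ?normr1 ?normr0.
have i1 := (Lfun1_integrable _ _).1 (L1_dual_phi n).
have i2 := (Lfun1_integrable _ _).1 (L1_dual_psi n).
have i3 := (Lfun1_integrable _ _).1 L1B.
rewrite -RintegralD //.
have -> : \int[mu]_x (dual_phi n x + dual_psi n x) =
    \int[mu]_x (1 - (2 ^ n).+1%:R * \1_(bad_orbit n) x).
  by apply: eq_Rintegral => x _; rewrite dual_sum subrr addr0.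
rewrite RintegralB //; last 2 first.
- by apply/Lfun1_integrable; exact: Lfun_cst.
- have -> : EFin \o (fun x => (2 ^ n).+1%:R * \1_(bad_orbit n) x : R) =
     (fun x => (2 ^ n).+1%:R%:E * (\1_(bad_orbit n) x)%:E)%E by [].
  exact: integrableZl.
rewrite Rintegral_cst // mul1r RintegralZl //; congr (_ - _ * _).
  by rewrite [X in fine X]unif01_setT.
by rewrite /Rintegral integral_indic // setIT.
Qed.

(** Indices start at 1 because the middle level 2^(n-1), and with it feasibility, needs n > 0. *)
Lemma dual_integral_cvg :
  (\int[mu]_x dual_phi n.+1 x + \int[mu]_y dual_psi n.+1 y) @[n --> \oo] --> (1 : R).
Proof.
have fin (A : set RR) : measurable A -> mu A \is a fin_num.
  by move=> mA; exact: fin_num_measure.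
have mB n := @measurable_bad R n.
have mBO n := measurable_bad_orbit n.
rewrite (_ : (fun n => \int[mu]_x dual_phi n.+1 x + \int[mu]_y dual_psi n.+1 y) =
   (fun n => 1 - (2 ^ n.+1).+1%:R * fine (mu (bad_orbit n.+1)))); last first.
  by apply/funext => n; exact: dual_integral.
suff h : ((2 ^ n.+1).+1%:R * fine (mu (bad_orbit n.+1)) : R) @[n --> \oo] --> (0 : R).
  have h1 : (1 : R) @[n --> \oo] --> (1 : R) by exact: cvg_cst.
  by have := cvgB h1 h; rewrite subr0; exact.
(* The constant 4 is the product of 2^n + 1 <= 2 [den n] and of the factor 2 in the measure of
   [bad_orbit]. *)
apply: (@squeeze_cvgr _ _ _ _ (fun=> 0) (fun n => 4 * fine (mu (@bad R n.+1) * ((den n.+1)%:R ^+ 1)%:E)%E)).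
- apply: nearW => n; apply/andP; split; first by rewrite mulr_ge0 // fine_ge0.
  have := unif01_bad_orbit n.+1.
  rewrite fineM ?fin // expr1 /= -{1}(fineK (fin _ (mBO n.+1))) -{1}(fineK (fin _ (mB n.+1))) -EFinM lee_fin.
  have arith (x y u v : R) : 0 <= u -> 0 <= x -> u <= 2 * v -> x <= 2 * y -> u * x <= 4 * (y * v).
    move=> u0 x0 uv xy.
    have h1 : u * x <= (2 * v) * x by rewrite ler_wpM2r.
    have h2 : v * x <= v * (2 * y) by rewrite ler_wpM2l //; lra.
    lra.
  apply: arith => //; first exact: fine_ge0.
  rewrite -addn1 natrD; have := exp2_le_den R n.+1; rewrite -natrX.
  have : 1 <= (den n.+1)%:R :> R by rewrite ler1n den_gt0.
  lra.
- exact: cvg_cst.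
rewrite -[X in _ --> X](mulr0 4); apply: cvgMr.
have := @bad_cvg0 R 1 isT; rewrite -(@cvg_shiftS _ _) /=.
by move/fine_cvg.
Qed.

(** Borel-Cantelli: the measures of the bad orbits are summable. *)
Lemma ae_eventually_good : {ae mu, forall x : R, \forall n \near \oo, ~ bad_orbit n x}.
Proof.
have mBO n := measurable_bad_orbit n.
exists (lim_sup_set bad_orbit); split.
- by apply: bigcapT_measurable => n; apply: bigcup_measurable.
- apply: lim_sup_set_cvg0 => //.
  (* The term is 2 * 16 * 2^-k, written as 64 / 2^(k+1) to match the known geometric series. *)
  apply: (@le_lt_trans _ _ (limn (eseries (fun k => (64 / (2 ^ (k + 1))%:R : R)%:E)))).
    apply: lee_nneseries => n _ //.
    apply: le_trans (unif01_bad_orbit n) _.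
    have := @bad_small R n 0 isT; rewrite expr0 mule1 => le.
    apply: (@le_trans _ _ (2%:E * (16 * 2^-1 ^+ n)%:E)%E); first by rewrite lee_wpmul2l.
    rewrite -EFinM lee_fin addn1 expnS natrM natrX exprVn invfM.
    by rewrite le_eqVlt; apply/orP; left; apply/eqP; field; rewrite expf_neq0.
  have /cvg_lim -> // := @cvg_geometric_eseries_half R 64 0.
  by rewrite ltry.
- move=> x /= nx n _; apply: contrapT => h; apply: nx; exists n => // m /= nm bm.
  by apply: h; exists m.
Qed.

End dual_sequence.

Section ae_imply.
Context d (X : measurableType d) (R : realType) (m : {measure set X -> \bar R}).
Implicit Types P Q S : X -> Prop.

Lemma ae_imply P Q : {ae m, forall x, P x} -> (forall x, P x -> Q x) -> {ae m, forall x, Q x}.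
Proof. by move=> mP PQ; apply: filterS mP. Qed.

Lemma ae_imply2 P Q S : {ae m, forall x, P x} -> {ae m, forall x, Q x} ->
  (forall x, P x -> Q x -> S x) -> {ae m, forall x, S x}.
Proof. by move=> mP mQ PQS; apply: filterS2 mP mQ. Qed.

End ae_imply.

(** * Values of the cost and limit of the dual sequence *)

Section primal_values.
Context (R : realType).
Local Notation RR := (measurableTypeR R).
Local Notation mu := (unif01 R).
Local Notation a := (alpha R).
Local Notation tau := (@jump R).
Local Notation T := (rotation_tau a tau).
Variables (bij0 : mp_bijection (id : R -> R)) (bij1 : mp_bijection (rotation a 1))
          (bijtau : mp_bijection T).
Local Notation pi0 := (graph_plan (mpb_measurable bij0)).
Local Notation pi1 := (graph_plan (mpb_measurable bij1)).
Local Notation pitau := (graph_plan (mpb_measurable bijtau)).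
Local Notation h := (hfun a).
Local Notation c := (cost a tau).
Local Notation pi := (mean3 pi0 pi1 pitau).

Lemma measurable_idT : measurable_fun [set: RR] (id : RR -> RR).
Proof. exact: measurable_id. Qed.

Lemma pi0_ae (P : RR * RR -> Prop) :
  {ae mu, forall x : R, 0 <= x < 1 -> P (x, x)} -> {ae pi0, forall z, P z}.
Proof. exact: (graph_plan_ae (T := id) _ measurable_idT). Qed.

Lemma pi1_ae (P : RR * RR -> Prop) :
  {ae mu, forall x : R, 0 <= x < 1 -> P (x, rotation a 1 x)} -> {ae pi1, forall z, P z}.
Proof. exact: (graph_plan_ae _ (measurable_rotation a 1)). Qed.

Lemma pitau_ae (P : RR * RR -> Prop) :
  {ae mu, forall x : R, 0 <= x < 1 -> ~ exceptional x -> P (x, T x)} -> {ae pitau, forall z, P z}.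
Proof.
move=> mP; apply: (graph_plan_ae _ (@measurable_jumpT R)).
by apply: (ae_imply2 mP (@ae_nonexceptional R)) => x Px Nx x01; exact: Px.
Qed.

Lemma h_ae0 : {ae pi0, forall z, h z = 1%E}.
Proof. by apply: pi0_ae; apply: aeW => x x01; exact: hfun_id. Qed.

Lemma c_ae0 : {ae pi0, forall z, c z = 1%E}.
Proof. by apply: pi0_ae; apply: aeW => x x01; exact: cost_id. Qed.

Lemma h_ae1 : {ae pi1, forall z, h z = (1 + fsgn z.1)%:~R%:E}.
Proof. by apply: pi1_ae; apply: aeW => x x01; exact: hfun_rotation. Qed.

Lemma c_ae1 : {ae pi1, forall z, c z = (1 + fsgn z.1)%:~R%:E}.
Proof. by apply: pi1_ae; apply: aeW => x x01; exact: cost_rotation. Qed.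

Lemma h_aetau : {ae pitau, forall z, h z = 2%E}.
Proof. by apply: pitau_ae; apply: aeW => x x01 Nx; exact: hfun_jump. Qed.

Lemma c_aetau : {ae pitau, forall z, c z = 2%E}.
Proof. by apply: pitau_ae; apply: aeW => x x01 Nx; exact: cost_jump. Qed.

(** The truncation at 0 is invisible: h takes only the values 0, 1 and 2 almost everywhere on the
    three graphs. *)
Lemma c_ae_h : {ae pi, forall z, c z = h z}.
Proof.
apply: mean3_ae.
- by apply: (ae_imply2 h_ae0 c_ae0) => z -> ->.
- by apply: (ae_imply2 h_ae1 c_ae1) => z -> ->.
- by apply: (ae_imply2 h_aetau c_aetau) => z -> ->.
Qed.

Lemma integral_ae_cst (p : {measure set (RR * RR) -> \bar R}) (f : RR * RR -> \bar R) (v : R) :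
  p setT = 1%E -> measurable_fun setT f -> {ae p, forall z, f z = v%:E} ->
  (\int[p]_z f z = v%:E)%E.
Proof.
move=> p1 mf fv; rewrite (ae_eq_integral (cst v%:E)) //.
  by rewrite integral_cst // p1 mule1.
by apply: (ae_imply fv) => z + _.
Qed.

Lemma cost_pi0 : (\int[pi0]_z c z = 1)%E.
Proof.
apply: integral_ae_cst c_ae0; last exact: measurable_cost.
exact: graph_plan_setT.
Qed.

Lemma cost_pitau : (\int[pitau]_z c z = 2)%E.
Proof.
apply: integral_ae_cst c_aetau; last exact: measurable_cost.
exact: graph_plan_setT.
Qed.

Lemma h_pitau : (\int[pitau]_z h z = 2)%E.
Proof.
apply: integral_ae_cst h_aetau; last exact: measurable_hfun.
exact: graph_plan_setT.
Qed.

Lemma unif01_half : mu [set x : RR | x < 2^-1] = (2^-1)%:E.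
Proof.
rewrite unif01E (_ : _ `&` _ = `[0, 2^-1[%classic).
  by rewrite lebesgue_measure_itv /= lte_fin invr_gt0 ltr0n sube0.
apply/seteqP; split=> x /=; rewrite I01E in_itv /= => h1; lra.
Qed.

Lemma cost_pi1 : (\int[pi1]_z c z = 1)%E.
Proof.
rewrite (graph_plan_integral _ (measurable_rotation a 1) (@measurable_cost R) (@cost_ge0 R)).
have mf := @measurable_fsgn R.
(* On [0,1) the value 1 + [fsgn] is 2 on the first half and 0 on the second. *)
transitivity (\int[mu]_x (2%:E * (\1_[set x : RR | x < 2^-1] x)%:E))%E.
  apply: ae_eq_integral => //.
  - apply: measurableT_comp; first exact: measurable_cost.
    apply: measurable_graph_map; exact: measurable_rotation.
  - apply: measurable_funeM; apply/measurable_EFinP; exact: measurable_indic.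
  exists (~` @I01 R); split.
  + by apply: measurableC; exact: measurable_I01.
  + by change (mu (~` @I01 R) = 0%E); rewrite unif01E setICl measure0.
  + move=> x nx x01; apply: nx => _; rewrite I01E in x01.
    rewrite cost_rotation // /fsgn indicE; case: ifPn => xh.
      by rewrite mem_set // mule1.
    by rewrite memNset ?mule0 //; apply/negP.
rewrite integralZl //; last first.
  apply/Lfun1_integrable; apply: (@bounded_L1 _ RR R mu _ 1) => //.
    exact: unif01_setT_lty.
  by move=> x; rewrite indicE; case: (_ \in _); rewrite ?normr1 ?normr0.
rewrite integral_indic // setIT [X in (_ * X)%E]unif01_half -EFinM; congr EFin.
by rewrite divff.
Qed.

(** Weak duality against each pair of the dual sequence, whose values tend to 1. *)
Lemma cost_optimal_value sigma : couplings mu mu sigma -> (1 <= \int[sigma]_z c z)%E.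
Proof.
move=> cs.
have cv : (\int[mu]_x dual_phi n.+1 x + \int[mu]_y dual_psi n.+1 y)%:E @[n --> \oo] --> (1%:E : \bar R).
  by apply: cvg_EFin; [exact: nearW|exact: dual_integral_cvg].
rewrite -(cvg_lim _ cv) //; apply: lime_le; first by apply/cvg_ex; exists 1%:E.
apply: nearW => n; apply: weak_duality => //.
- exact: L1_dual_phi.
- exact: L1_dual_psi.
- exact: measurable_cost.
- exact: cost_ge0.
- by move=> [x y]; exact: dual_le_cost.
Qed.

Lemma cost_pi : (\int[pi]_z c z = (4 / 3)%:E)%E.
Proof.
rewrite mean3_integral; [|exact: measurable_cost|exact: cost_ge0].
by rewrite cost_pi0 cost_pi1 cost_pitau -!EFinD -EFinM; congr EFin; field.
Qed.

(** The sequence is eventually equal to its limit: almost every x leaves the bad orbits for good,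
    and its matching round is eventually below [den n]. *)
Lemma dual_ae_cvg : {ae pi, forall z,
   (dual_phi n.+1 z.1 + dual_psi n.+1 z.2)%:E @[n --> \oo] --> h z}.
Proof.
have shift (P : nat -> Prop) : (\forall n \near \oo, P n) -> \forall n \near \oo, P n.+1.
  by move=> [N _ NP]; exists N => // n /= Nn; apply: NP => /=; exact: leqW.
have ev := @ae_eventually_good R.
apply: mean3_ae.
- apply: pi0_ae; apply: (ae_imply ev) => x /shift gx x01 /=.
  rewrite hfun_id //; apply: cvg_near_cst; apply: filterS gx => n nb.
  by rewrite dual_good // subrr addr0.
- apply: pi1_ae; apply: (ae_imply ev) => x /shift gx x01 /=.
  rewrite hfun_rotation //; apply: cvg_near_cst; apply: filterS gx => n nb.
  by rewrite dual_rotation.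
- apply: pitau_ae; apply: (ae_imply ev) => x /shift gx x01 Nx /=.
  rewrite hfun_jump //; apply: cvg_near_cst.
  have [j mj] := nonexceptional_matched x01 Nx.
  have jn : \forall n \near \oo, (j < den n.+1)%N.
    by exists j => // n /= jn; have := ltn_den n.+1; lia.
  by apply: filterS2 gx jn => n nb jn'; rewrite (dual_jump_eq x01 Nx nb mj jn').
Qed.

Lemma bounded_Borel_dual_phi n : bounded_Borel (dual_phi n : R -> R).
Proof. by split; [exact: measurable_dual_phi|exists (2 * (2 ^ n).+1%:R) => x; exact: bounded_dual_phi]. Qed.

Lemma bounded_Borel_dual_psi n : bounded_Borel (dual_psi n : R -> R).
Proof. by split; [exact: measurable_dual_psi|exists (2 ^ n)%:R => x; exact: bounded_dual_psi]. Qed.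

End primal_values.

(** * Functionals on L^oo *)

Section Loo_facts.
Context d (X : measurableType d) (R : realType).
Variable m : {measure set X -> \bar R}.
Hypothesis m1 : m setT = 1%E.
Implicit Types (f g u v : X -> R).

Let m_gt0 : (0 < m setT)%E. Proof. by rewrite m1 lte01. Qed.

Let m_lty : (m setT < +oo)%E. Proof. by rewrite m1 ltry. Qed.

Lemma Loonorm_le g (M : R) :
  (Loonorm m g <= M%:E)%E <-> {ae m, forall x, `|g x| <= M}.
Proof.
rewrite /Loonorm unlock m_gt0; split=> [/ess_supP le|le]; [|apply/ess_supP];
  by apply: (ae_imply le) => x /=; rewrite lee_fin.
Qed.

Lemma Loo_measurable g : Loo m g -> measurable_fun setT g.
Proof. by rewrite /Loo /= => /andP[]; rewrite inE. Qed.

Lemma Loo_bound g : Loo m g -> exists M, {ae m, forall x, `|g x| <= M}.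
Proof.
rewrite /Loo /= => /andP[_]; rewrite inE /= /finite_norm.
have : (0 <= 'N[m]_+oo[EFin \o g])%E by exact: Lnorm_ge0.
case E : ('N[m]_+oo[EFin \o g])%E => [M| |] // _ _.
by exists M; apply/Loonorm_le; rewrite /Loonorm E.
Qed.

Lemma LooI g (M : R) : measurable_fun setT g -> {ae m, forall x, `|g x| <= M} -> Loo m g.
Proof.
move=> mg gM; rewrite /Loo /=; apply/andP; split; first by rewrite inE.
rewrite inE /= /finite_norm; apply: (@le_lt_trans _ _ M%:E); last exact: ltry.
exact/Loonorm_le.
Qed.

Lemma LooI_bounded g (M : R) : measurable_fun setT g -> (forall x, `|g x| <= M) -> Loo m g.
Proof. by move=> mg gM; apply: (LooI mg); apply: aeW. Qed.

Lemma Loo_indic (A : set X) : measurable A -> Loo m \1_A.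
Proof.
move=> mA; apply: (@LooI_bounded _ 1) => // x.
by rewrite indicE; case: (_ \in _); rewrite ?normr1 ?normr0.
Qed.

Lemma Loo_cst (k : R) : Loo m (cst k).
Proof. by apply: (@LooI_bounded _ `|k|). Qed.

Lemma Loo_lin (k : R) u v : Loo m u -> Loo m v -> Loo m (fun x => k * u x + v x).
Proof.
move=> Lu Lv; have [M uM] := Loo_bound Lu; have [N vN] := Loo_bound Lv.
apply: (@LooI _ (`|k| * M + N)).
  apply: measurable_funD; last exact: Loo_measurable.
  by apply: measurable_funM => //; exact: Loo_measurable.
apply: (ae_imply2 uM vN) => x h1 h2.
by rewrite (le_trans (ler_normD _ _)) // lerD // normrM ler_wpM2l.
Qed.

Lemma Loo_mul u v : Loo m u -> Loo m v -> Loo m (fun x => u x * v x).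
Proof.
move=> Lu Lv; have [M uM] := Loo_bound Lu; have [N vN] := Loo_bound Lv.
apply: (@LooI _ (M * N)).
  by apply: measurable_funM; exact: Loo_measurable.
by apply: (ae_imply2 uM vN) => x h1 h2; rewrite normrM ler_pM.
Qed.

Lemma L1_measurable f : L1 m f -> measurable_fun setT f.
Proof. by rewrite /L1 /= => /andP[]; rewrite inE. Qed.

Lemma L1_int f : L1 m f -> m.-integrable setT (EFin \o f).
Proof. by move/Lfun1_integrable. Qed.

Lemma L1_mul f g : L1 m f -> Loo m g -> L1 m (fun x => f x * g x).
Proof.
move=> Lf Lg; have [M gM] := Loo_bound Lg.
apply/Lfun1_integrable; apply/integrableP; split.
  apply/measurable_EFinP; apply: measurable_funM; [exact: L1_measurable|exact: Loo_measurable].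
have /integrableP[_ fi] : m.-integrable setT (fun x => M%:E * (f x)%:E)%E.
  by apply: integrableZl => //; exact: L1_int.
apply: le_lt_trans fi; apply: ae_ge0_le_integral => //.
- apply: measurableT_comp => //; apply/measurable_EFinP; apply: measurable_funM; [exact: L1_measurable|exact: Loo_measurable].
- apply: measurableT_comp => //; apply: measurable_funeM; apply/measurable_EFinP; exact: L1_measurable.
apply: (ae_imply gM) => x gx _ /=; rewrite lee_fin mulrC !normrM ler_wpM2r //.
by rewrite (le_trans gx) // ler_norm.
Qed.

Lemma L1_Loo g : Loo m g -> L1 m g.
Proof.
move=> Lg; have L11 : L1 m (cst 1).
  by apply: (@bounded_L1 _ _ _ _ _ 1) => // x; rewrite normr1.
by have := L1_mul L11 Lg; congr L1; apply/funext => x; rewrite mul1r.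
Qed.

Lemma L1_lin (k : R) u v : L1 m u -> L1 m v -> L1 m (fun x => k * u x + v x).
Proof.
move=> Lu Lv; apply/Lfun1_integrable.
rewrite (_ : _ \o _ = (fun x => k%:E * (u x)%:E) \+ (EFin \o v))%E //.
apply: integrableD => //; last exact: L1_int.
by apply: integrableZl => //; exact: L1_int.
Qed.

Lemma Rintegral_lin (k : R) u v : L1 m u -> L1 m v ->
  \int[m]_x (k * u x + v x) = k * \int[m]_x u x + \int[m]_x v x.
Proof.
move=> Lu Lv; rewrite RintegralD //; last exact: L1_int.
  by rewrite RintegralZl //; exact: L1_int.
rewrite (_ : _ \o _ = (fun x => k%:E * (u x)%:E))%E //.
by apply: integrableZl => //; exact: L1_int.
Qed.

Lemma ae_eq_Rintegral u v : measurable_fun setT u -> measurable_fun setT v ->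
  {ae m, forall x, u x = v x} -> \int[m]_x u x = \int[m]_x v x.
Proof.
move=> mu mv uv; rewrite /Rintegral; congr fine; apply: ae_eq_integral => //.
- exact/measurable_EFinP.
- exact/measurable_EFinP.
- by apply: (ae_imply uv) => x ->.
Qed.

Lemma Rintegral_norm_le f g (M : R) : L1 m f -> measurable_fun setT g ->
  (forall x, `|g x| <= M) ->
  ((`|\int[m]_x (f x * g x)|)%:E <= M%:E * L1norm m f)%E.
Proof.
move=> Lf mg gM; have Lg := LooI_bounded mg gM.
have Lfg := L1_mul Lf Lg.
rewrite /L1norm Lnorm1 /Rintegral -fine_abse ?integrable_fin_num //; last exact: L1_int.
rewrite fineK; last by rewrite abse_fin_num integrable_fin_num //; exact: L1_int.
apply: (le_trans (le_abse_integral _ _ _)) => //.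
  by apply/measurable_EFinP; exact: L1_measurable.
have M0 : 0 <= M := le_trans (normr_ge0 _) (gM point).
have mfE : measurable_fun setT (fun x => `|(EFin \o f) x|)%E.
  by apply: measurableT_comp => //; apply/measurable_EFinP; exact: L1_measurable.
have mfgE : measurable_fun setT (fun x => `|(f x * g x)%:E|)%E.
  by apply: measurableT_comp => //; apply/measurable_EFinP; exact: L1_measurable.
rewrite -ge0_integralZl_EFin //.
apply: ge0_le_integral => //; first exact: measurable_funeM.
by move=> x _; rewrite -EFinM lee_fin normrM mulrC ler_wpM2r.
Qed.

Variable H : (X -> R) -> R.
Hypothesis bidualH : L1_bidual m H.

Lemma bidual_lin (k : R) u v : Loo m u -> Loo m v ->
  H (fun x => k * u x + v x) = k * H u + H v.
Proof. by move=> Lu Lv; have [lin _] := bidualH; rewrite -(lin k u v Lu Lv). Qed.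

End Loo_facts.

(** * Functionals on the closed span of the sums phi (+) psi *)

Section subspace_functionals.
Context d1 d2 (X : measurableType d1) (Y : measurableType d2) (R : realType).
Variables (mu : probability X R) (nu : probability Y R).
Variable pi : {measure set (X * Y) -> \bar R}.
Hypothesis coupled : couplings mu nu pi.

Let pi1 : pi setT = 1%E := coupling_setT coupled.

Lemma L1_oplus phi psi : L1 mu phi -> L1 nu psi -> L1 pi (oplus phi psi).
Proof. by move=> Lphi Lpsi; apply/Lfun1_integrable; have [] := coupling_oplus coupled Lphi Lpsi. Qed.

Lemma L1_cst0 d (Z : measurableType d) (m : {measure set Z -> \bar R}) : L1 m (cst 0).
Proof. by apply/Lfun1_integrable; exact: integrable0. Qed.

Lemma L1S_cst0 : L1S mu nu pi (cst 0).
Proof.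
split; first exact: L1_cst0.
move=> e e0; exists (cst 0), (cst 0); split; [exact: L1_cst0|exact: L1_cst0|].
rewrite /L1norm Lnorm1 integral0_eq ?lte_fin // => z _.
by rewrite /= /oplus /= addr0 subr0 normr0.
Qed.

Lemma pairing_bounded_dual (u : X * Y -> R) (M : R) : measurable_fun setT u -> (forall z, `|u z| <= M) ->
  bounded_dual (L1S mu nu pi) (L1norm pi) (fun f => \int[pi]_z (f z * u z)).
Proof.
move=> mm uM; have Lu := LooI_bounded pi1 mm uM; split.
  move=> k f g [Lf _] [Lg _].
  rewrite -(Rintegral_lin k (L1_mul pi1 Lf Lu) (L1_mul pi1 Lg Lu)).
  by apply: eq_Rintegral => z _; rewrite /= mulrDl mulrA.
by exists M => f [Lf _]; have := Rintegral_norm_le pi1 Lf mm uM; exact.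
Qed.

Lemma pairing_L1S (u w : X * Y -> R) (M : R) : measurable_fun setT u -> measurable_fun setT w ->
  (forall z, `|u z| <= M) -> (forall z, `|w z| <= M) ->
  (forall phi psi, L1 mu phi -> L1 nu psi ->
     \int[pi]_z (oplus phi psi z * u z) = \int[pi]_z (oplus phi psi z * w z)) ->
  forall f, L1S mu nu pi f -> \int[pi]_z (f z * u z) = \int[pi]_z (f z * w z).
Proof.
move=> mmu mw uM wM uw f [Lf Sf].
have Lu := LooI_bounded pi1 mmu uM; have Lw := LooI_bounded pi1 mw wM.
have M0 : 0 <= M := le_trans (normr_ge0 _) (uM point).
apply/eqP; rewrite -subr_eq0 -normr_le0; apply/ler_addgt0Pl => e e0; rewrite addr0.
(* The difference of the two weights is bounded by 2 M; the added 1 keeps the denominator positive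
   when M = 0. *)
have e1 : 0 < e / (2 * M + 1) by rewrite divr_gt0 //; lra.
have [phi [psi [Lphi Lpsi le]]] := Sf _ e1.
have Lo := L1_oplus Lphi Lpsi.
have Lr : L1 pi (fun z => f z - oplus phi psi z).
  by have := L1_lin (-1) Lo Lf; congr L1; apply/funext => z; rewrite mulN1r addrC.
have E : \int[pi]_z (f z * u z) - \int[pi]_z (f z * w z) =
    \int[pi]_z ((f z - oplus phi psi z) * (u z - w z)).
  have -> : \int[pi]_z ((f z - oplus phi psi z) * (u z - w z)) =
     \int[pi]_z (-1 * ((f z - oplus phi psi z) * w z) + (f z - oplus phi psi z) * u z).
    by apply: eq_Rintegral => z _; ring.
  rewrite Rintegral_lin; [|exact: L1_mul|exact: L1_mul].
  have F v : Loo pi v -> \int[pi]_z ((f z - oplus phi psi z) * v z) =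
      \int[pi]_z (f z * v z) - \int[pi]_z (oplus phi psi z * v z).
    move=> Lv; have := Rintegral_lin (-1) (L1_mul pi1 Lo Lv) (L1_mul pi1 Lf Lv).
    rewrite mulN1r addrC => <-; apply: eq_Rintegral => z _; ring.
  rewrite !F // uw //; ring.
have mM z : `|u z - w z| <= 2 * M.
  by have := ler_normB (u z) (w z); have := uM z; have := wM z; lra.
rewrite E -lee_fin; apply: (le_trans (Rintegral_norm_le pi1 Lr _ mM)).
  exact: measurable_funB.
apply: (@le_trans _ _ ((2 * M)%:E * (e / (2 * M + 1))%:E)%E).
  by rewrite lee_wpmul2l ?lee_fin ?mulr_ge0 // ltW.
rewrite -EFinM lee_fin mulrA ler_pdivrMr; last by lra.
by nra.
Qed.

(** The pairings with u and w agree on the subspace but may differ as functions outside it, so G is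
    not compared on equal arguments. Their difference has dual norm 0, and boundedness of G makes G
    vanish there. *)
Lemma subspace_bidual_eq H (u w : X * Y -> R) (M : R) :
  subspace_bidual pi (L1S mu nu pi) H ->
  measurable_fun setT u -> measurable_fun setT w ->
  (forall z, `|u z| <= M) -> (forall z, `|w z| <= M) ->
  (forall phi psi, L1 mu phi -> L1 nu psi ->
     \int[pi]_z (oplus phi psi z * u z) = \int[pi]_z (oplus phi psi z * w z)) ->
  H u = H w.
Proof.
move=> [G [linG [C bG]] HG] mmu mw uM wM uw.
rewrite !HG; [|exact: LooI_bounded wM|exact: LooI_bounded uM].
pose Fu (f : X * Y -> R) : R := \int[pi]_z (f z * u z).
pose Fw (f : X * Y -> R) : R := \int[pi]_z (f z * w z).
have dFu : bounded_dual (L1S mu nu pi) (L1norm pi) Fu := pairing_bounded_dual mmu uM.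
have dFw : bounded_dual (L1S mu nu pi) (L1norm pi) Fw := pairing_bounded_dual mw wM.
have D0 f : L1S mu nu pi f -> ((-1) *: Fw + Fu) f = 0.
  move=> Sf; rewrite -[LHS]/(-1 * Fw f + Fu f) mulN1r /Fu /Fw (pairing_L1S mmu mw uM wM uw Sf).
  by rewrite addNr.
have dD : bounded_dual (L1S mu nu pi) (L1norm pi) ((-1) *: Fw + Fu).
  split; last first.
    by exists 0 => f Sf; rewrite D0 // normr0 mul0e.
  have DE f : ((-1) *: Fw + Fu) f = -1 * Fw f + Fu f by [].
  have [[lu _] [lw _]] := (dFu, dFw).
  by move=> k f g Sf Sg; rewrite !DE lu // lw //; ring.
have N0 : dual_norm (L1S mu nu pi) (L1norm pi) ((-1) *: Fw + Fu) = 0%E.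
  apply/eqP; rewrite eq_le; apply/andP; split.
    by apply: ge_ereal_sup => _ [f [Sf _] <-]; rewrite D0 // normr0.
  apply: ereal_sup_ubound; exists (cst 0); last by rewrite D0 ?normr0 //; exact: L1S_cst0.
  split; first exact: L1S_cst0.
  rewrite /L1norm Lnorm1 integral0_eq ?lee01 // => z _.
  by rewrite /= normr0.
have := bG _ dD; rewrite N0 mule0 lee_fin normr_le0 linG // => /eqP.
by rewrite mulN1r addrC => /eqP; rewrite subr_eq0 => /eqP.
Qed.

End subspace_functionals.

(** * Functionals on L^oo dominated by a density *)

Section dominated_functionals.
Context d (X : measurableType d) (R : realType).
Variable m : {measure set X -> \bar R}.
Hypothesis m1 : m setT = 1%E.
Variables (H : (X -> R) -> R) (hr : X -> R).
Hypotheses (bidualH : L1_bidual m H) (Lhr : Loo m hr).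
Hypothesis leH : L1_bidual_le m H (L1_embed m hr).

Definition defect g := H g - L1_embed m hr g.

Let L1hr : L1 m hr := L1_Loo m1 Lhr.

Lemma defect_lin (k : R) u v : Loo m u -> Loo m v ->
  defect (fun x => k * u x + v x) = k * defect u + defect v.
Proof.
move=> Lu Lv; rewrite /defect (bidual_lin bidualH) // /L1_embed.
have := Rintegral_lin k (L1_mul m1 L1hr Lu) (L1_mul m1 L1hr Lv).
rewrite (_ : \int[m]_x (k * (hr x * u x) + hr x * v x) = \int[m]_x (hr x * (k * u x + v x))).
  by move=> ->; ring.
by apply: eq_Rintegral => x _; ring.
Qed.

Lemma defect_le0 g : Loo m g -> {ae m, forall x, 0 <= g x} -> defect g <= 0.
Proof. by move=> Lg g0; rewrite subr_le0; exact: leH. Qed.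

(** The defect is nonpositive on nonnegative functions, and both M v + u and M v - u are
    nonnegative. In particular, where the defect of v vanishes it vanishes on everything that v
    dominates. *)
Lemma defect_dominated u v (M : R) : Loo m u -> Loo m v ->
  {ae m, forall x, `|u x| <= M * v x} -> `|defect u| <= - (M * defect v).
Proof.
move=> Lu Lv uv.
have h1 : defect (fun x => M * v x + u x) <= 0.
  apply: defect_le0; first exact: Loo_lin.
  by apply: (ae_imply uv) => x; rewrite ler_norml => /andP[]; lra.
have LMv : Loo m (fun x => M * v x + 0) by apply: Loo_lin => //; exact: Loo_cst.
have h2 : defect (fun x => -1 * u x + (M * v x + 0)) <= 0.
  apply: defect_le0; first exact: Loo_lin.
  by apply: (ae_imply uv) => x; rewrite ler_norml => /andP[]; lra.
have L0 : Loo m (fun=> 0 : R) by exact: Loo_cst.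
have d0 : defect (fun=> 0) = 0.
  have := defect_lin 1 L0 L0; rewrite (_ : (fun x => 1 * 0 + 0) = (fun=> 0 : R)).
    by lra.
  by apply/funext => x; rewrite mulr0 addr0.
move: h1 h2; rewrite !defect_lin // d0 ler_norml; lra.
Qed.

Lemma defect_eq0 u v (M : R) : Loo m u -> Loo m v -> defect v = 0 ->
  {ae m, forall x, `|u x| <= M * v x} -> defect u = 0.
Proof.
move=> Lu Lv v0 uv; have := defect_dominated Lu Lv uv.
by rewrite v0 mulr0 oppr0 normr_le0 => /eqP.
Qed.

Variables (Hs : (X -> R) -> R) (r : X -> R) (A : nat -> set X).
Hypotheses (Lr : L1 m r) (singular : purely_singular m Hs).
Hypothesis HE : forall g, Loo m g -> H g = L1_embed m r g + Hs g.
Hypotheses (mA : forall i, measurable (A i)) (A0 : forall i, defect \1_(A i) = 0).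
Hypothesis Acover : {ae m, forall x, exists i, A i x}.

Let L1diff : L1 m (fun x => hr x - r x).
Proof.
by have := L1_lin (-1) Lr L1hr; congr L1; apply/funext => x; rewrite mulN1r addrC.
Qed.

Let Hs_defect g : Loo m g -> Hs g = defect g + \int[m]_x ((hr x - r x) * g x).
Proof.
move=> Lg; have E := HE Lg.
rewrite (_ : \int[m]_x ((hr x - r x) * g x) = L1_embed m hr g - L1_embed m r g).
  by rewrite /defect E; ring.
have := Rintegral_lin (-1) (L1_mul m1 Lr Lg) (L1_mul m1 L1hr Lg).
rewrite /L1_embed => i.
transitivity (\int[m]_x (-1 * (r x * g x) + hr x * g x)); last by rewrite i; ring.
by apply: eq_Rintegral => x _; ring.
Qed.

(* On A i the functional Hs has the density hr - r, hence |Hs| dominates the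
   measure with density |hr - r| there. *)
Lemma regular_part : {ae m, forall x, r x = hr x}.
Proof.
have mD := L1_measurable L1diff.
suff h i : {ae m, forall x, `|hr x - r x| * \1_(A i) x = 0}.
  apply: (ae_imply2 (ae_foralln h) Acover) => x hx [i Ai].
  have := hx i; rewrite indicE mem_set // mulr1 => /eqP.
  by rewrite normr_eq0 subr_eq0 => /eqP.
have LA := Loo_indic m1 (mA i).
have Labs : L1 m (fun x => `|hr x - r x|) by exact: Lfun_norm L1diff.
have [_ sing] := singular; apply: sing.
- exact: L1_mul.
- by apply: aeW => x; rewrite mulr_ge0 // indicE.
move=> g Lg g0.
(* With this sign, k = 1_A s g is admissible in the supremum defining the variation at g. Its defect
   vanishes, since it is dominated by a multiple of 1_A, so [Hs k] is the integral of |hr - r| g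
   over A. *)
pose s x : R := if 0 <= hr x - r x then 1 else -1.
have ms : measurable_fun setT s.
  apply: measurable_fun_ifT => //.
  by apply: measurable_fun_ler.
have Ls : Loo m s.
  by apply: (LooI_bounded m1 (M := 1) ms) => x; rewrite /s; case: ifP => _; rewrite ?normrN normr1.
have Lsg : Loo m (fun x => s x * g x) by exact: Loo_mul.
pose k x := \1_(A i) x * (s x * g x).
have Lk : Loo m k by exact: Loo_mul.
have [N gN] := Loo_bound m1 Lg.
have dk : defect k = 0.
  apply: (@defect_eq0 k \1_(A i) N) => //.
  apply: (ae_imply gN) => x gx; rewrite /k !normrM indicE.
  have -> : `|s x| = 1 by rewrite /s; case: ifP => _; rewrite ?normrN normr1.
  by case: (_ \in _); rewrite /= ?normr1 ?normr0 ?mul1r ?mulr1 ?mul0r ?mulr0.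
have -> : L1_embed m (fun x => `|hr x - r x| * \1_(A i) x) g = Hs k.
  rewrite Hs_defect // dk add0r; apply: eq_Rintegral => x _; rewrite /k /s.
  by case: ifPn => [h|]; [rewrite ger0_norm //|rewrite -ltNge => h; rewrite ltr0_norm //]; ring.
apply: ereal_sup_ubound; exists k => //; split => //.
apply: (ae_imply g0) => x gx; rewrite /k !normrM indicE (ger0_norm gx).
have -> : `|s x| = 1 by rewrite /s; case: ifP => _; rewrite ?normrN normr1.
by case: (_ \in _); rewrite /= ?normr1 ?normr0 ?mul1r ?mul0r.
Qed.

Lemma singular_part g : Loo m g -> Hs g = defect g.
Proof.
move=> Lg; rewrite Hs_defect // (_ : \int[m]_x _ = 0) ?addr0 //.
rewrite (@ae_eq_Rintegral _ _ _ m _ (cst 0)).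
- by rewrite /Rintegral integral0.
- by apply: measurable_funM; [exact: L1_measurable L1diff|exact: Loo_measurable Lg].
- exact: measurable_cst.
- by apply: (ae_imply regular_part) => x ->; rewrite subrr mul0r.
Qed.

(** [Hs] is the defect, a nonpositive functional, so its norm is attained at the constant 1. *)
Lemma singular_norm : L1_bidual_norm m Hs = (- defect (cst 1))%:E.
Proof.
have L1c := Loo_cst m1 (1 : R).
have d0 : defect (cst 1) <= 0 by apply: defect_le0 => //; exact: aeW.
apply/eqP; rewrite eq_le; apply/andP; split.
  apply: ge_ereal_sup => _ [u [Lu /(Loonorm_le m1) u1] <-].
  rewrite lee_fin singular_part //.
  have := @defect_dominated u (cst 1) 1 Lu L1c; rewrite mul1r; apply.
  by apply: (ae_imply u1) => x; rewrite mul1r.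
apply: ereal_sup_ubound; exists (cst 1).
  by split => //; apply/(Loonorm_le m1); apply: aeW => x; rewrite normr1.
by rewrite singular_part // ler0_norm.
Qed.

End dominated_functionals.

(** * Integrals of signed functions against the plans *)

Section signed_integrals.
Context (R : realType).
Local Notation RR := (measurableTypeR R).
Local Notation mu := (unif01 R).
Local Notation a := (alpha R).

Lemma fine_integral_posneg d (X : measurableType d) (m : {measure set X -> \bar R}) (F : X -> R) :
  L1 m F -> [/\ (\int[m]_x ((EFin \o F)^\+ x) \is a fin_num)%E,
    (\int[m]_x ((EFin \o F)^\- x) \is a fin_num)%E &
   \int[m]_x F x = fine (\int[m]_x ((EFin \o F)^\+ x))%E - fine (\int[m]_x ((EFin \o F)^\- x))%E].
Proof.
move=> LF; have i := L1_int LF.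
have ip : (\int[m]_x ((EFin \o F)^\+ x) \is a fin_num)%E.
  by apply: integrable_fin_num => //; exact: integrable_funepos.
have im : (\int[m]_x ((EFin \o F)^\- x) \is a fin_num)%E.
  by apply: integrable_fin_num => //; exact: integrable_funeneg.
by split => //; rewrite /Rintegral integralE fineB.
Qed.

Lemma mean3_L1 (p0 p1 p2 : {measure set (RR * RR) -> \bar R}) (F : RR * RR -> R) :
  L1 (mean3 p0 p1 p2) F -> [/\ L1 p0 F, L1 p1 F & L1 p2 F].
Proof.
move=> LF; have mF := L1_measurable LF.
have mA : measurable_fun setT (fun z => `|(EFin \o F) z|)%E.
  by apply: measurableT_comp => //; exact/measurable_EFinP.
have := L1_int LF => /integrableP[_]; rewrite mean3_integral //.
set s0 := (\int[p0]_z _)%E; set s1 := (\int[p1]_z _)%E; set s2 := (\int[p2]_z _)%E => h.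
have S : (s0 + s1 + s2 < +oo)%E.
  have -> : (s0 + s1 + s2 = 3%:E * ((3^-1)%:E * (s0 + s1 + s2)))%E.
    by rewrite muleA -EFinM divff // mul1e.
  by apply: lte_mul_pinfty => //; rewrite lee_fin.
have g0 : (0 <= s0)%E by exact: integral_ge0.
have g1 : (0 <= s1)%E by exact: integral_ge0.
have g2 : (0 <= s2)%E by exact: integral_ge0.
split; apply/Lfun1_integrable; apply/integrableP; split; try exact/measurable_EFinP.
- by apply: le_lt_trans S; rewrite -addeA leeDl // adde_ge0.
- by apply: le_lt_trans S; rewrite addeAC leeDr // adde_ge0.
- by apply: le_lt_trans S; rewrite leeDr // adde_ge0.
Qed.

Lemma mean3_Rintegral (p0 p1 p2 : {measure set (RR * RR) -> \bar R}) (F : RR * RR -> R) :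
  L1 (mean3 p0 p1 p2) F ->
  \int[mean3 p0 p1 p2]_z F z = 3^-1 * (\int[p0]_z F z + \int[p1]_z F z + \int[p2]_z F z).
Proof.
move=> LF; have [L0 L1 L2] := mean3_L1 LF.
have mF : measurable_fun setT (EFin \o F) by apply/measurable_EFinP; exact: L1_measurable LF.
have [_ _ ->] := fine_integral_posneg LF.
have [f0p f0m ->] := fine_integral_posneg L0.
have [f1p f1m ->] := fine_integral_posneg L1.
have [f2p f2m ->] := fine_integral_posneg L2.
rewrite !mean3_integral //; [|exact: measurable_funeneg|exact: measurable_funepos].
have e (x y z : \bar R) : x \is a fin_num -> y \is a fin_num -> z \is a fin_num ->
    fine ((3^-1)%:E * (x + y + z))%E = 3^-1 * (fine x + fine y + fine z).
  by move: x y z => [x| |] [y| |] [z| |].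
by rewrite !e //; ring.
Qed.

Lemma graph_plan_L1 (T : RR -> RR) (mT : measurable_fun (@I01 R) T) (mTT : measurable_fun setT T)
  (F : RR * RR -> R) : measurable_fun setT F ->
  (L1 (graph_plan mT) F <-> L1 mu (fun x => F (x, T x))).
Proof.
move=> mF; have mg := measurable_graph_map mTT.
have mA : measurable_fun setT (fun z => `|(EFin \o F) z|)%E.
  by apply: measurableT_comp => //; exact/measurable_EFinP.
have E := graph_plan_integral mT mTT mA (fun z => abse_ge0 _).
split=> L; apply/Lfun1_integrable; apply/integrableP; split.
- by apply/measurable_EFinP; exact: measurableT_comp mF mg.
- by have /integrableP[_] := L1_int L; rewrite E.
- exact/measurable_EFinP.
- by rewrite E; have /integrableP[_] := L1_int L.
Qed.

Lemma graph_plan_Rintegral (T : RR -> RR) (mT : measurable_fun (@I01 R) T) (mTT : measurable_fun setT T)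
  (F : RR * RR -> R) : measurable_fun setT F -> L1 mu (fun x => F (x, T x)) ->
  \int[graph_plan mT]_z F z = \int[mu]_x F (x, T x).
Proof.
move=> mF L; have Lg := (graph_plan_L1 mT mTT mF).2 L.
have mFE : measurable_fun setT (EFin \o F) by exact/measurable_EFinP.
have [_ _ ->] := fine_integral_posneg Lg; have [_ _ ->] := fine_integral_posneg L.
rewrite (graph_plan_integral mT mTT (measurable_funepos mFE) (fun z => funepos_ge0 _ _)).
rewrite (graph_plan_integral mT mTT (measurable_funeneg mFE) (fun z => funeneg_ge0 _ _)).
by congr (fine _ - fine _); apply: eq_integral => x _; rewrite ?funeposE ?funenegE.
Qed.

Lemma rotation_L1 k (F : R -> R) : L1 mu F ->
  L1 mu (fun x => F (rotation a k x)) /\ \int[mu]_x F (rotation a k x) = \int[mu]_x F x.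
Proof.
move=> LF; have mF := L1_measurable LF; have mr := measurable_rotation a k.
have E (f : RR -> \bar R) : measurable_fun setT f -> (forall x, (0 <= f x)%E) ->
    (\int[mu]_x f (rotation a k x) = \int[mu]_x f x)%E.
  move=> mf f0; transitivity (\int[pushforward mu (rotation a k : RR -> RR)]_x f x)%E.
    by rewrite (ge0_integral_pushforward mr) // preimage_setT.
  by apply: eq_measure_integral => A mA _; exact: unif01_rotation.
have mFE : measurable_fun setT (EFin \o F) by exact/measurable_EFinP.
have mA : measurable_fun setT (fun z => `|(EFin \o F) z|)%E by exact: measurableT_comp.
have LFr : L1 mu (fun x => F (rotation a k x)).
  apply/Lfun1_integrable; apply/integrableP; split.
    by apply/measurable_EFinP; exact: measurableT_comp mF mr.
  have /integrableP[_] := L1_int LF.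
  by rewrite -(E _ mA (fun x => abse_ge0 _)).
split => //.
have [_ _ ->] := fine_integral_posneg LF; have [_ _ ->] := fine_integral_posneg LFr.
rewrite -(E _ (measurable_funepos mFE) (fun x => funepos_ge0 _ _)).
rewrite -(E _ (measurable_funeneg mFE) (fun x => funeneg_ge0 _ _)).
by congr (fine _ - fine _); apply: eq_integral => x _; rewrite ?funeposE ?funenegE.
Qed.

Lemma ae_itv : {ae mu, forall x : R, 0 <= x < 1}.
Proof.
exists (~` @I01 R); split.
- by apply: measurableC; exact: measurable_I01.
- by change (mu (~` @I01 R) = 0%E); rewrite unif01E setICl measure0.
- by move=> x nx x01; apply: nx; rewrite I01E in x01.
Qed.

End signed_integrals.

(** * Dual optimizers *)

Section test_functions.
Context (R : realType).
Local Notation RR := (measurableTypeR R).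
Local Notation mu := (unif01 R).
Local Notation a := (alpha R).
Local Notation tau := (@jump R).
Local Notation T := (rotation_tau a tau).
Variables (bij0 : mp_bijection (id : R -> R)) (bij1 : mp_bijection (rotation a 1))
          (bijtau : mp_bijection T).
Local Notation pi0 := (graph_plan (mpb_measurable bij0)).
Local Notation pi1 := (graph_plan (mpb_measurable bij1)).
Local Notation pitau := (graph_plan (mpb_measurable bijtau)).
Local Notation h := (hfun a).
Local Notation c := (cost a tau).
Local Notation pi := (mean3 pi0 pi1 pitau).
Local Notation G0 := (graph01 (id : R -> R)).
Local Notation G1 := (graph01 (rotation a 1)).
Local Notation Gtau := (graph01 T).

Lemma couplings_pi : couplings mu mu pi.
Proof.
have [c0 c0'] := couplings_graph_plan bij0.
have [c1 c1'] := couplings_graph_plan bij1.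
have [c2 c2'] := couplings_graph_plan bijtau.
have e (x : \bar R) : x \is a fin_num -> ((3^-1)%:E * (x + x + x) = x)%E.
  by case: x => [x| |] // _; rewrite -!EFinD -EFinM; congr EFin; field.
split=> A mA; rewrite mean3E.
- have -> : (pi0 (A `*` setT) + pi1 (A `*` setT) + pitau (A `*` setT) = mu A + mu A + mu A)%E.
    by congr (_ + _ + _)%E; [exact: c0|exact: c1|exact: c2].
  by rewrite e //; exact: fin_num_measure.
- have -> : (pi0 (setT `*` A) + pi1 (setT `*` A) + pitau (setT `*` A) = mu A + mu A + mu A)%E.
    by congr (_ + _ + _)%E; [exact: c0'|exact: c1'|exact: c2'].
  by rewrite e //; exact: fin_num_measure.
Qed.

Lemma pi_setT : pi setT = 1%E.
Proof. exact: coupling_setT couplings_pi. Qed.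

Definition on_graph (G : set (RR * RR)) (B : set RR) : RR * RR -> R :=
  \1_(G `&` fst @^-1` B).

Lemma on_graphE G B z : on_graph G B z = \1_G z * \1_B z.1.
Proof. by rewrite /on_graph !indicE in_setI -natrM mulnb. Qed.

Lemma measurable_on_graph G B : measurable G -> measurable B ->
  measurable_fun setT (on_graph G B).
Proof.
move=> mG mB; apply: measurable_indic; apply: measurableI => //.
by rewrite -[X in measurable X]setTI; exact: measurable_fst.
Qed.

Lemma on_graph_norm G B z : `|on_graph G B z| <= 1.
Proof. by rewrite /on_graph indicE; case: (_ \in _); rewrite ?normr1 ?normr0. Qed.

Lemma on_graph_le G B z : `|on_graph G B z| <= \1_G z.
Proof.
rewrite on_graphE normrM !indicE.
by case: (_ \in _); case: (_ \in _); rewrite /= ?normr1 ?normr0 ?mul1r ?mulr0 ?mul0r.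
Qed.

Lemma rotation1_neq (x : R) : 0 <= x < 1 -> rotation a 1 x <> x.
Proof.
move=> x01; rewrite -{2}(rotation0 a x01) => /(rotation_inj (@irrational_alpha R)).
by [].
Qed.

Lemma jump_neq0 (x : R) : 0 <= x < 1 -> ~ exceptional x -> T x <> x.
Proof.
move=> x01 Nx; have [[//]|[j [_ _]]] := jump_cases x01; rewrite /rotation_tau => ->.
by rewrite -{2}(rotation0 a x01) => /(rotation_inj (@irrational_alpha R)).
Qed.

Lemma jump_neq1 (x : R) : 0 <= x < 1 -> ~ exceptional x -> T x <> rotation a 1 x.
Proof.
move=> x01 Nx; have [[//]|[j [_ _]]] := jump_cases x01; rewrite /rotation_tau => ->.
by move=> /(rotation_inj (@irrational_alpha R)).
Qed.

Lemma Rintegral_ae0 d (X : measurableType d) (m : {measure set X -> \bar R}) (F : X -> R) :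
  L1 m F -> {ae m, forall x, F x = 0} -> \int[m]_x F x = 0.
Proof.
move=> LF F0; rewrite (ae_eq_Rintegral (L1_measurable LF) (measurable_cst (0 : R)) F0).
by rewrite /Rintegral integral0.
Qed.

Lemma graph_plan_Rintegral_ae (S : RR -> RR) (mS : measurable_fun (@I01 R) S)
    (F : RR * RR -> R) (g : R -> R) : measurable_fun setT S ->
  L1 (graph_plan mS) F -> measurable_fun [set: RR] g ->
  {ae mu, forall x : R, 0 <= x < 1 -> F (x, S x) = g x} ->
  \int[graph_plan mS]_z F z = \int[mu]_x g x.
Proof.
move=> mST LF mg Fg; have mF := L1_measurable LF.
have L := (graph_plan_L1 mS mST mF).1 LF.
rewrite (graph_plan_Rintegral mS mST mF L); apply: ae_eq_Rintegral => //.
  exact: L1_measurable L.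
by apply: (ae_imply2 Fg (ae_itv R)) => x; apply.
Qed.

Lemma measurable_indic_mul (g : R -> R) (B : set RR) : measurable_fun [set: RR] g ->
  measurable B -> measurable_fun [set: RR] (fun x : RR => g x * \1_B x).
Proof. by move=> mg mB; apply: measurable_funM => //; exact: measurable_indic. Qed.

Lemma L1_on_graph (f : RR * RR -> R) G B : L1 pi f -> measurable G -> measurable B ->
  L1 pi (fun z => f z * on_graph G B z).
Proof.
move=> Lf mG mB; have mo := measurable_on_graph mG mB.
have h1 := LooI_bounded pi_setT mo (on_graph_norm G B). have h2 := L1_mul pi_setT Lf h1. exact: h2.
Qed.

Lemma on_graph_out (f : RR * RR -> R) G B z : ~ G z -> f z * on_graph G B z = 0.
Proof. by move=> Gz; rewrite on_graphE indicE memNset // mul0r mulr0. Qed.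

Lemma on_graph_in (f : RR * RR -> R) G B z : G z -> f z * on_graph G B z = f z * \1_B z.1.
Proof. by move=> Gz; rewrite on_graphE indicE mem_set // mul1r. Qed.

(** As alpha is irrational, the three graphs are disjoint up to a null set; only [pi0] charges the
    diagonal, and its weight in [pi] is a third. *)
Lemma pairing_G0 (f : RR * RR -> R) (B : set RR) : L1 pi f ->
  measurable_fun [set: RR] (fun x : RR => f (x, x)) -> measurable B ->
  \int[pi]_z (f z * on_graph G0 B z) = 3^-1 * \int[mu]_x (f (x, x) * \1_B x).
Proof.
move=> Lf mf mB; have LF := L1_on_graph Lf (@measurable_id_graph R) mB.
have [L0 L1 L2] := mean3_L1 LF.
rewrite (mean3_Rintegral LF) (Rintegral_ae0 L1) ?(Rintegral_ae0 L2) ?addr0.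
- congr (_ * _); apply: graph_plan_Rintegral_ae => //; first exact: measurable_indic_mul.
  by apply: aeW => x x01; rewrite on_graph_in.
- apply: pitau_ae; apply: aeW => x x01 Nx; rewrite on_graph_out // => -[_ /= e].
  exact: jump_neq0 x01 Nx e.
- apply: pi1_ae; apply: aeW => x x01; rewrite on_graph_out // => -[_ /= e].
  exact: rotation1_neq x01 e.
Qed.

Lemma pairing_G1 (f : RR * RR -> R) (B : set RR) : L1 pi f ->
  measurable_fun [set: RR] (fun x : RR => f (x, rotation a 1 x)) -> measurable B ->
  \int[pi]_z (f z * on_graph G1 B z) = 3^-1 * \int[mu]_x (f (x, rotation a 1 x) * \1_B x).
Proof.
move=> Lf mf mB; have LF := L1_on_graph Lf (@measurable_rotation_graph R 1) mB.
have [L0 L1 L2] := mean3_L1 LF.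
rewrite (mean3_Rintegral LF) (Rintegral_ae0 L0) ?(Rintegral_ae0 L2) ?addr0 ?add0r.
- congr (_ * _); apply: graph_plan_Rintegral_ae => //.
  + exact: measurable_rotation.
  + exact: measurable_indic_mul.
  by apply: aeW => x x01; rewrite on_graph_in.
- apply: pitau_ae; apply: aeW => x x01 Nx; rewrite on_graph_out // => -[_ /= e].
  exact: jump_neq1 x01 Nx e.
- apply: pi0_ae; apply: aeW => x x01; rewrite on_graph_out // => -[_ /= e].
  exact: rotation1_neq x01 (esym e).
Qed.

Lemma pairing_Gtau (f : RR * RR -> R) j : L1 pi f ->
  measurable_fun [set: RR] (fun x : RR => f (x, rotation a j.+2 x)) ->
  \int[pi]_z (f z * on_graph Gtau (@jump_piece R j) z) =
    3^-1 * \int[mu]_x (f (x, rotation a j.+2 x) * \1_(@jump_piece R j) x).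
Proof.
move=> Lf mf; have mB := @measurable_jump_piece R j.
have LF := L1_on_graph Lf (@measurable_jump_graph R) mB.
have [L0 L1 L2] := mean3_L1 LF.
have out x y : 0 <= x < 1 -> y <> T x ->
    f (x, y) * on_graph Gtau (jump_piece j) (x, y) = 0.
  by move=> x01 yT; rewrite on_graph_out // => -[_ /= e].
rewrite (mean3_Rintegral LF) (Rintegral_ae0 L0) ?(Rintegral_ae0 L1) ?addr0 ?add0r.
- congr (_ * _); apply: graph_plan_Rintegral_ae => //.
  + exact: measurable_jumpT.
  + exact: measurable_indic_mul.
  apply: aeW => x x01; rewrite on_graph_in //= indicE.
  have [xj|xj] := pselect (jump_piece j x); last by rewrite memNset // !mulr0.
  by have [_ ->] := jump_imageP xj.
- apply: pi1_ae; apply: (ae_imply (@ae_nonexceptional R)) => x Nx x01.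
  by apply: out => // /esym; exact: jump_neq1.
- apply: pi0_ae; apply: (ae_imply (@ae_nonexceptional R)) => x Nx x01.
  by apply: out => // /esym; exact: jump_neq0.
Qed.

(* What h and the functions phi(x) + psi(y) have in common: the values on the graphs
   of all positive rotations are determined by those on Gamma_0 and Gamma_1. *)
Definition orbit_additive (f : RR * RR -> R) : Prop :=
  [/\ L1 pi f, forall k : nat, L1 mu (fun x => f (x, rotation a k x)) &
   forall (k : nat) (x : R), 0 <= x < 1 -> f (x, rotation a k.+1 x) =
     f (x, rotation a k x) + f (rotation a k x, rotation a k.+1 x)
       - f (rotation a k x, rotation a k x)].

Lemma L1_graphs (f : RR * RR -> R) : L1 pi f ->
  L1 mu (fun x : RR => f (x, x)) /\ L1 mu (fun x : RR => f (x, rotation a 1 x)).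
Proof.
move=> Lf; have [L0 L1 _] := mean3_L1 Lf; have mf := L1_measurable Lf; split.
  exact: (graph_plan_L1 (mpb_measurable bij0) (@measurable_idT R) mf).1 L0.
exact: (graph_plan_L1 (mpb_measurable bij1) (measurable_rotation a 1) mf).1 L1.
Qed.

Lemma L1_indic_mul (g : R -> R) (B : set RR) : L1 mu g -> measurable B ->
  L1 mu (fun x => g x * \1_B x).
Proof.
move=> Lg mB; have h1 := Loo_indic (unif01_setT R) mB.
have h2 := L1_mul (unif01_setT R) Lg h1; exact: h2.
Qed.

(* The telescoping weight, built from indicators of Gamma_1 minus indicators of
   Gamma_0 along the orbit. *)
Lemma transport_weight (k : nat) (B : set RR) : measurable B ->
  exists (w : RR * RR -> R) (M : R), [/\ measurable_fun setT w,
    forall z, `|w z| <= M, forall z, `|w z| <= M * (\1_G0 z + \1_G1 z) &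
    forall f, orbit_additive f -> \int[pi]_z (f z * w z) =
      3^-1 * \int[mu]_x (f (x, rotation a k x) * \1_B x)].
Proof.
move=> mB; have mG0 := @measurable_id_graph R; have mG1 := @measurable_rotation_graph R 1.
have i0 (G : set (RR * RR)) z : 0 <= \1_G z :> R by rewrite indicE.
elim: k => [|k [w [M [mw wM wG fw]]]].
  exists (on_graph G0 B), 1; split.
  - exact: measurable_on_graph.
  - exact: on_graph_norm.
  - by move=> z; rewrite mul1r (le_trans (on_graph_le _ _ _)) // lerDl.
  move=> f [Lf _ _]; have [Lf0 _] := L1_graphs Lf.
  rewrite pairing_G0 //; last exact: L1_measurable Lf0.
  congr (_ * _); apply: ae_eq_Rintegral.
  - apply: measurable_indic_mul => //; exact: L1_measurable Lf0.
  - apply: measurable_indic_mul => //.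
    apply: measurableT_comp (L1_measurable Lf) _.
    by apply: measurable_graph_map; exact: measurable_rotation.
  - by apply: (ae_imply (ae_itv R)) => x x01; rewrite rotation0.
(* B moved k steps along the orbit. Over it, the indicator on Gamma_1 adds f(y, y + alpha) and the
   one on Gamma_0 subtracts f(y, y), which is the increment of f(x, x + k alpha) from k to k + 1.
   Each of the two indicators is bounded by 1, whence the bound M + 2. *)
pose B' : set RR := rotation a (- k%:Z) @^-1` B.
have mB' : measurable B' by exact: measurable_rotation_preimage.
have mo0 := measurable_on_graph mG0 mB'; have mo1 := measurable_on_graph mG1 mB'.
exists (fun z => w z + on_graph G1 B' z - on_graph G0 B' z), (M + 2); split.
- by apply: measurable_funB => //; exact: measurable_funD.
- move=> z; have := wM z; have := on_graph_norm G0 B' z; have := on_graph_norm G1 B' z.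
  by rewrite !ler_norml; lra.
- move=> z; have := wG z; have := on_graph_le G0 B' z; have := on_graph_le G1 B' z.
  have := i0 G0 z; have := i0 G1 z.
  by rewrite !ler_norml; lra.
move=> f oa; have [Lf Lk add] := oa; have [Lf0 Lf1] := L1_graphs Lf.
have Lw := L1_mul pi_setT Lf (LooI_bounded pi_setT mw wM).
have L1o := L1_on_graph Lf mG1 mB'; have L0o := L1_on_graph Lf mG0 mB'.
have L10 := L1_lin (-1) L0o L1o.
transitivity (\int[pi]_z (1 * (f z * w z) + (-1 * (f z * on_graph G0 B' z) + f z * on_graph G1 B' z))).
  by apply: eq_Rintegral => z _; ring.
rewrite (Rintegral_lin 1 Lw L10) (Rintegral_lin (-1) L0o L1o) fw //.
rewrite pairing_G0 ?pairing_G1 //; [|exact: L1_measurable Lf1|exact: L1_measurable Lf0].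
have LF0 := L1_indic_mul Lf0 mB'; have LF1 := L1_indic_mul Lf1 mB'.
have [LR0 <-] := rotation_L1 k LF0; have [LR1 <-] := rotation_L1 k LF1.
have LB := L1_indic_mul (Lk k) mB.
rewrite (_ : 1 * (3^-1 * \int[mu]_x (f (x, rotation a k x) * \1_B x)) +
  (-1 * (3^-1 * \int[mu]_x (f (rotation a k x, rotation a k x) * \1_B' (rotation a k x))) +
  3^-1 * \int[mu]_x (f (rotation a k x, rotation a 1 (rotation a k x)) * \1_B' (rotation a k x))) =
  3^-1 * (1 * \int[mu]_x (f (x, rotation a k x) * \1_B x) +
  (-1 * \int[mu]_x (f (rotation a k x, rotation a k x) * \1_B' (rotation a k x)) +
   \int[mu]_x (f (rotation a k x, rotation a 1 (rotation a k x)) * \1_B' (rotation a k x))))); last by ring.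
rewrite -(Rintegral_lin (-1) LR0 LR1) -(Rintegral_lin 1 LB (L1_lin (-1) LR0 LR1)).
congr (_ * _); apply: ae_eq_Rintegral.
- exact: L1_measurable (L1_lin 1 LB (L1_lin (-1) LR0 LR1)).
- exact: L1_measurable (L1_indic_mul (Lk k.+1) mB).
apply: (ae_imply (ae_itv R)) => x x01; rewrite (add k x x01) rotationD.
have -> : 1 + k%:Z = k.+1%:Z by lia.
have -> : \1_B' (rotation a k x) = \1_B x :> R.
  rewrite !indicE; congr (_%:R); apply: (congr1 nat_of_bool).
  by apply/idP/idP; rewrite !inE /B' /= rotationK.
ring.
Qed.

End test_functions.

(** * The relaxed dual value and the decomposition of an optimizer *)

Section dual_optimizers.
Context (R : realType).
Local Notation RR := (measurableTypeR R).
Local Notation mu := (unif01 R).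
Local Notation a := (alpha R).
Local Notation tau := (@jump R).
Local Notation T := (rotation_tau a tau).
Variables (bij0 : mp_bijection (id : R -> R)) (bij1 : mp_bijection (rotation a 1))
          (bijtau : mp_bijection T).
Local Notation pi0 := (graph_plan (mpb_measurable bij0)).
Local Notation pi1 := (graph_plan (mpb_measurable bij1)).
Local Notation pitau := (graph_plan (mpb_measurable bijtau)).
Local Notation h := (hfun a).
Local Notation c := (cost a tau).
Local Notation pi := (mean3 pi0 pi1 pitau).
Local Notation G0 := (graph01 (id : R -> R)).
Local Notation G1 := (graph01 (rotation a 1)).
Local Notation Gtau := (graph01 T).
Local Notation hr := (fine \o h).

Let piT : pi setT = 1%E := pi_setT bij0 bij1 bijtau.

Lemma measurable_hr : measurable_fun setT hr.
Proof. by apply: measurableT_comp => //; exact: measurable_hfun. Qed.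

Lemma h_bounds : {ae pi, forall z, [/\ h z \is a fin_num, 0 <= hr z & hr z <= 2]}.
Proof.
apply: mean3_ae.
- by apply: (ae_imply (h_ae0 bij0)) => z /= ->; split => //=; lra.
- apply: (ae_imply (h_ae1 bij1)) => z /= ->; rewrite /fsgn.
  by case: ifP => _; split => //=; rewrite intrD ?intrN; lra.
- by apply: (ae_imply (h_aetau bijtau)) => z /= ->; split => //=; lra.
Qed.

Lemma Loo_hr : Loo pi hr.
Proof.
apply: (LooI piT (M := 2) measurable_hr).
by apply: (ae_imply h_bounds) => z [_ h0 h2]; rewrite ger0_norm.
Qed.

(** The cocycle relation of [rho]: the sign added at y is h(y, y + alpha) - h(y, y), because h is 1
    on the diagonal. Identities proved for orbit additive functions thereby apply to phi (+) psi and
    to h alike. *)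
Lemma orbit_additive_hr : orbit_additive bij0 bij1 bijtau hr.
Proof.
split.
- by have L := L1_Loo piT Loo_hr.
- move=> k; apply: (L1_Loo (unif01_setT R)).
  apply: (LooI (unif01_setT R) (M := k%:R + 1)).
    apply: measurableT_comp measurable_hr _.
    by apply: measurable_graph_map; exact: measurable_rotation.
  apply: (ae_imply (ae_itv R)) => x x01 /=; rewrite hfunE //=.
  elim: k => [|k IH]; first by rewrite rho0 normr1 add0r.
  rewrite rhoS intrD (le_trans (ler_normD _ _)) // -natr1 lerD //.
  by rewrite /fsgn; case: ifP => _; rewrite ?normr1 // intrN normrN normr1.
move=> k x x01 /=; have y01 := rotation_itv a k x.
rewrite !hfunE //= hfun_id //=.
have -> : rotation a k.+1 x = rotation a 1 (rotation a k x).
  by rewrite rotationD; congr rotation; lia.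
by rewrite hfun_rotation //= rhoS !intrD; ring.
Qed.

Lemma orbit_additive_oplus phi psi : L1 mu phi -> L1 mu psi ->
  orbit_additive bij0 bij1 bijtau (oplus phi psi).
Proof.
move=> Lphi Lpsi; split.
- by have := L1_oplus (couplings_pi bij0 bij1 bijtau) Lphi Lpsi.
- move=> k; have [Lr _] := rotation_L1 k Lpsi.
  by have := L1_lin 1 Lphi Lr; congr L1; apply/funext => x; rewrite mul1r.
- by move=> k x x01; rewrite /oplus /=; ring.
Qed.

Lemma oplus_rotation_integral phi psi k : L1 mu phi -> L1 mu psi ->
  \int[mu]_x oplus phi psi (x, rotation a k x) = \int[mu]_x phi x + \int[mu]_x psi x.
Proof.
move=> Lphi Lpsi; have [Lr <-] := rotation_L1 k Lpsi.
have := Rintegral_lin 1 Lphi Lr; rewrite mul1r => <-.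
by apply: eq_Rintegral => x _; rewrite mul1r.
Qed.

Lemma oplus_pi_integral phi psi : L1 mu phi -> L1 mu psi ->
  \int[pi]_z oplus phi psi z = \int[mu]_x phi x + \int[mu]_x psi x.
Proof.
move=> Lphi Lpsi; have [_ E] := coupling_oplus (couplings_pi bij0 bij1 bijtau) Lphi Lpsi.
by rewrite /Rintegral E.
Qed.

Lemma hr_pi0 : \int[mu]_x hr (x, x) = 1.
Proof.
transitivity (\int[mu]_x (1 : R)); last by rewrite Rintegral_cst // mul1r [X in fine X]unif01_setT.
apply: ae_eq_Rintegral => //.
  by apply: measurableT_comp measurable_hr _; exact: measurable_graph_map.
by apply: (ae_imply (ae_itv R)) => x x01 /=; rewrite hfun_id.
Qed.

Lemma hr_pi1 : \int[mu]_x hr (x, rotation a 1 x) = 1.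
Proof.
have mr := measurable_rotation a 1.
have [_ Lk _] := orbit_additive_hr.
rewrite -(graph_plan_Rintegral (mpb_measurable bij1) mr measurable_hr (Lk 1%N)).
rewrite /Rintegral -[RHS]/(fine 1%:E) -(cost_pi1 bij1); congr fine.
apply: ae_eq_integral => //.
- by apply/measurable_EFinP; exact: measurable_hr.
- exact: measurable_cost.
- by apply: (ae_imply2 (h_ae1 bij1) (c_ae1 bij1)) => z /= -> ->.
Qed.

Lemma relaxed_ge1 e : 0 < e -> (1 <= relaxed_dual_value mu mu pi c e)%E.
Proof.
move=> e0.
have cv : (\int[mu]_x dual_phi n.+1 x + \int[mu]_y dual_psi n.+1 y)%:E @[n --> \oo] --> (1%:E : \bar R).
  by apply: cvg_EFin; [exact: nearW|exact: dual_integral_cvg].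
rewrite -(cvg_lim _ cv) //; apply: lime_le; first by apply/cvg_ex; exists 1%:E.
apply: nearW => n; apply: ereal_sup_ubound; exists (dual_phi n.+1), (dual_psi n.+1); split => //.
- exact: L1_dual_phi.
- exact: L1_dual_psi.
rewrite integral0_eq ?lee_fin ?ltW // => -[x y] _; apply/max_idPr.
by rewrite sube_le0; exact: dual_le_cost.
Qed.

(** Weak duality along [pi0], whose cost is 1; as [pi0] <= 3 [pi], an excess of e for [pi] is at
    most 3 e for [pi0]. *)
Lemma relaxed_le e : (relaxed_dual_value mu mu pi c e <= 1 + 3%:E * e%:E)%E.
Proof.
apply: ge_ereal_sup => _ [phi [psi [Lphi Lpsi le ->]]].
have cpl := couplings_graph_plan bij0.
apply: le_trans (relaxed_weak_duality cpl Lphi Lpsi (@measurable_cost R) (@cost_ge0 R)) _.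
rewrite cost_pi0; apply: leeD => //.
have mo : measurable_fun setT (EFin \o oplus phi psi).
  have [i _] := coupling_oplus cpl Lphi Lpsi; exact: measurable_int i.
have mm : measurable_fun setT (fun z => maxe ((oplus phi psi z)%:E - c z) 0)%E.
  by apply: measurable_maxe => //; apply: emeasurable_funB => //; exact: measurable_cost.
have m0 z : (0 <= maxe ((oplus phi psi z)%:E - c z) 0)%E by rewrite le_max lexx orbT.
apply: (@le_trans _ _ (3%:E * \int[pi]_z maxe ((oplus phi psi z)%:E - c z) 0)%E); last first.
  by rewrite lee_wpmul2l.
rewrite mean3_integral // muleA -EFinM divff // mul1e -addeA leeDl //.
by rewrite adde_ge0 // integral_ge0.
Qed.

Lemma dual_value1 : dual_value mu mu pi c = 1%E.
Proof.
apply: cvg_lim => //.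
apply: (@squeeze_cvge _ _ _ _ (fun=> 1%E) _ (fun e => (1 + 3%:E * e%:E)%E)).
- near=> e; rewrite relaxed_le andbT; apply: relaxed_ge1.
  by near: e; exact: nbhs_right_gt.
- exact: cvg_cst.
have : (1 + 3 * e : R) @[e --> 0^'+] --> (1 + 3 * 0 : R).
  apply: cvgD; first exact: cvg_cst.
  by apply: cvgMr; apply: cvg_at_right_filter; exact: cvg_id.
rewrite mulr0 addr0 => cv.
by apply: cvg_EFin; [exact: nearW|exact: cv].
Unshelve. all: by end_near. Qed.

Section optimizer.
Variables (H Hs : (R * R -> R) -> R) (r : R * R -> R).
Hypotheses (optH : dual_optimizer mu mu pi c H) (Lr : L1 pi r).
Hypotheses (singHs : purely_singular pi Hs)
  (HE : forall g, Loo pi g -> H g = L1_embed pi r g + Hs g).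

Let bidualH : L1_bidual pi H. Proof. by have [] := optH. Qed.

Let subH : subspace_bidual pi (L1S mu mu pi) H. Proof. by have [] := optH. Qed.

Let H1 : H (cst 1) = 1.
Proof. by have [_ _ _] := optH; rewrite dual_value1 => -[]. Qed.

Let leH : L1_bidual_le pi H (L1_embed pi hr).
Proof.
have [_ _ le _] := optH => g Lg g0; rewrite (le_trans (le g Lg g0)) // le_eqVlt.
apply/orP; left; apply/eqP; apply: ae_eq_Rintegral.
- apply: measurable_funM; last exact: Loo_measurable Lg.
  by apply: measurableT_comp => //; exact: measurable_cost.
- by apply: measurable_funM; [exact: measurable_hr|exact: Loo_measurable Lg].
- by apply: (ae_imply (c_ae_h bij0 bij1 bijtau)) => z /= ->.
Qed.

Local Notation Q := (defect pi H hr).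

(** Numbered so that [piece k] lies on the graph of the rotation by k alpha. *)
Definition piece (i : nat) : set (RR * RR) :=
  if i is i'.+1 then (if i' is j.+1 then Gtau `&` fst @^-1` (@jump_piece R j) else G1) else G0.

Lemma measurable_piece i : measurable (piece i).
Proof.
case: i => [|[|j]]; [exact: measurable_id_graph|exact: measurable_rotation_graph|].
apply: measurableI; first exact: measurable_jump_graph.
rewrite -[X in measurable X]setTI; apply: measurable_fst => //.
exact: measurable_jump_piece.
Qed.

Lemma piece_cover : {ae pi, forall z, exists i, piece i z}.
Proof.
apply: mean3_ae.
- by apply: pi0_ae; apply: aeW => x x01; exists 0%N.
- by apply: pi1_ae; apply: aeW => x x01; exists 1%N.
- apply: pitau_ae; apply: aeW => x x01 Nx.
  by have [j mj] := nonexceptional_matched x01 Nx; exists j.+2.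
Qed.

Let indic_cst (G : set (RR * RR)) : \1_G = on_graph G setT :> (RR * RR -> R).
Proof. by rewrite /on_graph preimage_setT setIT. Qed.

(** Against phi (+) psi, the indicator of G and the constant 1/3 both give a third of the sum of the
    two integrals, so H takes the value 1/3 on both. The integral of h over G is also 1/3, since h
    has integral 1 along [pi0] and [pi1]. *)
Let defect_graph (G : set (RR * RR)) : measurable G ->
  (forall f, orbit_additive bij0 bij1 bijtau f -> \int[pi]_z (f z * \1_G z) =
     3^-1 * \int[mu]_x f (x, x)) \/
  (forall f, orbit_additive bij0 bij1 bijtau f -> \int[pi]_z (f z * \1_G z) =
     3^-1 * \int[mu]_x f (x, rotation a 1 x)) -> Q \1_G = 0.
Proof.
move=> mG E.
have b1 (z : RR * RR) : `|\1_G z : R| <= 1.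
  by rewrite indicE; case: (_ \in _); rewrite ?normr1 ?normr0.
have b2 (z : RR * RR) : `|cst (3^-1 : R) z| <= 1.
  by rewrite /= ger0_norm ?invr_ge0 // invf_le1 // ler1n.
have eqH : H \1_G = H (cst 3^-1).
  apply: (subspace_bidual_eq (couplings_pi bij0 bij1 bijtau) subH _ _ b1 b2) => //.
  move=> phi psi Lphi Lpsi.
  have oa := orbit_additive_oplus Lphi Lpsi.
  have -> : \int[pi]_z (oplus phi psi z * cst 3^-1 z) = 3^-1 * (\int[mu]_x phi x + \int[mu]_x psi x).
    rewrite -(oplus_pi_integral Lphi Lpsi) -RintegralZl //.
      by apply: eq_Rintegral => z _; rewrite mulrC.
    by apply: L1_int; have [] := oa.
  case: E => ->//; congr (_ * _); last exact: oplus_rotation_integral.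
  rewrite -(oplus_rotation_integral 0 Lphi Lpsi); apply: ae_eq_Rintegral.
  - by have [/L1_graphs[/L1_measurable]] := oa.
  - by have [_ Lk _] := oa; exact: L1_measurable (Lk 0%N).
  - by apply: (ae_imply (ae_itv R)) => x x01; rewrite rotation0.
have H0 : H (cst 0) = 0.
  have e := bidual_lin bidualH 1 (Loo_cst piT 0) (Loo_cst piT 0).
  have {}e : H (cst 0) = 1 * H (cst 0) + H (cst 0).
    by apply: etrans e; congr H; apply/funext => z /=; rewrite mulr0 addr0.
  lra.
have H3 : H (cst 3^-1) = 3^-1.
  have e := bidual_lin bidualH (3^-1 : R) (Loo_cst piT 1) (Loo_cst piT 0).
  have {}e : H (cst 3^-1) = 3^-1 * H (cst 1) + H (cst 0).
    by apply: etrans e; congr H; apply/funext => z /=; rewrite mulr1 addr0.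
  by rewrite e H0 H1 mulr1 addr0.
rewrite /defect eqH H3 /L1_embed.
by case: E => ->; rewrite ?hr_pi0 ?hr_pi1 ?mulr1 ?subrr //; exact: orbit_additive_hr.
Qed.

Let mul_indicT (g : R -> R) : \int[mu]_x (g x * \1_[set: RR] x) = \int[mu]_x g x.
Proof. by apply: eq_Rintegral => x _; rewrite indicE in_setT mulr1. Qed.

Let defect_G0 : Q \1_G0 = 0.
Proof.
apply: defect_graph; first exact: measurable_id_graph.
left=> f [Lf _ _]; rewrite indic_cst pairing_G0 //; first by rewrite mul_indicT.
by have [/L1_measurable] := L1_graphs Lf.
Qed.

Let defect_G1 : Q \1_G1 = 0.
Proof.
apply: defect_graph; first exact: measurable_rotation_graph.
right=> f [Lf _ _]; rewrite indic_cst pairing_G1 //; first by rewrite mul_indicT.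
by have [_ /L1_measurable] := L1_graphs Lf.
Qed.

Let Loo_G0 : Loo pi \1_G0 := Loo_indic piT (@measurable_id_graph R).
Let Loo_G1 : Loo pi \1_G1 := Loo_indic piT (@measurable_rotation_graph R 1).

Let defect_G01 : Q (fun z => \1_G0 z + \1_G1 z) = 0.
Proof.
have := defect_lin piT bidualH Loo_hr 1 Loo_G0 Loo_G1.
rewrite defect_G0 defect_G1 mulr0 addr0 => <-.
by congr (Q _); apply/funext => z; rewrite mul1r.
Qed.

Let Loo_G01 : Loo pi (fun z => \1_G0 z + \1_G1 z).
Proof.
by have := Loo_lin piT 1 Loo_G0 Loo_G1; congr Loo; apply/funext => z; rewrite mul1r.
Qed.

(** The weight w of [transport_weight] is dominated by the indicators of Gamma_0 and Gamma_1, so its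
    defect vanishes. It pairs with phi (+) psi and with h exactly as the indicator of the piece
    does, so both terms of the defect coincide for the two functions. *)
Lemma defect_piece i : Q \1_(piece i) = 0.
Proof.
case: i => [|[|j]]; [exact: defect_G0|exact: defect_G1|].
have mB := @measurable_jump_piece R j.
have [w [M [mw wM wG fw]]] := transport_weight bij0 bij1 bijtau j.+2 mB.
have Lw := LooI_bounded piT mw wM.
have Qw : Q w = 0.
  apply: (defect_eq0 piT bidualH Loo_hr leH Lw Loo_G01 defect_G01 (M := M)).
  exact: aeW.
have E f : orbit_additive bij0 bij1 bijtau f ->
   \int[pi]_z (f z * \1_(piece j.+2) z) = \int[pi]_z (f z * w z).
  move=> oa; have [Lf Lk _] := oa; rewrite fw //.
  by rewrite -[LHS]/(\int[pi]_z (f z * on_graph Gtau (@jump_piece R j) z)) pairing_Gtau //;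
    exact: L1_measurable (Lk j.+2).
have b1 (z : RR * RR) : `|\1_(piece j.+2) z : R| <= Num.max 1 M.
  by rewrite le_max indicE; case: (_ \in _); rewrite ?normr1 ?normr0 ?lexx ?ler01.
have b2 (z : RR * RR) : `|w z| <= Num.max 1 M by rewrite le_max wM orbT.
have eqH : H \1_(piece j.+2) = H w.
  apply: (subspace_bidual_eq (couplings_pi bij0 bij1 bijtau) subH _ mw b1 b2).
    by apply: measurable_indic; exact: measurable_piece.
  by move=> phi psi Lphi Lpsi; rewrite E //; exact: orbit_additive_oplus.
by rewrite -Qw /defect eqH /L1_embed E //; exact: orbit_additive_hr.
Qed.

Lemma optimizer_regular : {ae pi, forall z, (r z)%:E = h z}.
Proof.
have := regular_part piT bidualH Loo_hr leH Lr singHs HE measurable_piece defect_piece piece_cover.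
move=> rh; apply: (ae_imply2 rh h_bounds) => z -> [fz _ _].
by rewrite /= fineK.
Qed.

Let singular g : Loo pi g -> Hs g = Q g.
Proof.
have S := singular_part piT bidualH Loo_hr leH Lr singHs HE measurable_piece defect_piece piece_cover.
by move=> Lg; apply: S.
Qed.

Lemma hr_pi : L1_embed pi hr (cst 1) = 4 / 3.
Proof.
rewrite /L1_embed -[RHS]/(fine (4 / 3)%:E) -(cost_pi bij0 bij1 bijtau) /Rintegral; congr fine.
apply: ae_eq_integral => //.
- apply/measurable_EFinP; apply: measurable_funM => //; exact: measurable_hr.
- exact: measurable_cost.
- by apply: (ae_imply2 (c_ae_h bij0 bij1 bijtau) h_bounds) => z /= -> [fz _ _] _; rewrite mulr1 fineK.
Qed.

(** The defect of the constant 1 is 1 - 4/3, the dual value minus the integral of h. *)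
Lemma optimizer_norm : (3%:E * L1_bidual_norm pi Hs = 1)%E.
Proof.
rewrite (singular_norm piT bidualH Loo_hr leH Lr singHs HE measurable_piece defect_piece piece_cover).
by rewrite /defect H1 hr_pi -EFinM; congr EFin; field.
Qed.

Lemma optimizer_nonzero : exists2 g, Loo pi g & Hs g != 0.
Proof.
exists (cst 1); first exact: Loo_cst.
rewrite singular; last exact: Loo_cst.
by rewrite /defect H1 hr_pi; apply/eqP; lra.
Qed.

Lemma optimizer_support : Hs (\1_G0 + \1_G1) = 0.
Proof. by rewrite singular. Qed.

End optimizer.
End dual_optimizers.

Theorem mainTheorem1 (R : realType) :
  exists (alpha : R) (tau : R -> int),
  [/\ 0 <= alpha < 1, irrational alpha &
  (* (i) *)
  exists (bij0 : mp_bijection (id : R -> R))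
         (bij1 : mp_bijection (rotation alpha 1))
         (bijtau : mp_bijection (rotation_tau alpha tau)),
  let h := hfun alpha in
  let c := cost alpha tau in
  let mu := unif01 R in
  let pi0 := graph_plan (mpb_measurable bij0) in
  let pi1 := graph_plan (mpb_measurable bij1) in
  let pitau := graph_plan (mpb_measurable bijtau) in
  let pi := mean3 pi0 pi1 pitau in
  [/\ [/\ couplings mu mu pi0, couplings mu mu pi1 & couplings mu mu pitau],
  (* (ii) *)
  [/\ optimal mu mu c pi0 /\ optimal mu mu c pi1,
      ~ optimal mu mu c pitau,
      (\int[pi0]_z c z = 1)%E /\ (\int[pi1]_z c z = 1)%E,
      (\int[pitau]_z h z <= \int[pitau]_z c z)%E &
      (1 < \int[pitau]_z h z)%E],
  (* (iii) *)
  (exists phi psi : nat -> R -> R,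
    [/\ forall n, bounded_Borel (phi n) /\ bounded_Borel (psi n),
        forall n x y, 0 <= x < 1 -> 0 <= y < 1 ->
          ((phi n x + psi n y)%:E <= c (x, y))%E,
        (\int[mu]_x phi n x + \int[mu]_y psi n y) @[n --> \oo] --> (1 : R) &
        {ae pi, forall z,
          (phi n z.1 + psi n z.2)%:E @[n --> \oo] --> h z}]) &
  (* (iv); L1(pi)** and dual optimizers presuppose that c is pi-integrable *)
  (\int[pi]_z c z < +oo)%E /\
  (forall H Hs : (R * R -> R) -> R, forall r : R * R -> R,
     dual_optimizer mu mu pi c H ->
     L1 pi r -> purely_singular pi Hs ->
     (forall g, Loo pi g -> H g = L1_embed pi r g + Hs g) ->
     [/\ {ae pi, forall z, (r z)%:E = h z},
         (* 3 because pi is normalized by 1/3: |<Hs, pitau>| = 3 ||Hs||,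
            as pitau has density 3 w.r.t. pi where graph tau is not met by
            the other two graphs. *)
         (3%:E * L1_bidual_norm pi Hs = \int[pitau]_z h z - 1)%E,
         (0 < \int[pitau]_z h z - 1)%E,
         (exists2 g, Loo pi g & Hs g != 0) &
         Hs (\1_(graph01 id) + \1_(graph01 (rotation alpha 1))) = 0])]].
Proof.
exists (alpha R), (@jump R); split; [exact: alpha_itv|exact: irrational_alpha|].
exists (mp_bijection_id R), (mp_bijection_rotation R 1), (mp_bijection_jump R).
(* The plans depend on the witnesses through their measurability proofs; abstracting the witnesses
   matches the lemmas, which hold for any of them. *)
move: (mp_bijection_id R) (mp_bijection_rotation R 1) (mp_bijection_jump R).
move=> bij0 bij1 bijtau h c mu pi0 pi1 pitau pi.
have hE : (\int[pitau]_z h z = 2)%E by exact: h_pitau.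
have c0 : couplings mu mu pi0 by exact: couplings_graph_plan.
have c1 : couplings mu mu pi1 by exact: couplings_graph_plan.
have ctau : couplings mu mu pitau by exact: couplings_graph_plan.
have e0 : (\int[pi0]_z c z = 1)%E by exact: cost_pi0.
have e1 : (\int[pi1]_z c z = 1)%E by exact: cost_pi1.
have etau : (\int[pitau]_z c z = 2)%E by exact: cost_pitau.
have h1 : (2 - 1 = 1 :> \bar R)%E by rewrite -EFinB; congr EFin; ring.
split.
- by [].
- split => //.
  + by split; split => // sigma cs; rewrite ?e0 ?e1; exact: cost_optimal_value.
  + by move=> [_ /(_ _ c0)]; rewrite e0 etau leNgt lte_fin ltr1n.
  + by rewrite hE etau.
  + by rewrite hE lte_fin ltr1n.
- exists (fun n => dual_phi n.+1), (fun n => dual_psi n.+1); split.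
  + by move=> n; split; [exact: bounded_Borel_dual_phi|exact: bounded_Borel_dual_psi].
  + by move=> n x y _ _; exact: dual_le_cost.
  + exact: dual_integral_cvg.
  + exact: dual_ae_cvg.
split; first by rewrite cost_pi ltry.
move=> H Hs r optH Lr sing HE; rewrite hE h1; split.
- exact: optimizer_regular optH Lr sing HE.
- exact: optimizer_norm optH Lr sing HE.
- by rewrite lte01.
- exact: optimizer_nonzero optH Lr sing HE.
- exact: optimizer_support optH Lr sing HE.
Qed.
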